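(* Let $X=\mathbb{R}\times\mathbb{Z}(2)$ and let $\xi_1,\dots,\xi_n$ be independent random variables with values in $X$ and with distributions $\mu_{\xi_1},\dots,\mu_{\xi_n}$ whose characteristic functions $\widehat\mu_{\xi_j}$ do not vanish anywhere on the character group of $X$. Let $a_j,b_j,c_j,d_j$ $(j=1,\dots,n)$ be continuous endomorphisms of $X$, and consider the linear forms $$L_1=a_1\xi_1+\cdots+a_n\xi_n,\quad L_2=b_1\xi_1+\cdots+b_n\xi_n,\quad L_3=c_1\xi_1+\cdots+c_n\xi_n,\quad L_4=d_1\xi_1+\cdots+d_n\xi_n.$$ Suppose that the random vectors $(L_1,L_2)$ and $(L_3,L_4)$ (with values in $X\times X$) are identically distributed. Then the following statements hold. (1) For every $i\in\{1,\dots,n\}$ such that $a_id_j-b_ic_j\in \mathrm{Aut}(X)$ for all $j=1,\dots,n$, one has $\mu_{\xi_i}\in\Gamma(X)$. (2) For every $i\in\{1,\dots,n\}$ such that $a_i'd_j'-b_i'c_j'\neq 0$ for all $j=1,\dots,n$ and at least one of the numbers $a_i'',b_i''$ is equal to $1$, one has $\mu_{\xi_i}\in\Theta(X)$. (3) For every $i\in\{1,\dots,n\}$ such that $a_i'd_j'-b_i'c_j'\neq 0$ for all $j=1,\dots,n$, one has $\mu_{\xi_i}\in\Lambda(X)$.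
   Context: $\mathbb{Z}(2)=\{0,1\}$ is the cyclic group of order 2 (discrete), and $X=\mathbb{R}\times\mathbb{Z}(2)$ is a locally compact Abelian group with elements written $(t,k)$, $t\in\mathbb{R}$, $k\in\mathbb{Z}(2)$. Its character group $Y$ is identified with $\mathbb{R}\times\mathbb{Z}(2)$, with elements written $(s,l)$, and pairing $((t,k),(s,l))=e^{its}(-1)^{kl}$. For a Borel probability measure $\mu$ on $X$ (the set of these is denoted $M^1(X)$) the characteristic function is $\widehat\mu(y)=\int_X (x,y)\,d\mu(x)$, $y\in Y$; we write $\widehat\mu(s,l)$ for $y=(s,l)$. $\mathrm{End}(X)$ is the ring of continuous endomorphisms of $X$ (pointwise addition, composition as product) and $\mathrm{Aut}(X)$ the group of topological automorphisms. Every continuous endomorphism $a$ of $X$ has the form $a(t,k)=(a't,a''k)$ with $a'\in\mathbb{R}$ and $a''\in\{0,1\}$; the notation $a_j',a_j'',b_j',b_j'',c_j',c_j'',d_j',d_j''$ refers to this representation. Such an $a$ is in $\mathrm{Aut}(X)$ exactly when $a'\neq0$ and $a''=1$ (arithmetic in the second component is modulo 2). Classes of distributions: - $\Gamma(X)$ (Gaussian distributions): all $\gamma\in M^1(X)$ with $\widehat\gamma(y)=(x,y)\exp\{-\varphi(y)\}$ for all $y\in Y$, where $x\in X$ is fixed and $\varphi:Y\to[0,\infty)$ is continuous and satisfies $\varphi(u+v)+\varphi(u-v)=2[\varphi(u)+\varphi(v)]$ for all $u,v\in Y$. (Degenerate distributions are included.) - $\Theta(X)$: all $\mu\in M^1(X)$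 for which there exist real numbers $\sigma,\sigma',\beta,\beta',\kappa$ such that $$\widehat\mu(s,0)=\exp\{-\sigma s^2+i\beta s\},\qquad \widehat\mu(s,1)=\kappa\exp\{-\sigma' s^2+i\beta' s\},\qquad s\in\mathbb{R},$$ where either $0<\sigma'<\sigma$ and $0<|\kappa|\le\sqrt{\sigma'/\sigma}\,\exp\left\{-\frac{(\beta-\beta')^2}{4(\sigma-\sigma')}\right\}$, or $\sigma=\sigma'\ge0$, $\beta=\beta'$ and $|\kappa|\le1$. - $\Lambda(X)$: all $\mu\in M^1(X)$ such that $s\mapsto\widehat\mu(s,0)$ is the characteristic function of a Gaussian distribution on the real line, possibly degenerate. *)

(* Defs.v *)
From HB Require Import structures.
From mathcomp Require Import all_boot all_order all_algebra.
From mathcomp Require Import all_classical all_reals all_analysis.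
From mathcomp.real_closed Require Import complex.

Set Implicit Arguments.
Unset Strict Implicit.
Unset Printing Implicit Defensive.

Import Order.TTheory GRing.Theory Num.Theory.
Import numFieldNormedType.Exports.

Local Open Scope classical_set_scope.
Local Open Scope complex_scope.
Local Open Scope ring_scope.

(* Z(2) is [bool]: its library ring structure is that of F_2 (0 = false,
   1 = true, sum [addb], product [andb]), its topology is discrete and all its
   subsets are measurable. [R * bool] carries the product group structure,
   topology and sigma-algebra (which is the Borel one); it serves both as the
   group X and as its character group Y. *)
Notation XG R := (R * bool)%type.

Section complex_valued.
Context {R : realType}.

Definition cexp (z : R[i]) : R[i] :=
  (expR (complex.Re z) * cos (complex.Im z))
    +i* (expR (complex.Re z) * sin (complex.Im z)).

Definition cintegral {d : measure_display} {T : measurableType d}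
    (mu : probability T R) (f : T -> R[i]) : R[i] :=
  (\int[mu]_x complex.Re (f x))%R +i* (\int[mu]_x complex.Im (f x))%R.

End complex_valued.

Section characteristic_functions.
Context {R : realType}.

Definition pairing (x y : XG R) : R[i] :=
  cexp (0 +i* (x.1 * y.1)) * (-1) ^+ (x.2 && y.2).

Definition charX (mu : probability (XG R) R) (y : XG R) : R[i] :=
  cintegral mu (fun x => pairing x y).

Definition charR (nu : probability R R) (s : R) : R[i] :=
  cintegral nu (fun t => cexp (0 +i* (t * s))).

End characteristic_functions.

Section classes.
Context {R : realType}.

Definition Gamma (mu : probability (XG R) R) : Prop :=
  exists (x : XG R) (phi : XG R -> R),
    [/\ forall y, 0 <= phi y,
        continuous phi,
        forall u v, phi (u + v) + phi (u - v) = 2 * (phi u + phi v) &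
        forall y, charX mu y = pairing x y * (expR (- phi y))%:C].

Definition Theta (mu : probability (XG R) R) : Prop :=
  exists sigma sigma' beta beta' kappa : R,
    [/\ forall s, charX mu (s, 0) = cexp ((- (sigma * s ^+ 2)) +i* (beta * s)),
        forall s, charX mu (s, 1) =
          kappa%:C * cexp ((- (sigma' * s ^+ 2)) +i* (beta' * s)) &
        [/\ 0 < sigma', sigma' < sigma, 0 < `|kappa| &
            `|kappa| <= Num.sqrt (sigma' / sigma) *
              expR (- ((beta - beta') ^+ 2 / (4 * (sigma - sigma'))))]
        \/ [/\ sigma = sigma', 0 <= sigma, beta = beta' & `|kappa| <= 1]].

(* [normal_prob m s] is only the normal law for [s != 0]; the degenerate
   Gaussian distributions are the Dirac masses. *)
Definition gaussianR (nu : probability R R) : Prop :=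
  (exists m s : R, s != 0 /\
     forall A : set R, measurable A -> nu A = normal_prob m s A)
  \/ (exists m : R, forall A : set R, measurable A -> nu A = \d_m A).

Definition Lambda (mu : probability (XG R) R) : Prop :=
  exists2 nu : probability R R, gaussianR nu &
    forall s, charX mu (s, 0) = charR nu s.

End classes.

Section endomorphisms.
Context {R : realType}.

Definition is_End (a : XG R -> XG R) : Prop :=
  continuous a /\ (forall x y, a (x + y) = a x + a y).

Definition is_Aut (a : XG R -> XG R) : Prop :=
  is_End a /\ exists b, [/\ continuous b, cancel a b & cancel b a].

(* The numbers a' and a'' of the representation a(t, k) = (a' t, a'' k),
   see [is_EndE]. *)
Definition fst_coef (a : XG R -> XG R) : R := (a (1, 0)).1.
Definition snd_coef (a : XG R -> XG R) : bool := (a (0, 1)).2.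

End endomorphisms.

Lemma continuous_additive_linear (R : realType) (f : R -> R) :
  continuous f -> (forall x y, f (x + y) = f x + f y) ->
  forall x, f x = f 1 * x.
Proof.
move=> cf fD.
have f0 : f 0 = 0 by apply: (@addrI _ (f 0)); rewrite -fD !addr0.
have fN x : f (- x) = - f x.
  by apply: (@addrI _ (f x)); rewrite -fD !subrr.
have fn n x : f (n%:R * x) = n%:R * f x.
  elim: n => [|n IH]; first by rewrite !mul0r.
  by rewrite -natr1 !mulrDl !mul1r fD IH.
have fz (z : int) x : f (z%:~R * x) = z%:~R * f x.
  by case: z => n; rewrite ?NegzE ?mulrNz ?mulNr ?fN -pmulrn fn.
have fq (q : rat) : f (ratr q) = f 1 * ratr q.
  have d0 : (denq q)%:~R != 0 :> R by rewrite intr_eq0 denq_neq0.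
  have dq : (denq q)%:~R * ratr q = (numq q)%:~R * 1 :> R.
    by rewrite /ratr mulrCA divff.
  by apply: (mulfI d0); rewrite -fz dq fz mulrCA dq mulr1 mulrC.
move=> x; apply/eqP; rewrite -subr_eq0; apply/negPn/negP => gx.
pose g y := f y - f 1 * y.
have cg : continuous g.
  by move=> y; apply: cvgB; [exact: cf|apply: cvgM; [exact: cvg_cst|exact: cvg_id]].
have og : open (g @^-1` [set y | y != 0]).
  by apply: open_comp => [y _|]; [exact: cg|exact: open_neq].
have [|y [/= gy [q _ qy]]] := dense_rat _ og; first by exists x.
by move: gy; rewrite /g -qy fq subrr eqxx.
Qed.

Lemma is_EndE (R : realType) (a : XG R -> XG R) : is_End a ->
  forall t k, a (t, k) = (fst_coef a * t, snd_coef a * k).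
Proof.
move=> [ca aD] t k.
have a0 : a 0 = 0 by apply: (@addrI _ (a 0)); rewrite -aD !addr0.
have -> : (t, k) = (t, 0) + (0, k) :> XG R by congr pair; rewrite ?addr0 ?add0r.
have k1 : (a (0, k)).1 = 0.
  have : (a ((0, k) + (0, k))).1 = 0.
    suff -> : (0, k) + (0, k) = 0 :> XG R by rewrite a0.
    by congr pair; [rewrite addr0 | case: (k)].
  by rewrite aD /= => /eqP; rewrite -mulr2n mulrn_eq0 /= => /eqP.
have k2 : (a (0, k)).2 = snd_coef a * k.
  by rewrite /snd_coef; case: k {k1}; [rewrite mulr1|rewrite mulr0 a0].
have t2 : (a (t, 0)).2 = 0.
  have -> : (t, 0) = (t / 2, 0) + (t / 2, 0) :> XG R.
    by congr pair; rewrite -splitr.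
  by rewrite aD /=; case: (_.2).
have t1 : (a (t, 0)).1 = fst_coef a * t.
  apply: (@continuous_additive_linear R (fun s => (a (s, 0)).1)).
    move=> s; have cs : (fun u : R => (u, 0) : XG R) @ s --> ((s, 0) : XG R).
      apply: (@cvg_pair _ _ _ (nbhs s) (nbhs s) (nbhs (0 : bool)) _ _ _ id
        (fun=> 0)); [exact: cvg_id|exact: cvg_cst].
    have cas := cvg_comp _ _ cs (ca (s, 0)).
    by apply: cvg_comp cas _ => A; case: (a (s, 0)) => u v; exact: cvg_fst.
  move=> x y; have -> : (x + y, 0) = (x, 0) + (y, 0) :> XG R by congr pair.
  by rewrite aD.
rewrite aD; congr pair => /=; first by rewrite t1 k1 addr0.
by rewrite t2 k2 add0r.
Qed.

Section random_variables.
Context {R : realType} {d : measure_display} {T : measurableType d}.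
Variable P : probability T R.

Definition independent_RVs {n : nat} {d' : measure_display}
    {T' : measurableType d'} (xi : 'I_n -> {RV P >-> T'}) : Prop :=
  forall (J : {set 'I_n}) (B : 'I_n -> set T'),
    (forall j, measurable (B j)) ->
    P (\bigcap_(j in [set` J]) (xi j @^-1` B j)) =
      (\prod_(j in J) P (xi j @^-1` B j))%E.

Definition identically_distributed {d' : measure_display}
    {T' : measurableType d'} (U V : T -> T') : Prop :=
  forall A : set T', measurable A -> pushforward P U A = pushforward P V A.

Definition linear_form {n : nat} (a : 'I_n -> XG R -> XG R)
    (xi : 'I_n -> T -> XG R) (w : T) : XG R :=
  \sum_(j < n) a j (xi j w).

End random_variables.

(* Main.v *)
(* If (L_1, L_2) and (L_3, L_4) have the same law, the characteristic functions
   f_j of the xi_j satisfy, with a~ the adjoint of a,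
     prod_j f_j (a~_j u + b~_j v) = prod_j f_j (c~_j u + d~_j v).
   Differencing the logarithm of the modulus on a fixed level of Z(2) along
   suitable directions kills every ridge function that is not parallel to the
   i-th one, so by Frechet the product of the |f_j|^2 over the parallel indices
   is the exponential of a polynomial. On level 0 such a factor has finite
   exponential moments, hence is an entire function without zeros and of finite
   order, hence the exponential of a polynomial (Hadamard), whose degree is at
   most 2 (Marcinkiewicz). This gives (3), and the growth bound obtained there
   gives the shape of f_i (s, 1) needed in (2). The constraints of Theta come
   from integrating the nonnegative weight 1 +- (-1)^k against
   exp (i y (t - x)) and smoothing in y by a Gaussian, that is, from comparing two
   Gaussian densities at every point. In (1) evaluation at the elements of order
   2 of the character group shows that the product of some kappa_j with
   |kappa_j| <= 1, kappa_i among them, is 1; so |kappa_i| = 1, which in Theta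
   forces sigma = sigma' and beta = beta'. *)
Require Import Defs.
From HB Require Import structures.
From mathcomp Require Import all_boot all_order all_algebra.
From mathcomp Require Import all_classical all_reals all_analysis.
From mathcomp.real_closed Require Import complex.
From mathcomp Require Import measurable_realfun.
From mathcomp Require Import ring lra zify.

Set Implicit Arguments.
Unset Strict Implicit.
Unset Printing Implicit Defensive.

Import Order.TTheory GRing.Theory Num.Theory.
Import numFieldNormedType.Exports.

Local Open Scope classical_set_scope.
Local Open Scope complex_scope.
Local Open Scope ring_scope.

(** * Entire power series *)

Section entire_series.
Context {R : realType}.
Implicit Types (a b : nat -> R) (r th : R).

(** The holomorphic functions involved have the form [E (e exp (z X))] with a real bounded weight
    [e], so their Taylor coefficients at 0 are real and a sequence of reals carries everything:
    products are Cauchy products [conv], the value at [r exp (i th)] is the pair [csum], [ssum], and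
    a characteristic function is the restriction to [th = pi / 2]. The absence of zeros is used only
    as the existence of an inverse for [conv], which the modulus identity supplies, since the
    factors and their conjugates multiply to [exp p]. A logarithm is then a primitive of [a' / a],
    and finite order bounds its real part, hence its coefficients. The obstacle is that the modulus
    identity lives on the real line: exponential moments have to be extracted from it before any of
    these series exists. Level 0 allows this, its factors being characteristic functions of real
    variables; but the moments concern the measures themselves, so they also make the signed level-1
    transforms entire. There the positivity behind the degree bound of Marcinkiewicz is lost, and
    the order of growth inherited from level 0 replaces it. *)

Definition abs_sum a r n := \sum_(i < n) `|a i| * `|r| ^+ i.

(** Absolute convergence at every radius, kept as a bound on partial sums: such bounds pass from one
    series to another termwise, and the constant [K] itself feeds the growth estimates. *)
Definition entire a := forall r, exists K, forall n, abs_sum a r n <= K.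

Definition psum a r := limn (pseries a r).

Lemma abs_sum_ge0 a r n : 0 <= abs_sum a r n.
Proof. by apply: sumr_ge0 => i _; rewrite mulr_ge0 ?exprn_ge0. Qed.

Lemma abs_sum_le a r s n m : `|r| <= `|s| -> (n <= m)%N -> abs_sum a r n <= abs_sum a s m.
Proof.
move=> rs nm; rewrite /abs_sum -(big_mkord xpredT (fun i => `|a i| * `|r| ^+ i)).
rewrite -(big_mkord xpredT (fun i => `|a i| * `|s| ^+ i)).
rewrite [leRHS](big_cat_nat (leq0n n) nm) /= -[leLHS]addr0 lerD//.
  by apply: ler_sum => i _; rewrite ler_wpM2l// lerXn2r// nnegrE.
by apply: sumr_ge0 => i _; rewrite mulr_ge0 ?exprn_ge0.
Qed.

Lemma bounded_cvg_pseries a r K : (forall n, abs_sum a r n <= K) ->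
  cvgn (pseries a r).
Proof.
move=> aK; apply: normed_cvg.
apply: (@nondecreasing_is_cvgn R).
  by apply/nondecreasing_seqP => n; rewrite /normed_series_of/series/= big_nat_recr//= lerDl.
exists K => _ [n _ <-].
apply: le_trans (aK n); rewrite /normed_series_of/series/abs_sum/= big_mkord.
by apply: ler_sum => i _; rewrite normrM normrX.
Qed.

Lemma entire_cvg a r : entire a -> cvgn (pseries a r).
Proof. by move=> /(_ r)[K]; exact: bounded_cvg_pseries. Qed.

Lemma norm_psum_le a r K : (forall n, abs_sum a r n <= K) -> `|psum a r| <= K.
Proof.
move=> aK; have ca := bounded_cvg_pseries aK.
rewrite /psum -lim_norm//; apply: limr_le; first exact: is_cvg_norm.
near=> n; apply: le_trans (aK n); rewrite /pseries/series/= big_mkord.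
apply: le_trans (ler_norm_sum _ _ _) _.
by apply: ler_sum => i _; rewrite normrM normrX.
Unshelve. all: by end_near. Qed.

Lemma entire_le a b : entire b -> (forall n, `|a n| <= `|b n|) -> entire a.
Proof.
move=> eb ab r; have [K bK] := eb r; exists K => n; apply: le_trans (bK n).
by apply: ler_sum => i _; rewrite ler_wpM2r// exprn_ge0.
Qed.

Lemma entire_bounded_mul a e : entire a -> (forall n, `|e n| <= 1) ->
  entire (fun n => a n * e n).
Proof.
move=> ea e1; apply: entire_le ea _ => n.
by rewrite normrM ler_piMr.
Qed.

Lemma entireD a b : entire a -> entire b -> entire (fun n => a n + b n).
Proof.
move=> ea eb r; have [K aK] := ea r; have [L bL] := eb r.
exists (K + L) => n; apply: le_trans (lerD (aK n) (bL n)).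
rewrite /abs_sum -big_split/=; apply: ler_sum => i _.
by rewrite -mulrDl ler_wpM2r ?exprn_ge0// ler_normD.
Qed.

Lemma entireZ c a : entire a -> entire (fun n => c * a n).
Proof.
move=> ea r; have [K aK] := ea r; exists (`|c| * K) => n.
apply: le_trans (ler_wpM2l (normr_ge0 c) (aK n)).
by rewrite /abs_sum mulr_sumr; apply: ler_sum => i _; rewrite normrM mulrA.
Qed.

Lemma entire_scale c a : entire a -> entire (fun n => c ^+ n * a n).
Proof.
move=> ea r; have [K aK] := ea (c * r); exists K => n.
apply: le_trans (aK n); apply: ler_sum => i _.
by rewrite normrM normrM normrX exprMn [_ ^+ _ * `|a i|]mulrC mulrA.
Qed.

Lemma entire_finite a N : (forall n, (N <= n)%N -> a n = 0) -> entire a.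
Proof.
move=> a0 r; exists (abs_sum a r N) => n; have [nN|/ltnW Nn] := leqP n N.
  exact: abs_sum_le.
rewrite /abs_sum -!(big_mkord xpredT (fun i => `|a i| * `|r| ^+ i)).
rewrite (big_cat_nat (leq0n N) Nn) /= [X in _ + X]big_nat_cond.
rewrite [X in _ + X]big1 ?addr0// => i /andP[/andP[Ni _] _].
by rewrite a0// normr0 mul0r.
Qed.

Lemma psum_finite a r N : (forall n, (N <= n)%N -> a n = 0) ->
  psum a r = \sum_(i < N) a i * r ^+ i.
Proof.
move=> a0; apply/cvg_lim => //; apply: cvg_near_cst.
near=> n; have Nn : (N <= n)%N by near: n; exists N.
rewrite /pseries/series/= (big_cat_nat (leq0n N) Nn)/= big_mkord.
rewrite [X in _ + X]big_nat_cond.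
by rewrite [X in _ + X]big1 ?addr0// => i /andP[/andP[Ni _] _]; rewrite a0// mul0r.
Unshelve. all: by end_near. Qed.

Lemma psum_cvg a r : entire a -> pseries a r @ \oo --> psum a r.
Proof. by move=> /entire_cvg; exact. Qed.

Lemma psumD a b r : entire a -> entire b ->
  psum (fun n => a n + b n) r = psum a r + psum b r.
Proof.
move=> ea eb; apply/cvg_lim => //.
rewrite [X in X @ _](_ : _ = pseries a r \+ pseries b r).
  by apply: cvgD; exact: psum_cvg.
apply/funext => n /=; rewrite /pseries/series/= -big_split/=.
by apply: eq_bigr => i _; rewrite mulrDl.
Qed.

Lemma psumZ c a r : entire a -> psum (fun n => c * a n) r = c * psum a r.
Proof.
move=> ea; apply/cvg_lim => //.
rewrite [X in X @ _](_ : _ = (fun n => c * pseries a r n)).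
  by apply: cvgMl_tmp; exact: psum_cvg.
apply/funext => n; rewrite /pseries/series/= mulr_sumr.
by apply: eq_bigr => i _; rewrite mulrA.
Qed.

Lemma psumB a b r : entire a -> entire b ->
  psum (fun n => a n - b n) r = psum a r - psum b r.
Proof.
move=> ea eb; rewrite -[in RHS](mulN1r (psum b r)) -psumZ// -psumD//; last exact: entireZ.
by congr (psum _ _); apply/funext => n; rewrite mulN1r.
Qed.

Lemma eq_psum a b r s : (forall n, a n * r ^+ n = b n * s ^+ n) ->
  psum a r = psum b s.
Proof.
move=> ab; rewrite /psum (_ : pseries a r = pseries b s)//.
by apply/funext => n; rewrite /pseries/series/=; apply: eq_bigr => i _; exact: ab.
Qed.

Lemma psum_scale c a r : psum (fun n => c ^+ n * a n) r = psum a (c * r).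
Proof. by apply: eq_psum => n; rewrite exprMn [RHS]mulrCA mulrA. Qed.

Lemma psum0 a : psum a 0 = a 0%N.
Proof.
apply/cvg_lim => //; apply: cvg_near_cst.
near=> n; have n0 : (0 < n)%N by near: n; exists 1%N.
rewrite /pseries/series/= big_ltn// expr0 mulr1 big_nat_cond big1 ?addr0//.
by move=> i /andP[/andP[i0 _] _]; rewrite expr0n gtn_eqF// mulr0.
Unshelve. all: by end_near. Qed.

(** At radius [2 (|r| + 1)] the factor [2 ^ (i + 1)] absorbs the [i + 1] brought in by
    differentiation. *)
Lemma entire_diffs a : entire a -> entire (pseries_diffs a).
Proof.
move=> ea r; have [K aK] := ea (2 * (`|r| + 1)); exists K => n.
apply: le_trans (aK n.+1).
rewrite {2}/abs_sum big_ord_recl /=; apply: ler_wpDl; first by rewrite mulr_ge0// exprn_ge0.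
apply: ler_sum => i _; rewrite /bump leq0n add1n /pseries_diffs normrM normr_nat.
rewrite -mulrA mulrCA ler_wpM2l//.
rewrite normrM ger0_norm// ger0_norm; last by rewrite addr_ge0.
rewrite exprMn; apply: ler_pM => //.
  by rewrite -natrX ler_nat; apply: ltnW; apply: ltn_expl.
apply: (@le_trans _ _ ((`|r| + 1) ^+ i)).
  by apply: lerXn2r; rewrite ?nnegrE ?addr_ge0// lerDl.
by rewrite exprS ler_peMl ?exprn_ge0 ?addr_ge0// lerDr.
Qed.

Lemma is_derive_psum a r : entire a ->
  is_derive r (1 : R) (psum a) (psum (pseries_diffs a) r).
Proof.
move=> ea; apply: (@pseries_snd_diffs _ _ (`|r| + 1)).
- exact: entire_cvg.
- exact/entire_cvg/entire_diffs.
- exact/entire_cvg/entire_diffs/entire_diffs.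
- by rewrite [X in _ < X]ger0_norm ?addr_ge0// ltrDl.
Qed.

Definition conv a b n := \sum_(i < n.+1) a i * b (n - i)%N.

Lemma conv_term a b r n : conv a b n * r ^+ n =
  \sum_(i < n.+1) (a i * r ^+ i) * (b (n - i)%N * r ^+ (n - i)).
Proof.
rewrite /conv mulr_suml; apply: eq_bigr => i _.
have -> : r ^+ n = r ^+ i * r ^+ (n - i) by rewrite -exprD subnKC ?leq_ord.
by rewrite mulrACA.
Qed.

Lemma sum_conv (u v : nat -> R) n :
  \sum_(k < n) conv u v k = \sum_(i < n) \sum_(j < n - i) u i * v j.
Proof.
elim: n => [|n IH]; first by rewrite !big_ord0.
rewrite big_ord_recr/= IH big_ord_recr/= subSnn big_ord_recr big_ord0/= add0r.
rewrite {1}/conv big_ord_recr/= subnn addrA -big_split/=; congr (_ + _).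
by apply: eq_bigr => i _; rewrite subSn 1?ltnW// big_ord_recr.
Qed.

Lemma sum_mul_sub_sum_conv (u v : nat -> R) n :
  (\sum_(i < n) u i) * (\sum_(i < n) v i) - \sum_(k < n) conv u v k =
  \sum_(i < n) \sum_(n - i <= j < n) u i * v j.
Proof.
rewrite sum_conv mulr_suml -sumrB; apply: eq_bigr => i _.
rewrite mulr_sumr -!(big_mkord xpredT (fun j => u i * v j)).
by rewrite (big_cat_nat (leq0n (n - i)) (leq_subr i n))/= addrAC subrr add0r.
Qed.

(** The sum over a square minus the sum over the triangle [i + j < n]: what remains is bounded by
    the same remainder for the absolute values, so the signed case reduces to the nonnegative
    one. *)
Lemma norm_conv_sub (u v : nat -> R) n :
  `|(\sum_(i < n) u i) * (\sum_(i < n) v i) - \sum_(k < n) conv u v k| <=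
  (\sum_(i < n) `|u i|) * (\sum_(i < n) `|v i|) -
    \sum_(k < n) conv (fun i => `|u i|) (fun i => `|v i|) k.
Proof.
rewrite !sum_mul_sub_sum_conv; apply: le_trans (ler_norm_sum _ _ _) _.
apply: ler_sum => i _; apply: le_trans (ler_norm_sum _ _ _) _.
by apply: ler_sum => j _; rewrite normrM.
Qed.

Lemma sum_conv_le_mul (u v : nat -> R) n : (forall i, 0 <= u i) ->
  (forall i, 0 <= v i) ->
  \sum_(k < n) conv u v k <= (\sum_(i < n) u i) * (\sum_(i < n) v i).
Proof.
move=> u0 v0; rewrite -subr_ge0 sum_mul_sub_sum_conv.
by apply: sumr_ge0 => i _; apply: sumr_ge0 => j _; rewrite mulr_ge0.
Qed.

(** The triangle of side [2 n] contains the square of side [n]. *)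
Lemma mul_le_sum_conv (u v : nat -> R) n : (forall i, 0 <= u i) ->
  (forall i, 0 <= v i) ->
  (\sum_(i < n) u i) * (\sum_(i < n) v i) <= \sum_(k < n.*2) conv u v k.
Proof.
move=> u0 v0; rewrite sum_conv mulr_suml.
rewrite -(big_mkord xpredT (fun i => u i * \sum_(i < n) v i)).
rewrite -(big_mkord xpredT (fun i => \sum_(j < n.*2 - i) u i * v j)).
have nn : (n <= n.*2)%N by rewrite -addnn leq_addr.
rewrite [leRHS](big_cat_nat (leq0n n) nn) /= -[leLHS]addr0 lerD//.
  apply: ler_sum_nat => i /andP[_ ni]; rewrite mulr_sumr.
  have ni2 : (n <= n.*2 - i)%N by rewrite -addnn; lia.
  rewrite -!(big_mkord xpredT (fun j => u i * v j)).
  rewrite [leRHS](big_cat_nat (leq0n n) ni2)/= lerDl.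
  by apply: sumr_ge0 => j _; rewrite mulr_ge0.
by apply: sumr_ge0 => i _; apply: sumr_ge0 => j _; rewrite mulr_ge0.
Qed.

Lemma abs_sum_conv_le a b r n : abs_sum (conv a b) r n <= abs_sum a r n * abs_sum b r n.
Proof.
apply: le_trans (sum_conv_le_mul _ (u := fun i => `|a i| * `|r| ^+ i)
  (v := fun i => `|b i| * `|r| ^+ i) _ _); last first.
- by move=> i; rewrite mulr_ge0// exprn_ge0.
- by move=> i; rewrite mulr_ge0// exprn_ge0.
apply: ler_sum => k _.
rewrite [leRHS](_ : _ = conv (fun i => `|a i|) (fun i => `|b i|) k * `|r| ^+ k); last by rewrite conv_term.
rewrite ler_wpM2r ?exprn_ge0//.
apply: le_trans (ler_norm_sum _ _ _) _.
by apply: ler_sum => i _; rewrite normrM.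
Qed.

Lemma abs_sum_conv_bound a b r K L : (forall n, abs_sum a r n <= K) ->
  (forall n, abs_sum b r n <= L) -> forall n, abs_sum (conv a b) r n <= K * L.
Proof.
move=> aK bL n; apply: le_trans (abs_sum_conv_le _ _ _ _) _.
by apply: ler_pM => //; exact: abs_sum_ge0.
Qed.

Lemma entire_conv a b : entire a -> entire b -> entire (conv a b).
Proof.
move=> ea eb r; have [K aK] := ea r; have [L bL] := eb r.
by exists (K * L); exact: abs_sum_conv_bound.
Qed.

(** For the absolute values, [T n <= U n * V n <= T (2 n)] squeezes squares between triangles, so
    both have the same limit; [norm_conv_sub] carries this over to the signed series. *)
Lemma psum_conv a b r : entire a -> entire b ->
  psum (conv a b) r = psum a r * psum b r.
Proof.
move=> ea eb.
pose u i := a i * r ^+ i; pose v i := b i * r ^+ i.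
pose T n := \sum_(k < n) conv (fun i => `|u i|) (fun i => `|v i|) k.
pose U n := \sum_(i < n) `|u i|; pose V n := \sum_(i < n) `|v i|.
have UE n : U n = abs_sum a r n by apply: eq_bigr => i _; rewrite normrM normrX.
have VE n : V n = abs_sum b r n by apply: eq_bigr => i _; rewrite normrM normrX.
have cU : cvgn U.
  have [K aK] := ea r; apply: (@nondecreasing_is_cvgn R).
    by apply/nondecreasing_seqP => n; rewrite /U big_ord_recr lerDl/=.
  by exists K => _ [n _ <-]; rewrite UE.
have cV : cvgn V.
  have [K bK] := eb r; apply: (@nondecreasing_is_cvgn R).
    by apply/nondecreasing_seqP => n; rewrite /V big_ord_recr lerDl/=.
  by exists K => _ [n _ <-]; rewrite VE.
have TUV n : T n <= U n * V n by apply: sum_conv_le_mul.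
have UVT n : U n * V n <= T n.*2 by apply: mul_le_sum_conv.
have cT : cvgn T.
  have [K aK] := ea r; have [L bL] := eb r; apply: (@nondecreasing_is_cvgn R).
    apply/nondecreasing_seqP => n; rewrite /T big_ord_recr lerDl/=.
    by apply: sumr_ge0 => i _; rewrite mulr_ge0.
  exists (K * L) => _ [n _ <-]; apply: le_trans (TUV n) _.
  by rewrite UE VE ler_pM ?abs_sum_ge0.
have cUV : U n * V n @[n --> \oo] --> limn U * limn V by apply: cvgM.
have dbl : n.*2 @[n --> \oo] --> \oo.
  by move=> A [N _ NA]; exists N => // n /= Nn; apply: NA => /=; rewrite -addnn; lia.
have cT2 : T n.*2 @[n --> \oo] --> limn T by apply: cvg_comp dbl cT.
have TE : limn T = limn U * limn V.
  apply/eqP; rewrite eq_le; apply/andP; split.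
    by apply: (ler_cvg_to cT cUV); apply: nearW.
  by apply: (ler_cvg_to cUV cT2); apply: nearW.
have d0 : U n * V n - T n @[n --> \oo] --> (0 : R).
  by rewrite -(subrr (limn T)) {1}TE; apply: cvgB.
have e0 : pseries a r n * pseries b r n - pseries (conv a b) r n @[n --> \oo] --> (0 : R).
  apply/norm_cvg0P; apply: (squeeze_cvgr _ (cvg_cst 0) d0).
  apply: nearW => n; rewrite normr_ge0/= /pseries/series/= !big_mkord.
  rewrite [X in _ - X](eq_bigr (fun k : 'I_n => conv u v k)); last first.
    by move=> k _; rewrite conv_term.
  exact: norm_conv_sub.
have e1 : pseries a r n * pseries b r n - pseries (conv a b) r n @[n --> \oo] -->
    psum a r * psum b r - psum (conv a b) r.
  by apply: cvgB; [apply: cvgM|]; apply: psum_cvg => //; exact: entire_conv.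
by apply/esym/eqP; rewrite -subr_eq0; apply/eqP; exact: cvg_unique e1 e0.
Qed.

(** Identity theorem: if the coefficients below [m] vanish, the term of index [m] cancels a tail of
    size [K r ^ (m + 1)], whence [|a m| <= K r] for [0 < r <= 1]. *)
Lemma psum_eq0 a : entire a -> (forall r, 0 < r -> psum a r = 0) ->
  forall n, a n = 0.
Proof.
move=> ea a0; elim/ltn_ind => m IH.
have [K aK] := ea 1.
have K0 : 0 <= K by apply: le_trans (aK 0%N); rewrite /abs_sum big_ord0.
have aKr r : 0 < r -> r <= 1 -> `|a m| <= K * r.
  move=> r0 r1.
  pose c n := if (n <= m)%N then 0 else a n.
  pose d n := if (n == m)%N then a m else 0.
  have ed : entire d.
    by apply: (@entire_finite _ m.+1) => n mn; rewrite /d gtn_eqF.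
  have cK n : abs_sum c r n <= K * r ^+ m.+1.
    apply: le_trans (ler_wpM2r _ (aK n)); last by rewrite exprn_ge0// ltW.
    rewrite /abs_sum mulr_suml; apply: ler_sum => i _.
    rewrite /c; case: leqP => im; first by rewrite normr0 mul0r !mulr_ge0// exprn_ge0// ltW.
    rewrite -mulrA ler_wpM2l// normr1 expr1n mul1r gtr0_norm//.
    by apply: ler_wiXn2l => //; exact: ltW.
  have acd r' : psum a r' = psum c r' + psum d r'.
    rewrite -psumD//.
      congr (psum _ _); apply/funext => n; rewrite /c /d.
      by case: (ltngtP n m) => [nm|nm|->]; rewrite ?addr0 ?add0r// IH.
    apply: entire_le ea _ => n; rewrite /c; case: ifP => // _.
    by rewrite normr0.
  have dE : psum d r = a m * r ^+ m.
    rewrite (@psum_finite _ _ m.+1); last by move=> n mn; rewrite /d gtn_eqF.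
    rewrite big_ord_recr/= {2}/d eqxx big1 ?add0r// => i _.
    by rewrite /d ltn_eqF// mul0r.
  have : a m * r ^+ m = - psum c r.
    by apply/eqP; rewrite -addr_eq0 addrC -dE -acd a0.
  move=> /(congr1 Num.norm); rewrite normrN normrM normrX (gtr0_norm r0) => h.
  have := norm_psum_le cK; rewrite -h exprS mulrA.
  by rewrite ler_pM2r// exprn_gt0.
apply/eqP; rewrite -normr_le0; apply/ler_addgt0Pl => e e0.
rewrite addr0; move: aKr; have [->|Kn0] := eqVneq K 0 => aKr.
  by apply: le_trans (aKr 1 _ _) _ => //; rewrite mul0r ltW.
have Kp : 0 < K by rewrite lt_neqAle eq_sym Kn0.
apply: le_trans (aKr (Num.min 1 (e / K)) _ _) _.
- by rewrite lt_min ltr01 divr_gt0.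
- by rewrite ge_min lexx.
- by rewrite mulrC -ler_pdivlMr// ge_min lexx orbT.
Qed.

End entire_series.

(** * Power series in polar coordinates *)

Section polar_values.
Context {R : realType}.
Implicit Types (a b h d : nat -> R) (r th : R).

(* Real and imaginary parts of the power series [a] at the point [r exp (i th)]. *)
Definition csum a th r := psum (fun n => a n * cos (n%:R * th)) r.
Definition ssum a th r := psum (fun n => a n * sin (n%:R * th)) r.

Lemma entire_cos a th : entire a -> entire (fun n => a n * cos (n%:R * th)).
Proof. by move=> ea; apply: entire_bounded_mul => // n; exact: cos_max. Qed.

Lemma entire_sin a th : entire a -> entire (fun n => a n * sin (n%:R * th)).
Proof. by move=> ea; apply: entire_bounded_mul => // n; exact: sin_max. Qed.

(** Addition formula for [n t = i t + (n - i) t], that is, the real part of a product in polar form.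
    The phase [s] serves the derivatives in [r], whose coefficient of index [n] carries the angle
    [(n + 1) t]. *)
Lemma conv_cos a b (s t : R) n :
  conv a b n * cos (n%:R * t + s) =
  conv (fun k => a k * cos (k%:R * t + s)) (fun k => b k * cos (k%:R * t)) n -
  conv (fun k => a k * sin (k%:R * t + s)) (fun k => b k * sin (k%:R * t)) n.
Proof.
rewrite /conv mulr_suml -sumrB; apply: eq_bigr => i _.
have -> : n%:R * t + s = (i%:R * t + s) + (n - i)%:R * t.
  by rewrite natrB ?leq_ord//; ring.
by rewrite cosD; ring.
Qed.

Lemma conv_sin a b (s t : R) n :
  conv a b n * sin (n%:R * t + s) =
  conv (fun k => a k * sin (k%:R * t + s)) (fun k => b k * cos (k%:R * t)) n +
  conv (fun k => a k * cos (k%:R * t + s)) (fun k => b k * sin (k%:R * t)) n.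
Proof.
rewrite /conv mulr_suml -big_split/=; apply: eq_bigr => i _.
have -> : n%:R * t + s = (i%:R * t + s) + (n - i)%:R * t.
  by rewrite natrB ?leq_ord//; ring.
by rewrite sinD; ring.
Qed.

Lemma entire_cos_shift a t s : entire a -> entire (fun n => a n * cos (n%:R * t + s)).
Proof. by move=> ea; apply: entire_bounded_mul => // n; exact: cos_max. Qed.

Lemma entire_sin_shift a t s : entire a -> entire (fun n => a n * sin (n%:R * t + s)).
Proof. by move=> ea; apply: entire_bounded_mul => // n; exact: sin_max. Qed.

Lemma psum_conv_cos a b s t r : entire a -> entire b ->
  psum (fun n => conv a b n * cos (n%:R * t + s)) r =
  psum (fun n => a n * cos (n%:R * t + s)) r * csum b t r -
  psum (fun n => a n * sin (n%:R * t + s)) r * ssum b t r.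
Proof.
move=> ea eb.
rewrite (funext (conv_cos a b s t)) psumB; last 2 first.
- by apply: entire_conv; [exact: entire_cos_shift|exact: entire_cos].
- by apply: entire_conv; [exact: entire_sin_shift|exact: entire_sin].
rewrite !psum_conv//.
- exact: entire_sin_shift.
- exact: entire_sin.
- exact: entire_cos_shift.
- exact: entire_cos.
Qed.

Lemma psum_conv_sin a b s t r : entire a -> entire b ->
  psum (fun n => conv a b n * sin (n%:R * t + s)) r =
  psum (fun n => a n * sin (n%:R * t + s)) r * csum b t r +
  psum (fun n => a n * cos (n%:R * t + s)) r * ssum b t r.
Proof.
move=> ea eb.
rewrite (funext (conv_sin a b s t)) psumD; last 2 first.
- by apply: entire_conv; [exact: entire_sin_shift|exact: entire_cos].
- by apply: entire_conv; [exact: entire_cos_shift|exact: entire_sin].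
rewrite !psum_conv//.
- exact: entire_cos_shift.
- exact: entire_sin.
- exact: entire_sin_shift.
- exact: entire_cos.
Qed.

Lemma csum_conv a b t r : entire a -> entire b ->
  csum (conv a b) t r = csum a t r * csum b t r - ssum a t r * ssum b t r.
Proof.
move=> ea eb; have := @psum_conv_cos a b 0 t r ea eb.
by under eq_fun do rewrite addr0; under [in RHS]eq_fun do rewrite addr0;
  under [X in _ - psum X _ * _]eq_fun do rewrite addr0.
Qed.

Lemma ssum_conv a b t r : entire a -> entire b ->
  ssum (conv a b) t r = ssum a t r * csum b t r + csum a t r * ssum b t r.
Proof.
move=> ea eb; have := @psum_conv_sin a b 0 t r ea eb.
by under eq_fun do rewrite addr0; under [in RHS]eq_fun do rewrite addr0;
  under [X in _ + psum X _ * _]eq_fun do rewrite addr0.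
Qed.

Lemma csum_th0 a r : csum a 0 r = psum a r.
Proof. by apply: eq_psum => n; rewrite mulr0 cos0 mulr1. Qed.

Lemma ssum_th0 a r : ssum a 0 r = 0.
Proof.
rewrite /ssum (@psum_finite _ _ _ 0) ?big_ord0// => n _.
by rewrite mulr0 sin0 mulr0.
Qed.

Lemma csumr0 a t : csum a t 0 = a 0%N.
Proof. by rewrite /csum psum0 mul0r cos0 mulr1. Qed.

Lemma ssumr0 a t : ssum a t 0 = 0.
Proof. by rewrite /ssum psum0 mul0r sin0 mulr0. Qed.

Lemma csum_scale c a t r : csum (fun n => c ^+ n * a n) t r = csum a t (c * r).
Proof. by rewrite /csum -psum_scale; apply: eq_psum => n; rewrite !mulrA. Qed.

Lemma ssum_scale c a t r : ssum (fun n => c ^+ n * a n) t r = ssum a t (c * r).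
Proof. by rewrite /ssum -psum_scale; apply: eq_psum => n; rewrite !mulrA. Qed.

Lemma csumZ c a t r : entire a -> csum (fun n => c * a n) t r = c * csum a t r.
Proof.
move=> ea; rewrite /csum -psumZ; last exact: entire_cos.
by apply: eq_psum => n; rewrite !mulrA.
Qed.

Lemma ssumZ c a t r : entire a -> ssum (fun n => c * a n) t r = c * ssum a t r.
Proof.
move=> ea; rewrite /ssum -psumZ; last exact: entire_sin.
by apply: eq_psum => n; rewrite !mulrA.
Qed.

(* The hypothesis says that the power series [a] solves [a' = h' a], so that
   [a = a_0 exp h] if [h 0 = 0]. *)
Lemma csum_ssum_exp a h t r : entire a -> entire h -> h 0%N = 0 ->
  (forall n, pseries_diffs a n = conv (pseries_diffs h) a n) ->
  csum a t r = a 0%N * expR (csum h t r) * cos (ssum h t r) /\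
  ssum a t r = a 0%N * expR (csum h t r) * sin (ssum h t r).
Proof.
move=> ea eh h0 ah; set d := pseries_diffs h in ah.
have ed : entire d by exact: entire_diffs.
pose C := csum a t; pose S := ssum a t; pose p := csum h t; pose q := ssum h t.
pose p' x := psum (fun n => d n * cos (n%:R * t + t)) x.
pose q' x := psum (fun n => d n * sin (n%:R * t + t)) x.
have nS n : n.+1%:R * t = n%:R * t + t by rewrite -natr1 mulrDl mul1r.
have dp x : is_derive x (1 : R) p (p' x).
  rewrite (_ : p' x = psum (pseries_diffs (fun n => h n * cos (n%:R * t))) x).
    by apply: is_derive_psum; exact: entire_cos.
  by apply: eq_psum => n; rewrite /d /pseries_diffs nS mulrA.
have dq x : is_derive x (1 : R) q (q' x).
  rewrite (_ : q' x = psum (pseries_diffs (fun n => h n * sin (n%:R * t))) x).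
    by apply: is_derive_psum; exact: entire_sin.
  by apply: eq_psum => n; rewrite /d /pseries_diffs nS mulrA.
have dC x : is_derive x (1 : R) C (p' x * C x - q' x * S x).
  rewrite -psum_conv_cos//.
  rewrite (_ : psum _ _ = psum (pseries_diffs (fun n => a n * cos (n%:R * t))) x).
    by apply: is_derive_psum; exact: entire_cos.
  by apply: eq_psum => n; rewrite -ah /pseries_diffs nS mulrA.
have dS x : is_derive x (1 : R) S (q' x * C x + p' x * S x).
  rewrite -psum_conv_sin//.
  rewrite (_ : psum _ _ = psum (pseries_diffs (fun n => a n * sin (n%:R * t))) x).
    by apply: is_derive_psum; exact: entire_sin.
  by apply: eq_psum => n; rewrite -ah /pseries_diffs nS mulrA.
pose E x := expR (- p x).
have dE x : is_derive x (1 : R) E (E x * - p' x) by apply: is_derive1_comp.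
have dc x : is_derive x (1 : R) (cos \o q) (- sin (q x) * q' x) by apply: is_derive1_comp.
have ds x : is_derive x (1 : R) (sin \o q) (cos (q x) * q' x) by apply: is_derive1_comp.
(* [U] and [V] are the real and imaginary parts of [a exp (- h)] along the ray of angle [t], so both
   are constant. *)
pose U := E * (C * (cos \o q) + S * (sin \o q)).
pose V := E * (S * (cos \o q) - C * (sin \o q)).
have UE : U r = a 0%N.
  transitivity (U 0).
    apply: is_derive_0_is_cst => x; rewrite /U; apply: trigger_derive.
    have -> : (C * (cos \o q) + S * (sin \o q)) x = C x * cos (q x) + S x * sin (q x) by [].
    by rewrite /GRing.scale/=; ring.
  rewrite (_ : U 0 = E 0 * (C 0 * cos (q 0) + S 0 * sin (q 0)))//.
  rewrite /E /p /C /q /S !csumr0 !ssumr0 h0 oppr0 expR0 cos0 sin0; ring.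
have VE : V r = 0.
  transitivity (V 0).
    apply: is_derive_0_is_cst => x; rewrite /V; apply: trigger_derive.
    have -> : (S * (cos \o q) - C * (sin \o q)) x = S x * cos (q x) - C x * sin (q x) by [].
    by rewrite /GRing.scale/=; ring.
  rewrite (_ : V 0 = E 0 * (S 0 * cos (q 0) - C 0 * sin (q 0)))//.
  rewrite /E /p /C /q /S !csumr0 !ssumr0 h0 oppr0 expR0 cos0 sin0; ring.
have cs := cos2Dsin2 (q r).
have EE : expR (p r) * E r = 1 by rewrite /E expRxMexpNx_1.
have SC : S r * cos (q r) = C r * sin (q r).
  apply/eqP; rewrite -subr_eq0; move/eqP: VE.
  by rewrite /V mulf_eq0 => /orP[|//]; rewrite /E expR_eq0.
have {}UE : a 0%N = E r * (C r * cos (q r) + S r * sin (q r)) by rewrite -UE.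
rewrite -/(C r) -/(S r) -/(p r) -/(q r) UE.
split.
- transitivity (expR (p r) * E r * (C r * cos (q r) ^+ 2 + (S r * cos (q r)) * sin (q r))).
    by rewrite EE SC mul1r -mulrA -mulrDr cs mulr1.
  ring.
- transitivity (expR (p r) * E r * ((C r * sin (q r)) * cos (q r) + S r * sin (q r) ^+ 2)).
    by rewrite EE -SC mul1r -mulrA -mulrDr cs mulr1.
  ring.
Qed.

End polar_values.

(** * The exponential of a power series *)

Section expser.
Context {R : realType}.
Implicit Types (a b h d : nat -> R) (r : R).

(* Taylor coefficients of [exp h] for [h 0 = 0], by the recursion read off
   [(exp h)' = h' exp h]. *)
Fixpoint expser_seq h n : seq R :=
  if n is m.+1 then
    rcons (expser_seq h m)
      ((\sum_(i < m.+1) pseries_diffs h i * nth 0 (expser_seq h m) (m - i)) / m.+1%:R)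
  else [:: 1].

Definition expser h n := nth 0 (expser_seq h n) n.

Lemma size_expser_seq h n : size (expser_seq h n) = n.+1.
Proof. by elim: n => //= n IH; rewrite size_rcons IH. Qed.

Lemma nth_expser_seq h n k : (k <= n)%N -> nth 0 (expser_seq h n) k = expser h k.
Proof.
elim: n => [|n IH]; first by rewrite leqn0 => /eqP ->.
rewrite leq_eqVlt => /orP[/eqP-> //|]; rewrite ltnS => kn.
by rewrite /= nth_rcons size_expser_seq ltnS kn IH.
Qed.

Lemma expser0 h : expser h 0 = 1. Proof. by []. Qed.

Lemma expserE h n : pseries_diffs (expser h) n = conv (pseries_diffs h) (expser h) n.
Proof.
rewrite /pseries_diffs {1}/expser /= nth_rcons size_expser_seq ltnn eqxx.
rewrite mulrC divfK ?pnatr_eq0//; apply: eq_bigr => i _.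
by rewrite nth_expser_seq// leq_subr.
Qed.

Lemma expser_unique a h : (forall n, pseries_diffs a n = conv (pseries_diffs h) a n) ->
  forall n, a n = a 0%N * expser h n.
Proof.
move=> ah; elim/ltn_ind => -[|n] IH; first by rewrite expser0 mulr1.
have n0 : n.+1%:R != 0 :> R by rewrite pnatr_eq0.
apply: (mulfI n0); rewrite mulrCA -[LHS]/(pseries_diffs a n) ah.
rewrite -[X in _ = _ * X]/(pseries_diffs (expser h) n) expserE /conv mulr_sumr.
by apply: eq_bigr => i _; rewrite IH ?ltnS ?leq_subr// mulrCA.
Qed.

Lemma expser_ge0 h : (forall n, 0 <= h n) -> forall n, 0 <= expser h n.
Proof.
move=> h0; elim/ltn_ind => -[|n] IH; first by rewrite expser0.
have n0 : 0 < n.+1%:R :> R by rewrite ltr0n.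
rewrite -(pmulr_rge0 _ n0) -[X in 0 <= X]/(pseries_diffs (expser h) n) expserE.
apply: sumr_ge0 => i _; rewrite mulr_ge0 ?IH ?ltnS ?leq_subr//.
by rewrite mulr_ge0.
Qed.

(** The recursion has nonnegative coefficients in terms of [h], so taking absolute values gives a
    majorant. *)
Lemma norm_expser_le h n : `|expser h n| <= expser (fun k => `|h k|) n.
Proof.
elim/ltn_ind: n => -[|n] IH; first by rewrite !expser0 normr1.
have n0 : 0 < n.+1%:R :> R by rewrite ltr0n.
rewrite -(ler_pM2l n0) -[X in X * `|_|](gtr0_norm n0) -normrM.
rewrite -[X in `|X|]/(pseries_diffs (expser h) n) expserE.
rewrite -[leRHS]/(pseries_diffs (expser (fun k => `|h k|)) n) expserE.
apply: le_trans (ler_norm_sum _ _ _) _; apply: ler_sum => i _.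
rewrite normrM ler_pM ?IH ?ltnS ?leq_subr//.
by rewrite /pseries_diffs normrM ger0_norm.
Qed.

(** Cutting the series after index [n] gives a polynomial [e] with [e' <= h' e] coefficientwise,
    since only nonnegative terms are lost; hence [e exp (- h)] does not increase on the positive
    half-line, where it starts at 1. Working with the cut series avoids presupposing the convergence
    that this bound serves to prove. *)
Lemma expser_partial_le h r n : entire h -> (forall k, 0 <= h k) -> h 0%N = 0 ->
  0 <= r -> abs_sum (expser h) r n <= expR (psum h r).
Proof.
move=> eh hp h0 r0; have ep := expser_ge0 hp.
apply: (@le_trans _ _ (abs_sum (expser h) r n.+1)); first exact: abs_sum_le.
pose e k := if (k <= n)%N then expser h k else 0.
have e0 k : (n.+1 <= k)%N -> e k = 0 by rewrite /e ltnNge; case: leqP.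
have ee : entire e by exact: entire_finite e0.
have -> : abs_sum (expser h) r n.+1 = psum e r.
  rewrite (psum_finite _ e0); apply: eq_bigr => i _.
  by rewrite /e leq_ord !ger0_norm.
pose f := psum e * (expR \o (- psum h)).
pose f' x := psum e x * (expR (- psum h x) * - psum (pseries_diffs h) x) +
  expR (- psum h x) * psum (pseries_diffs e) x.
have df x : is_derive x (1 : R) f (f' x).
  have de := is_derive_psum x ee.
  have dh := is_derive_psum x eh.
  have dx : is_derive x (1 : R) (expR \o (- psum h)) (expR (- psum h x) * - psum (pseries_diffs h) x).
    by apply: is_derive1_comp.
  by rewrite /f; apply: trigger_derive.
have f'0 x : 0 <= x -> f' x <= 0.
  move=> x0; rewrite /f'.
  have psum_le a b : entire a -> entire b -> (forall k, a k <= b k) -> psum a x <= psum b x.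
    move=> ea eb ab; apply: ler_lim; [exact: entire_cvg|exact: entire_cvg|].
    apply: nearW => m; rewrite /pseries/series/=; apply: ler_sum => i _.
    by rewrite ler_wpM2r// exprn_ge0.
  have edh := entire_diffs eh.
  have : psum (pseries_diffs e) x <= psum (pseries_diffs h) x * psum e x.
    rewrite -psum_conv//; apply: psum_le; [exact: entire_diffs|exact: entire_conv|].
    have cge0 k : 0 <= conv (pseries_diffs h) e k.
      apply: sumr_ge0 => i _; rewrite mulr_ge0//; first by rewrite mulr_ge0.
      by rewrite /e; case: ifP.
    move=> k; rewrite {1}/pseries_diffs {1}/e; have [kn|kn] := ltnP k n; last by rewrite mulr0 cge0.
    rewrite -[leLHS]/(pseries_diffs (expser h) k) expserE /conv.
    rewrite le_eqVlt; apply/orP; left; apply/eqP; apply: eq_bigr => i _.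
    by rewrite /e ifT//; apply: leq_trans (leq_subr _ _) (ltnW kn).
  move=> le_e; rewrite (_ : _ + _ = expR (- psum h x) * (psum (pseries_diffs e) x - psum (pseries_diffs h) x * psum e x)); last ring.
  by rewrite pmulr_rle0 ?expR_gt0// subr_le0.
have [|c] := @MVT_segment R f f' 0 r r0 (fun x _ => df x).
  apply/continuous_subspaceT => x.
  exact/differentiable_continuous/derivable1_diffP.
rewrite in_itv/= => /andP[c0 _].
have -> : f 0 = 1 by rewrite /f !fctE !psum0 h0 oppr0 expR0 /e /= expser0 mulr1.
rewrite subr0 => frE.
have : f r <= 1.
  by rewrite -subr_le0 frE mulr_le0_ge0// f'0.
rewrite -[f r]/(psum e r * expR (- psum h r)) expRN.
by rewrite ler_pdivrMr ?expR_gt0// mul1r.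
Qed.

Lemma abs_sum_expser_le h r n : entire h -> h 0%N = 0 ->
  abs_sum (expser h) r n <= expR (psum (fun k => `|h k|) `|r|).
Proof.
move=> eh h0.
have eh' : entire (fun k => `|h k|) by apply: entire_le eh _ => k; rewrite normr_id.
apply: le_trans (expser_partial_le n eh' _ _ (normr_ge0 r)) => //; last by rewrite h0 normr0.
apply: ler_sum => i _; rewrite normr_id ler_wpM2r ?exprn_ge0//.
by rewrite (le_trans (norm_expser_le _ _))// ler_norm.
Qed.

Lemma entire_expser h : entire h -> h 0%N = 0 -> entire (expser h).
Proof.
move=> eh h0 r; exists (expR (psum (fun k => `|h k|) `|r|)) => n.
exact: abs_sum_expser_le.
Qed.

Lemma csum_expser h t r : entire h -> h 0%N = 0 ->
  csum (expser h) t r = expR (csum h t r) * cos (ssum h t r).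
Proof.
move=> eh h0.
have [] := csum_ssum_exp t r (entire_expser eh h0) eh h0 (expserE h).
by rewrite expser0 mul1r.
Qed.

Lemma ssum_expser h t r : entire h -> h 0%N = 0 ->
  ssum (expser h) t r = expR (csum h t r) * sin (ssum h t r).
Proof.
move=> eh h0.
have [] := csum_ssum_exp t r (entire_expser eh h0) eh h0 (expserE h).
by rewrite expser0 mul1r.
Qed.

End expser.

(** * Zero-free entire series of finite order *)

Section liouville.
Context {R : realType}.
Implicit Types (a b h : nat -> R) (r t : R).

Lemma sum_cos_mul (x : R) n :
  2 * sin (x / 2) * \sum_(k < n) cos (k%:R * x) =
  sin (n%:R * x - x / 2) + sin (x / 2).
Proof.
elim: n => [|n IH].
  by rewrite big_ord0 mulr0 mul0r sub0r sinN addNr.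
rewrite big_ord_recr/= mulrDr IH -[n.+1%:R]natr1.
have -> : (n%:R + 1) * x - x / 2 = n%:R * x + x / 2 by field.
rewrite sinB sinD; ring.
Qed.

(** In [sum_cos_mul] the angle [x / 2 = j pi / M] has a positive sine, and the right-hand side
    vanishes by periodicity. *)
Lemma sum_cos_root (j M : nat) : (0 < j)%N -> (j < M)%N ->
  \sum_(k < M) cos (j%:R * (k%:R * (2 * pi / M%:R))) = 0 :> R.
Proof.
move=> j0 jM; have M0 : M%:R != 0 :> R by rewrite pnatr_eq0; lia.
pose x : R := j%:R * (2 * pi / M%:R).
rewrite (eq_bigr (fun k : 'I_M => cos (k%:R * x))); last first.
  by move=> k _; rewrite /x; congr cos; ring.
have sx : 0 < sin (x / 2).
  rewrite (_ : x / 2 = pi * (j%:R / M%:R)); last by rewrite /x; field.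
  have M0' : 0 < M%:R :> R by rewrite ltr0n; lia.
  apply: sin_gt0_pi; apply/andP; split; first by apply: mulr_gt0; [exact: pi_gt0|apply: divr_gt0 => //; rewrite ltr0n].
  by rewrite -[ltRHS]mulr1 ltr_pM2l ?pi_gt0// ltr_pdivrMr// mul1r ltr_nat.
have := sum_cos_mul x M.
have -> : M%:R * x - x / 2 = - (x / 2) + j%:R * (pi *+ 2).
  by rewrite /x -mulr_natr; field.
rewrite [_ + _ * _]addrC.
have -> : sin (j%:R * (pi *+ 2) + - (x / 2)) = sin (- (x / 2)) :> R.
  rewrite addrC; elim: (j) (- (x / 2)) => [|i IHi] y; first by rewrite mul0r addr0.
  by rewrite -natr1 mulrDl mul1r addrA sinD2pi.
rewrite sinN addNr => /eqP; rewrite !mulf_eq0 pnatr_eq0/= (gt_eqF sx)/=.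
by move=> /eqP.
Qed.

(** The condition [n + m < M] excludes aliasing: the frequencies [n + m] and [|n - m|] stay below
    [M], so among them only 0 has a nonzero mean. *)
Lemma avg_cos_weight (s : R) (n m M : nat) : (0 < m)%N -> (n + m < M)%N ->
  \sum_(k < M) cos (n%:R * (k%:R * (2 * pi / M%:R))) *
     (1 + s * cos (m%:R * (k%:R * (2 * pi / M%:R)))) =
  M%:R * ((n == 0%N)%:R + s / 2 * (n == m)%:R).
Proof.
move=> m0 nmM; pose th (k : nat) : R := k%:R * (2 * pi / M%:R).
change (\sum_(k < M) cos (n%:R * th k) * (1 + s * cos (m%:R * th k)) =
  M%:R * ((n == 0%N)%:R + s / 2 * (n == m)%:R)).
have cos1 j : (j < M)%N -> \sum_(k < M) cos (j%:R * th k) = M%:R * (j == 0%N)%:R.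
  case: j => [|j] jM; last by rewrite mulr0; exact: sum_cos_root.
  rewrite (eq_bigr (fun=> 1)) ?sumr_const ?card_ord ?mulr1// => k _.
  by rewrite mul0r cos0.
have cosM j k : (j <= k)%N -> forall i,
    cos (j%:R * th i) * cos (k%:R * th i) =
    2^-1 * (cos ((k - j)%:R * th i) + cos ((k + j)%:R * th i)).
  move=> jk i; rewrite natrB// natrD mulrBl mulrDl cosB cosD; by field.
have main : \sum_(k < M) cos (n%:R * th k) * cos (m%:R * th k) =
    M%:R * (2^-1 * (n == m)%:R).
  have [nm|/ltnW mn] := leqP n m.
    rewrite (eq_bigr _ (fun (k : 'I_M) _ => cosM _ _ nm k)) -mulr_sumr big_split/=.
    rewrite !cos1; [|lia..].
    have -> : (m - n == 0)%N = (n == m) by lia.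
    have -> : (m + n == 0)%N = false by lia.
    by rewrite mulr0 addr0 mulrCA.
  under eq_bigr do rewrite mulrC.
  rewrite (eq_bigr _ (fun (k : 'I_M) _ => cosM _ _ mn k)) -mulr_sumr big_split/=.
  rewrite !cos1; [|lia..].
  have -> : (n - m == 0)%N = (n == m) by lia.
  have -> : (n + m == 0)%N = false by lia.
  by rewrite mulr0 addr0 mulrCA.
rewrite (eq_bigr (fun k : 'I_M => cos (n%:R * th k) + s * (cos (n%:R * th k) * cos (m%:R * th k)))); last first.
  by move=> k _; ring.
by rewrite big_split/= -mulr_sumr main cos1; [ring|lia].
Qed.

(** Uniformity in [t] matters because the sample points of the averaging argument move with the
    truncation [L]. It comes from the tail of the absolute series. *)
Lemma csum_tail a r : entire a -> forall e, 0 < e -> \forall L \near \oo,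
  forall t, `|csum a t r - \sum_(n < L) a n * cos (n%:R * t) * r ^+ n| <= e.
Proof.
move=> ea e e0.
have ea' : entire (fun n => `|a n|) by apply: entire_le ea _ => n; rewrite normr_id.
have /cvgrPdist_le/(_ e e0) := psum_cvg (r := `|r|) ea'.
apply: filterS => L hL t; apply: le_trans hL.
have hp : cvgn (pseries (fun n => `|a n|) `|r|) by apply: entire_cvg.
pose aL n := if (n < L)%N then a n else 0.
pose bL n := if (n < L)%N then 0 else a n.
have eaL : entire aL by apply: (@entire_finite _ _ L) => n; rewrite /aL ltnNge => ->.
have ebL : entire bL by apply: entire_le ea _ => n; rewrite /bL; case: ifP; rewrite ?normr0.
have abL n : a n = aL n + bL n by rewrite /aL /bL; case: ifP; rewrite ?addr0 ?add0r.
have -> : csum a t r = csum aL t r + csum bL t r.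
  rewrite /csum -psumD; [|exact: entire_cos..].
  by apply: eq_psum => n; rewrite -mulrDl -abL.
have -> : csum aL t r = \sum_(n < L) a n * cos (n%:R * t) * r ^+ n.
  rewrite /csum (@psum_finite _ _ _ L); last by move=> n; rewrite /aL ltnNge => ->; rewrite mul0r.
  by apply: eq_bigr => i _; rewrite /aL ltn_ord.
rewrite addrAC subrr add0r.
have -> : psum (fun n => `|a n|) `|r| - pseries (fun n => `|a n|) `|r| L =
    psum (fun n => `|bL n|) `|r|.
  have -> : pseries (fun n => `|a n|) `|r| L = psum (fun n => `|aL n|) `|r|.
    rewrite (@psum_finite _ _ _ L); last by move=> n; rewrite /aL ltnNge => ->; rewrite normr0.
    by rewrite /pseries/series/= big_mkord; apply: eq_bigr => i _; rewrite /aL ltn_ord.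
  rewrite -psumB//; last by apply: entire_le eaL _ => n; rewrite normr_id.
  apply: eq_psum => n; rewrite /aL /bL; case: ifP => _; rewrite ?normr0 ?subrr ?subr0//.
have ebL' : entire (fun n => `|bL n|) by apply: entire_le ebL _ => n; rewrite normr_id.
rewrite (le_trans _ (ler_norm _))//; apply: norm_psum_le => n.
apply: le_trans (_ : abs_sum bL r n <= _).
  by apply: ler_sum => i _; rewrite ler_wpM2r ?exprn_ge0// normrM ler_piMr// cos_max.
rewrite (_ : abs_sum bL r n = pseries (fun n => `|bL n|) `|r| n); last first.
  by rewrite /pseries/series/= big_mkord.
apply: nondecreasing_cvgn_le; last exact: entire_cvg.
by apply/nondecreasing_seqP => k; rewrite /pseries/series/= big_nat_recr//= lerDl mulr_ge0 ?exprn_ge0.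
Qed.

(* Averaging [csum h] over the [M]-th roots of unity against the nonnegative
   weight [1 +- cos (m t)], of mean 1, isolates the coefficient [h m]. *)
Lemma coef_le_of_csum_le h r A m : entire h -> h 0%N = 0 -> 0 <= r ->
  (forall t, csum h t r <= A) -> (0 < m)%N -> `|h m| * r ^+ m <= 2 * A.
Proof.
move=> eh h0 r0 hA m0.
suff main s : `|s| <= 1 -> s * (h m * r ^+ m) <= 2 * A.
  have [hm|hm] := ger0P (h m).
    by have := main 1; rewrite mul1r; apply; rewrite normr1.
  by have := main (-1); rewrite mulN1r mulNr; apply; rewrite normrN1.
move=> s1; apply/ler_addgt0Pl => e e0.
have e4 : 0 < e / 4 by rewrite divr_gt0.
have [L0 _ /(_ (maxn L0 m.+1))/= hL] := csum_tail r eh e4.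
have {}hL := hL (leq_maxl _ _); set L := maxn L0 m.+1 in hL.
have mL : (m < L)%N by rewrite leq_max ltnSn orbT.
(* With [L + m] roots of unity the [L] retained frequencies can be tested against the frequency [m]
   without aliasing. *)
pose M := (L + m)%N; pose th k : R := k%:R * (2 * pi / M%:R).
pose w k := 1 + s * cos (m%:R * th k).
have M0 : 0 < M%:R :> R by rewrite ltr0n /M; lia.
have w0 k : 0 <= w k.
  rewrite /w; have : `|s * cos (m%:R * th k)| <= 1.
    by rewrite normrM -[leRHS]mulr1 ler_pM// cos_max.
  by rewrite ler_norml => /andP[] + _; lra.
have Sw : \sum_(k < M) w k = M%:R.
  have := @avg_cos_weight s 0 m M m0; rewrite /M => /(_ ltac:(lia)).
  rewrite -/M eqxx (_ : (0 == m)%N = false) ?mulr0 ?addr0 ?mulr1; last by lia.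
  by move=> <-; apply: eq_bigr => k _; rewrite mul0r cos0 mul1r.
have Sc : \sum_(k < M) (\sum_(n < L) h n * cos (n%:R * th k) * r ^+ n) * w k =
    M%:R * (s / 2 * (h m * r ^+ m)).
  under eq_bigr do rewrite mulr_suml.
  rewrite exchange_big/= (bigD1 (Ordinal mL))//= [X in _ + X]big1 ?addr0; last first.
    move=> n nm; transitivity (h n * r ^+ n * \sum_(k < M) cos (n%:R * th k) * w k).
      by rewrite mulr_sumr; apply: eq_bigr => k _; ring.
    have [->|n0] := eqVneq (n : nat) 0%N; first by rewrite h0 !mul0r.
    rewrite avg_cos_weight//; last by rewrite /M ltn_add2r.
    by rewrite (negbTE n0) -[(n : nat) == m]/(n == Ordinal mL) (negbTE nm) mulr0 addr0 mulr0 mulr0.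
  transitivity (h m * r ^+ m * \sum_(k < M) cos (m%:R * th k) * w k).
    by rewrite mulr_sumr; apply: eq_bigr => k _; ring.
  rewrite avg_cos_weight//; last by rewrite /M ltn_add2r.
  rewrite eqxx (_ : (m == 0)%N = false); last by lia.
  by rewrite /=; ring.
have : \sum_(k < M) (\sum_(n < L) h n * cos (n%:R * th k) * r ^+ n) * w k <=
    \sum_(k < M) (A + e / 4) * w k.
  apply: ler_sum => k _; rewrite ler_wpM2r//.
  have := hL (th k); rewrite ler_distl => /andP[_ h2].
  have := hA (th k) => h3.
  by have := hL (th k); rewrite ler_norml => /andP[]; lra.
rewrite Sc -mulr_sumr Sw [leRHS]mulrC ler_pM2l// => h1; lra.
Qed.

(** Dividing by [r ^ (m - 1)] bounds [c r] by the sum of the [|q_i|] for all [r >= 1]. *)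
Lemma poly_bounds_coef (c : R) (q : {poly R}) m : (size q <= m)%N ->
  (forall r, 1 <= r -> c * r ^+ m <= q.[r]) -> c <= 0.
Proof.
move=> sq hq.
pose K := \sum_(i < size q) `|q`_i|.
have K0 : 0 <= K by apply: sumr_ge0.
have cK r : 1 <= r -> c * r <= K.
  move=> r1; have r0 : 0 < r by apply: lt_le_trans r1.
  have [q0|q0] := eqVneq q 0.
    have := hq r r1; rewrite q0 horner0 pmulr_lle0 ?exprn_gt0// => c0.
    by apply: le_trans K0; rewrite pmulr_lle0.
  have sm : m = m.-1.+1 by rewrite prednK// (leq_trans _ sq)// lt0n size_poly_eq0.
  have := hq r r1; rewrite sm exprS mulrA horner_coef => h1.
  rewrite -(ler_pM2r (exprn_gt0 m.-1 r0)); apply: le_trans h1 _.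
  rewrite mulr_suml; apply: ler_sum => i _.
  apply: le_trans (ler_norm _) _; rewrite normrM ler_wpM2l//.
  rewrite normrX gtr0_norm// ler_weXn2l//.
  by have := ltn_ord i; lia.
rewrite leNgt; apply/negP => c0.
have := cK (K / c + 1); rewrite lerDr => /(_ (divr_ge0 K0 (ltW c0))).
by rewrite mulrDr mulrC divfK ?gt_eqF// mulr1 gerDl leNgt c0.
Qed.

Lemma entire_primitive a : entire a ->
  entire (fun n => if n is m.+1 then a m / m.+1%:R else 0).
Proof.
move=> ea r; have [K aK] := ea r; exists (K * `|r|) => n.
apply: le_trans (ler_wpM2r (normr_ge0 _) (aK n)).
case: n => [|n]; first by rewrite /abs_sum !big_ord0 mul0r.
rewrite /abs_sum big_ord_recl normr0 mul0r add0r mulr_suml big_ord_recr/=.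
rewrite -[leLHS]addr0 lerD ?mulr_ge0 ?exprn_ge0//.
apply: ler_sum => i _; rewrite /bump leq0n add1n exprSr mulrA.
rewrite ler_wpM2r// ler_wpM2r ?exprn_ge0// normrM ler_piMr//.
by rewrite normfV normr_nat invf_le1 ?ltr0n// ler1n.
Qed.

(** Hadamard's factorization, with [b] standing for [1 / a]: [h] is the primitive of [a' b], and its
    real part at radius [r] is at most [q.[r]] plus a constant, so [|h m| r ^ m] is bounded by a
    polynomial of degree below [m] once [m >= size q]. The [maxn 1] leaves room for that constant
    and keeps [m] positive. *)
Theorem entire_zero_free_exp_poly a b (q : {poly R}) : entire a -> entire b ->
  (forall n, conv a b n = (n == 0%N)%:R) ->
  (forall r n, 1 <= r -> abs_sum a r n <= expR q.[r]) ->
  exists h, [/\ h 0%N = 0, forall n, (maxn 1 (size q) <= n)%N -> h n = 0 &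
    forall n, a n = a 0%N * expser h n].
Proof.
move=> ea eb ab1 aq.
have a0 : a 0%N != 0.
  have := ab1 0%N; rewrite /conv big_ord1 subn0 eqxx /= => h1.
  by apply/negP => /eqP a00; move: h1 => /eqP; rewrite a00 mul0r eq_sym oner_eq0.
pose d := conv (pseries_diffs a) b.
have ed : entire d by apply: entire_conv => //; exact: entire_diffs.
pose h n := if n is m.+1 then d m / m.+1%:R else 0.
have eh : entire h by exact: entire_primitive.
have h0 : h 0%N = 0 by [].
have hd : pseries_diffs h = d.
  by apply/funext => n; rewrite /pseries_diffs /h mulrC divfK// pnatr_eq0.
have ah n : pseries_diffs a n = conv (pseries_diffs h) a n.
  rewrite hd; apply/eqP; rewrite -subr_eq0; apply/eqP; move: n.
  apply: psum_eq0.
    apply: entireD; first exact: entire_diffs.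
    have := entireZ (-1) (entire_conv ed ea).
    by congr entire; apply/funext => n; rewrite mulN1r.
  move=> r _; rewrite psumB; [|exact: entire_diffs|exact: entire_conv].
  rewrite !psum_conv//; last exact: entire_diffs.
  rewrite -mulrA [X in _ * X]mulrC -psum_conv// (funext ab1).
  rewrite (@psum_finite _ (fun n => (n == 0%N)%:R) _ 1); last by case.
  by rewrite big_ord1 expr0 !mulr1 subrr.
exists h; split=> //; last exact: expser_unique.
move=> m; rewrite geq_max => /andP[m0 sq].
(* The 2 comes from bounding the modulus by the sum of the absolute real and imaginary parts;
   [L <= exp L] then avoids taking [ln L]. *)
pose L := 2 / `|a 0%N|.
have hA t r : 1 <= r -> csum h t r <= q.[r] + L.
  move=> r1; have [C S] := csum_ssum_exp t r ea eh h0 ah.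
  have bC : `|csum a t r| <= expR q.[r].
    apply: norm_psum_le => n; apply: le_trans (aq r n r1).
    by apply: ler_sum => i _; rewrite ler_wpM2r ?exprn_ge0// normrM ler_piMr// cos_max.
  have bS : `|ssum a t r| <= expR q.[r].
    apply: norm_psum_le => n; apply: le_trans (aq r n r1).
    by apply: ler_sum => i _; rewrite ler_wpM2r ?exprn_ge0// normrM ler_piMr// sin_max.
  have cs := cos2Dsin2 (ssum h t r).
  have e2 : `|a 0%N| * expR (csum h t r) <= 2 * expR q.[r].
    set X := `|a 0%N| * _; have X0 : 0 <= X by rewrite mulr_ge0 ?expR_ge0.
    have XC : X * `|cos (ssum h t r)| = `|csum a t r|.
      by rewrite C !normrM [`|expR _|]ger0_norm ?expR_ge0.
    have XS : X * `|sin (ssum h t r)| = `|ssum a t r|.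
      by rewrite S !normrM [`|expR _|]ger0_norm ?expR_ge0.
    have : X <= X * (`|cos (ssum h t r)| + `|sin (ssum h t r)|).
      rewrite ler_peMr// -cs; apply: lerD.
        by rewrite -real_normK ?num_real// expr2 ler_piMl// cos_max.
      by rewrite -real_normK ?num_real// expr2 ler_piMl// sin_max.
    rewrite mulrDr XC XS; lra.
  rewrite -ler_expR expRD; apply: (@le_trans _ _ (expR q.[r] * L)).
    by rewrite /L mulrA ler_pdivlMr ?normr_gt0// mulrC [_ * 2]mulrC.
  rewrite ler_wpM2l ?expR_ge0//; have := expR_ge1Dx L; lra.
have main : `|h m| <= 0.
  apply: (@poly_bounds_coef _ (2%:P * (q + L%:P)) m).
    apply: leq_trans (size_polyMleq _ _) _.
    rewrite (@size_polyC _ 2) pnatr_eq0/=.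
    apply: leq_trans (size_polyD _ _) _; rewrite geq_max sq/=.
    by apply: leq_trans (size_polyC_leq1 _) _.
  move=> r r1; rewrite !hornerE.
  by apply: coef_le_of_csum_le => // [|t]; [apply: le_trans r1|exact: hA].
by apply/eqP; rewrite -normr_le0.
Qed.

End liouville.

(** * Sums of ridge functions *)

Section frechet.
Context {R : realType}.
Implicit Types (f g phi : R -> R) (s t x : R) (ts : seq R).

Definition fdiff t f x := f (x + t) - f x.
Definition fdiffs ts f := foldr fdiff f ts.

Lemma fdiffC s t f : fdiff s (fdiff t f) = fdiff t (fdiff s f).
Proof. by apply/funext => x; rewrite /fdiff [x + s + t]addrAC; ring. Qed.

Lemma fdiff_fdiffs s ts f : fdiff s (fdiffs ts f) = fdiffs ts (fdiff s f).
Proof. by elim: ts => //= t ts IH; rewrite fdiffC IH. Qed.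

Lemma fdiffsB ts f g x : fdiffs ts (fun x => f x - g x) x = fdiffs ts f x - fdiffs ts g x.
Proof.
elim: ts x => //= t ts IH x.
by rewrite /fdiff !IH; ring.
Qed.

Lemma continuous_fdiff t f : continuous f -> continuous (fdiff t f).
Proof.
move=> cf x; apply: cvgB; last exact: cf.
apply: (@continuous_comp _ _ _ (fun x => x + t) f); last exact: cf.
by apply: cvgD; [exact: cvg_id|exact: cvg_cst].
Qed.

Lemma continuous_fdiffs ts f : continuous f -> continuous (fdiffs ts f).
Proof. by move=> cf; elim: ts => //= t ts IH; exact: continuous_fdiff. Qed.

(** Vanishing second differences make [fdiff s f] a constant, which is then additive in [s];
    continuity makes it linear. *)
Lemma fdiff_linear f : continuous f -> (forall s t x, fdiff s (fdiff t f) x = 0) ->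
  forall s x, fdiff s f x = s * fdiff 1 f 0.
Proof.
move=> cf f0.
have cst s x y : fdiff s f x = fdiff s f y.
  have := f0 (x - y) s y; rewrite {1}/fdiff (_ : y + (x - y) = x); last by ring.
  move=> /eqP.
  by rewrite subr_eq0 => /eqP.
have cg : continuous (fun s => fdiff s f 0).
  move=> s; apply: cvgB; last exact: cvg_cst.
  by rewrite add0r; under eq_fun do rewrite add0r; exact: cf.
have gD s t : fdiff (s + t) f 0 = fdiff s f 0 + fdiff t f 0.
  rewrite [X in _ = _ + X](cst t 0 s) /fdiff !add0r; ring.
move=> s x; rewrite (cst s x 0).
by have := continuous_additive_linear cg gD s; rewrite mulrC.
Qed.

(** By [fdiff_linear] the outermost step enters as a scalar factor and can be replaced by 1; the
    induction then runs on [fdiff 1 f]. *)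
Lemma fdiffs_multilinear m f : continuous f ->
  (forall ts x, size ts = m.+1 -> fdiffs ts f x = 0) ->
  forall ts x, size ts = m -> fdiffs ts f x = (\prod_(t <- ts) t) * fdiffs (nseq m 1) f 0.
Proof.
elim: m f => [|m IH] f cf f0 ts x sts.
  rewrite (size0nil sts) /= big_nil mul1r.
  have := f0 [:: x] 0 erefl; rewrite /= /fdiff add0r => /eqP.
  by rewrite subr_eq0 => /eqP.
case: ts sts => // s ts [sts]; rewrite [LHS]/=.
rewrite (@fdiff_linear (fdiffs ts f)); last 2 first.
- exact: continuous_fdiffs.
- by move=> a b y; apply: (f0 [:: a, b & ts]); rewrite /= sts.
rewrite fdiff_fdiffs IH//; last 2 first.
- exact: continuous_fdiff.
- move=> ts' y sts'; rewrite -fdiff_fdiffs.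
  by apply: (f0 (1 :: ts')); rewrite /= sts'.
by rewrite big_cons mulrA /= fdiff_fdiffs.
Qed.

Lemma fdiff_poly (p : {poly R}) t m : (size p <= m.+2)%N ->
  exists q : {poly R}, [/\ (size q <= m.+1)%N, q`_m = m.+1%:R * t * p`_m.+1 &
    forall x, fdiff t (horner p) x = q.[x]].
Proof.
move=> sp; pose q := \sum_(i < m.+1) t ^+ i.+1 *: p^`N(i.+1).
exists q; split.
- rewrite /q; apply: leq_trans (size_sum _ _ _) _; apply/bigmax_leqP => i _.
  apply: leq_trans (size_scale_leq _ _) _; apply/leq_sizeP => j jm.
  rewrite coef_nderivn nth_default ?mul0rn//.
  by apply: leq_trans sp _; lia.
- rewrite /q coef_sum big_ord_recl big1 ?addr0.
    by rewrite coefZ coef_nderivn expr1 add1n bin1 -mulr_natl; ring.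
  move=> i _; rewrite coefZ coef_nderivn nth_default ?mul0rn ?mulr0//.
  by apply: leq_trans sp _; rewrite /= /bump /=; lia.
move=> x; rewrite /fdiff nderiv_taylor; last exact: mulrC.
have -> : \sum_(i < size p) p^`N(i).[x] * t ^+ i = \sum_(i < m.+2) p^`N(i).[x] * t ^+ i.
  rewrite -!(big_mkord xpredT (fun i => p^`N(i).[x] * t ^+ i)).
  rewrite [RHS](big_cat_nat (leq0n _) sp)/= [X in _ + X]big_nat_cond.
  rewrite [X in _ + X]big1 ?addr0// => i /andP[/andP[si _] _].
  by rewrite nderivn_poly0// horner0 mul0r.
rewrite big_ord_recl nderivn0 expr0 mulr1 addrAC subrr add0r.
rewrite /q horner_sum; apply: eq_bigr => i _.
by rewrite hornerZ mulrC.
Qed.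

Lemma fdiffs_poly m (p : {poly R}) ts x : (size p <= m.+1)%N -> size ts = m ->
  fdiffs ts (horner p) x = m`!%:R * (\prod_(t <- ts) t) * p`_m.
Proof.
elim: m p ts => [|m IH] p ts sp sts.
  rewrite (size0nil sts) big_nil mulr1 mul1r /=.
  by rewrite (size1_polyC sp) hornerC coefC.
case: ts sts => // t ts [sts].
have [q [sq qm qE]] := fdiff_poly t sp.
rewrite /= fdiff_fdiffs (funext qE) IH// qm big_cons factS natrM; ring.
Qed.

(** Frechet's theorem. Subtracting [c X ^ m], with [c] matched to the multilinear value of the
    differences of order [m], lowers the order by one; the factorial in [c] is that of
    [fdiffs_poly]. *)
Theorem continuous_fdiffs0_poly m f : continuous f ->
  (forall ts x, size ts = m -> fdiffs ts f x = 0) ->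
  exists p : {poly R}, forall x, f x = p.[x].
Proof.
elim: m f => [|m IH] f cf f0.
  by exists 0 => x; rewrite horner0; exact: (f0 [::] x).
pose c := fdiffs (nseq m 1) f 0 / m`!%:R.
have [||p pE] := IH (fun x => f x - (c *: 'X^m).[x]); last first.
- by exists (p + c *: 'X^m) => x; rewrite hornerD -pE subrK.
- move=> ts x sts.
  rewrite fdiffsB (fdiffs_multilinear cf f0)// (@fdiffs_poly m) //; last first.
    by apply: leq_trans (size_scale_leq _ _) _; rewrite size_polyXn.
  have cE : m`!%:R * c = fdiffs (nseq m 1) f 0.
    by rewrite /c mulrC divfK// pnatr_eq0 -lt0n fact_gt0.
  by rewrite coefZ coefXn eqxx mulr1 -cE; ring.
- move=> x; apply: cvgB; [exact: cf|exact: continuous_horner].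
Qed.

(* Differencing along a direction orthogonal to [ga k] kills the term of index [k]. *)
Lemma fdiffs_ridge_sum (al : R * R) (I : eqType) (r : seq I) (ga : I -> R * R)
    (g : I -> R -> R) f :
  (exists w : R * R, al.1 * w.1 + al.2 * w.2 = 1) ->
  (forall k, k \in r -> al.1 * (ga k).2 - al.2 * (ga k).1 != 0) ->
  (forall u : R * R, f (al.1 * u.1 + al.2 * u.2) =
     \sum_(k <- r) g k ((ga k).1 * u.1 + (ga k).2 * u.2)) ->
  forall ts x, size ts = size r -> fdiffs ts f x = 0.
Proof.
move=> [w w1]; elim: r f g => [|k r IH] f g det fE ts x sts.
  rewrite (size0nil sts) /=; have := fE (x * w.1, x * w.2); rewrite big_nil /=.
  by rewrite mulrCA (mulrCA al.2) -mulrDr w1 mulr1.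
case: ts sts => // t ts [sts]; rewrite /= fdiff_fdiffs.
have det0 := det k (mem_head _ _).
pose e := t / (al.1 * (ga k).2 - al.2 * (ga k).1).
pose v := (e * (ga k).2, - e * (ga k).1).
have alv : al.1 * v.1 + al.2 * v.2 = t by rewrite /v /e /=; field.
have gav : (ga k).1 * v.1 + (ga k).2 * v.2 = 0 by rewrite /v /=; ring.
apply: (IH _ (fun j => fdiff ((ga j).1 * v.1 + (ga j).2 * v.2) (g j))) => //.
  by move=> j jr; apply: det; rewrite in_cons jr orbT.
move=> u; rewrite /fdiff -[in X in f (_ + X)]alv.
have E (p q : R) : p * u.1 + q * u.2 + (p * v.1 + q * v.2) = p * (u + v).1 + q * (u + v).2.
  by rewrite /=; ring.
rewrite E !fE !big_cons -E gav addr0 opprD addrACA subrr add0r -sumrB.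
by apply: eq_bigr => j _; rewrite E.
Qed.

End frechet.

Lemma cvgn_ext {R : realType} (u v : nat -> R) (l : R) :
  u @ \oo --> l -> (forall n, u n = v n) -> v @ \oo --> l.
Proof. by move=> + /funext <-. Qed.

(** * Exponential moments *)

Section bounded_measurable.
Context {R : realType} {d : measure_display} {T : measurableType d}.
Variable P : probability T R.
Implicit Types f g X : T -> R.

(** Integrable for every probability measure and stable under sums and products, which reduces most
    integrability conditions to closure properties. *)
Definition bm f := measurable_fun setT f /\ exists M, forall x, `|f x| <= M.

Lemma bm_cst (c : R) : bm (fun=> c).
Proof. by split; [exact: measurable_cst|exists `|c|]. Qed.

Lemma bmD f g : bm f -> bm g -> bm (fun x => f x + g x).
Proof.
move=> [mf [M fM]] [mg [N gN]]; split; first exact: measurable_funD.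
by exists (M + N) => x; rewrite (le_trans (ler_normD _ _))// lerD.
Qed.

Lemma bmM f g : bm f -> bm g -> bm (fun x => f x * g x).
Proof.
move=> [mf [M fM]] [mg [N gN]]; split; first exact: measurable_funM.
by exists (M * N) => x; rewrite normrM ler_pM.
Qed.

Lemma bmB f g : bm f -> bm g -> bm (fun x => f x - g x).
Proof.
move=> bf bg; rewrite (_ : (fun x => _) = (fun x => f x + (-1) * g x)).
  by apply: bmD => //; apply: bmM => //; exact: bm_cst.
by apply/funext => x; rewrite mulN1r.
Qed.

Lemma bmX f n : bm f -> bm (fun x => f x ^+ n).
Proof.
move=> bf; elim: n => [|n IH]; first exact: bm_cst.
under eq_fun do rewrite exprS; exact: bmM.
Qed.

Lemma bm_cos X : measurable_fun setT X -> bm (fun x => cos (X x)).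
Proof.
move=> mX; split; last by exists 1 => x; exact: cos_max.
by apply: measurableT_comp => //; apply: continuous_measurable_fun; exact: continuous_cos.
Qed.

Lemma bm_sin X : measurable_fun setT X -> bm (fun x => sin (X x)).
Proof.
move=> mX; split; last by exists 1 => x; exact: sin_max.
by apply: measurableT_comp => //; apply: continuous_measurable_fun; exact: continuous_sin.
Qed.

Lemma bm_integrable f : bm f -> P.-integrable setT (EFin \o f).
Proof.
move=> [mf [M fM]]; apply: measurable_bounded_integrable => //.
- by apply: (le_lt_trans (probability_le1 P measurableT)); rewrite ltry.
- by exists M; split; [exact: num_real|move=> N MN x _; exact: le_trans (fM x) (ltW MN)].
Qed.

Lemma bm_RintD f g : bm f -> bm g ->
  \int[P]_x (f x + g x) = \int[P]_x f x + \int[P]_x g x.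
Proof. by move=> bf bg; rewrite RintegralD//; exact: bm_integrable. Qed.

Lemma bm_RintB f g : bm f -> bm g ->
  \int[P]_x (f x - g x) = \int[P]_x f x - \int[P]_x g x.
Proof. by move=> bf bg; rewrite RintegralB//; exact: bm_integrable. Qed.

Lemma bm_RintZ c f : bm f -> \int[P]_x (c * f x) = c * \int[P]_x f x.
Proof. by move=> bf; rewrite RintegralZl//; exact: bm_integrable. Qed.

Lemma Rint_cst c : \int[P]_x c = c.
Proof.
rewrite Rintegral_cst// (_ : fine _ = fine (P setT))//.
by rewrite probability_setT mulr1.
Qed.

Lemma bm_Rint_le f g : bm f -> bm g -> (forall x, f x <= g x) ->
  \int[P]_x f x <= \int[P]_x g x.
Proof. by move=> bf bg fg; apply: le_Rintegral => //; exact: bm_integrable. Qed.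

Lemma bm_Rint_norm_le f K : bm f -> (forall x, `|f x| <= K) -> `|\int[P]_x f x| <= K.
Proof.
move=> bf fK; have bK := bm_cst K; have bK' := bm_cst (- K).
rewrite ler_norml; apply/andP; split.
  rewrite -[leLHS]Rint_cst; apply: bm_Rint_le => // x.
  by have := fK x; rewrite ler_norml => /andP[].
rewrite -[leRHS]Rint_cst; apply: bm_Rint_le => // x.
by have := fK x; rewrite ler_norml => /andP[].
Qed.

Lemma bm_EFin_Rint f : bm f -> (\int[P]_x (f x)%:E)%E = (\int[P]_x f x)%:E.
Proof.
move=> /bm_integrable bf; rewrite /Rintegral fineK//.
exact: integrable_fin_num.
Qed.

Lemma bm_sum (I : Type) (r : seq I) (F : I -> T -> R) :
  (forall i, bm (F i)) -> bm (fun x => \sum_(i <- r) F i x).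
Proof.
move=> bF; elim: r => [|i r IH].
  by under eq_fun do rewrite big_nil; exact: bm_cst.
by under eq_fun do rewrite big_cons; exact: bmD.
Qed.

Lemma bm_Rint_sum (I : Type) (r : seq I) (F : I -> T -> R) : (forall i, bm (F i)) ->
  \int[P]_x (\sum_(i <- r) F i x) = \sum_(i <- r) \int[P]_x F i x.
Proof.
move=> bF; elim: r => [|i r IH].
  by under eq_Rintegral do rewrite big_nil; rewrite Rint_cst big_nil.
under eq_Rintegral do rewrite big_cons.
by rewrite big_cons bm_RintD// ?IH//; exact: bm_sum.
Qed.

Local Open Scope ereal_scope.

(** The bound is allowed an error [e] that disappears in the limit, as the Taylor remainder in
    [moment_le] requires. *)
Lemma fatou_le (f : (T -> R)^nat) g (K : R) :
  (forall n, measurable_fun setT (f n)) -> (forall n x, (0 <= f n x)%R) ->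
  (forall x, f ^~ x @ \oo --> g x) ->
  (forall e : R, (0 < e)%R -> \forall n \near \oo, \int[P]_x (f n x)%:E <= (K + e)%:E) ->
  \int[P]_x (g x)%:E <= K%:E.
Proof.
move=> mf f0 fg fK.
have gE x : (g x)%:E = limn_einf (fun n => (f n x)%:E).
  apply/esym; apply: (cvg_limn_einf_sup _).1; apply: cvg_EFin; last exact: fg.
  exact: nearW.
under eq_integral do rewrite gE.
have := @fatou _ T R P setT measurableT (fun n x => (f n x)%:E).
move=> /(_ _ _)/le_trans; apply.
- by move=> n; exact/measurable_EFinP.
- by move=> n x _; rewrite lee_fin.
apply/lee_addgt0Pr => e e0; have [N _ NK] := fK e e0.
rewrite limn_einf_lim; apply: lime_le; first exact: is_cvg_einfs.
near=> n; apply: le_trans (NK n _); last by near: n; exists N.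
by apply: ereal_inf_lbound; exists n => /=.
Unshelve. all: by end_near. Qed.

End bounded_measurable.

(** * Moments from an analytic characteristic function *)

Section moments.
Context {R : realType}.

(* Differencing with the steps [t, - t] repeated [k] times multiplies [cos (X x)]
   by a factor of constant sign, so that Fatou bounds the moment of order [2 k]. *)
Definition pm_steps (k : nat) (t : R) : seq R := flatten (nseq k [:: t; - t]).

Lemma size_pm_steps k t : size (pm_steps k t) = k.*2.
Proof. by elim: k => //= k ->; rewrite doubleS. Qed.

Lemma prod_pm_steps k t : \prod_(s <- pm_steps k t) s = (- t ^+ 2) ^+ k.
Proof.
elim: k => [|k IH]; first by rewrite big_nil expr0.
by rewrite /pm_steps/= !big_cons IH [RHS]exprS mulrA mulrN -expr2.
Qed.

Lemma fdiffs_bound ts (f : R -> R) C (x : R) :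
  (forall y, `|y - x| <= \sum_(t <- ts) `|t| -> `|f y| <= C) ->
  `|fdiffs ts f x| <= 2 ^+ size ts * C.
Proof.
elim: ts x => [|t ts IH] x fC.
  by rewrite /= expr0 mul1r; apply: fC; rewrite subrr normr0 big_nil.
rewrite /= /fdiff exprS -mulrA; apply: le_trans (ler_normB _ _) _.
have -> : 2 * (2 ^+ size ts * C) = 2 ^+ size ts * C + 2 ^+ size ts * C by ring.
apply: lerD; apply: IH => y yx; apply: fC; rewrite big_cons.
  have -> : y - x = t + (y - (x + t)) by ring.
  by apply: le_trans (ler_normD _ _) _; rewrite lerD2l.
by apply: le_trans yx _; rewrite lerDr.
Qed.

Lemma sum_norm_pm_steps k t : \sum_(s <- pm_steps k t) `|s| = k.*2%:R * `|t|.
Proof.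
elim: k => [|k IH]; first by rewrite big_nil mul0r.
by rewrite /pm_steps/= !big_cons IH doubleS normrN -!natr1; ring.
Qed.

Lemma psum_taylor (g : nat -> R) m : entire g ->
  exists K, 0 <= K /\ forall s, `|s| <= 1 ->
    `|psum g s - (\poly_(i < m) g i).[s]| <= K * `|s| ^+ m.
Proof.
move=> eg; have [K gK] := eg 1; exists K.
have K0 : 0 <= K by apply: le_trans (gK 0%N); rewrite /abs_sum big_ord0.
split=> // s s1.
pose c n := if (n < m)%N then 0 else g n.
pose e n := if (n < m)%N then g n else 0.
have ee : entire e by apply: (@entire_finite _ _ m) => n; rewrite /e ltnNge => ->.
have ec : entire c by apply: entire_le eg _ => n; rewrite /c; case: ifP; rewrite ?normr0.
have -> : psum g s = psum e s + psum c s.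
  by rewrite -psumD//; apply: eq_psum => n; rewrite /c /e; case: ifP; rewrite ?addr0 ?add0r.
have -> : psum e s = (\poly_(i < m) g i).[s].
  rewrite (@psum_finite _ _ _ m); last by move=> n; rewrite /e ltnNge => ->.
  by rewrite horner_poly; apply: eq_bigr => i _; rewrite /e ltn_ord.
rewrite addrAC subrr add0r; apply: norm_psum_le => n.
apply: le_trans (ler_wpM2r _ (gK n)); last by rewrite exprn_ge0.
rewrite /abs_sum mulr_suml; apply: ler_sum => i _; rewrite normr1 expr1n mulr1.
rewrite /c; case: ltnP => im; first by rewrite normr0 mul0r mulr_ge0// exprn_ge0.
by rewrite ler_wpM2l// ler_wiXn2l.
Qed.

Lemma sin_div_cvg (x : R) : (fun m : nat => 2 * (sin (m.+1%:R^-1 * x / 2) / m.+1%:R^-1)) @ \oo --> x.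
Proof.
have t0 : (fun m : nat => m.+1%:R^-1 : R) @ \oo --> (0 : R)^'.
  have h : (fun m : nat => m.+1%:R^-1 : R) @ \oo --> (0 : R) by exact: cvg_harmonic.
  move=> A [e /= e0 eA]; have /cvgrPdist_lt/(_ e e0) := h.
  apply: filterS => m me; apply: eA => //=.
have df : is_derive (0 : R) (1 : R) (fun t => sin (t * x / 2)) (x / 2).
  have -> : (fun t => sin (t * x / 2)) = sin \o (fun t => (x / 2) * t).
    by apply/funext => t /=; congr sin; ring.
  have dg : is_derive (0 : R) (1 : R) (fun t : R => (x / 2) * t) ((x / 2) *: 1).
    exact: (@is_deriveZ _ _ _ id (x / 2)).
  have := @is_derive1_comp _ sin _ 0 _ _ (is_derive_sin _) dg.
  by rewrite mulr0 cos0 mul1r /GRing.scale/= mulr1.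
have [/cvg_ex[l hl] dE] := df.
have lE : l = x / 2 by rewrite -dE; apply/esym/cvg_lim.
rewrite lE in hl; have hc := cvg_comp _ _ t0 hl.
have := cvgMl_tmp (a := 2) hc; rewrite [X in _ --> X]mulrC divfK// => h2.
apply: cvgn_ext (h2 _) _ => m /=.
rewrite /GRing.scale/= mulr1 addr0 mul0r mul0r sin0 subr0.
by congr (_ * _); rewrite mulrC.
Qed.

Lemma cos_div_cvg (x : R) k :
  (fun m : nat => ((2 - 2 * cos (m.+1%:R^-1 * x)) / m.+1%:R^-1 ^+ 2) ^+ k) @ \oo --> x ^+ k.*2.
Proof.
have h := @sin_div_cvg x.
have h2 : (fun m : nat => (2 * (sin (m.+1%:R^-1 * x / 2) / m.+1%:R^-1)) ^+ k.*2) @ \oo --> x ^+ k.*2.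
  have cX : continuous (fun y : R => y ^+ k.*2) by exact: exprn_continuous.
  exact: cvg_comp h (cX x).
apply: cvgn_ext h2 _ => m.
rewrite -mul2n exprM; congr (_ ^+ _).
have : m.+1%:R^-1 != 0 :> R by rewrite invr_eq0 pnatr_eq0.
set u := m.+1%:R^-1 => u0; set a := u * x / 2.
have -> : u * x = a + a by rewrite /a; field.
by rewrite cosD -!expr2 cos2sin2; field.
Qed.

Context {d : measure_display} {T : measurableType d} (P : probability T R).
Variables (X : T -> R) (mX : measurable_fun setT X) (g : nat -> R).
Hypothesis eg : entire g.
Hypothesis charE : forall t, \int[P]_x cos (t * X x) = psum g t.

Let mtX (t : R) : measurable_fun setT (fun x => t * X x).
Proof. exact: measurable_funM. Qed.

Let W t k x := (2 - 2 * cos (t * X x)) ^+ k.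

Let bmW t k : bm (W t k).
Proof.
apply: bmX; apply: bmB; first exact: bm_cst.
by apply: bmM; [exact: bm_cst|exact: bm_cos].
Qed.

Lemma fdiffs_psum_char k t s :
  fdiffs (pm_steps k t) (psum g) s = \int[P]_x (W t k x * cos (s * X x)).
Proof.
elim: k s => [|k IH] s.
  by rewrite /= -charE; apply: eq_Rintegral => x _; rewrite /W expr0 mul1r.
rewrite /pm_steps/= -/(pm_steps k t) /fdiff !IH.
have bc u : bm (fun x => W t k x * cos (u * X x)).
  by apply: bmM => //; exact: bm_cos.
rewrite -bm_RintB// -bm_RintB// -bm_RintB//; [|exact: bmB..].
apply: eq_Rintegral => x _; rewrite /W exprS.
rewrite (_ : (s + t + - t) * X x = s * X x); last by ring.
rewrite !mulrDl mulNr cosD cosB; ring.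
Qed.

Lemma moment_le k : (\int[P]_x (X x ^+ k.*2)%:E <= (k.*2`!%:R * `|g k.*2|)%:E)%E.
Proof.
have [K [K0 Kg]] := psum_taylor k.*2.+1 eg.
(* [2 ^ (2 k)] counts the terms of a difference of order [2 k], and [K (2 k t) ^ (2 k + 1)] is the
   Taylor remainder on the interval of radius [2 k t] that the steps can reach. *)
pose C := 2 ^+ k.*2 * (K * k.*2%:R ^+ k.*2.+1).
have bound t : 0 < t -> k.*2%:R * t <= 1 ->
    \int[P]_x W t k x <= t ^+ k.*2 * (k.*2`!%:R * `|g k.*2| + C * t).
  move=> t0 kt.
  have -> : \int[P]_x W t k x = fdiffs (pm_steps k t) (psum g) 0.
    by rewrite fdiffs_psum_char; apply: eq_Rintegral => x _; rewrite mul0r cos0 mulr1.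
  pose p := \poly_(i < k.*2.+1) g i.
  have -> : fdiffs (pm_steps k t) (psum g) 0 =
      fdiffs (pm_steps k t) (fun s => psum g s - p.[s]) 0 + fdiffs (pm_steps k t) (horner p) 0.
    by rewrite fdiffsB subrK.
  rewrite (fdiffs_poly _ (size_poly _ _) (size_pm_steps k t)) coef_poly ltnSn prod_pm_steps.
  apply: le_trans (ler_norm _) _; apply: le_trans (ler_normD _ _) _.
  rewrite mulrDr addrC; apply: lerD.
    rewrite !normrM normr_nat normrX normrN normrX (gtr0_norm t0) -exprM mul2n.
    by rewrite [leRHS]mulrCA mulrA.
  have -> : t ^+ k.*2 * (C * t) = 2 ^+ size (pm_steps k t) * (K * (k.*2%:R * t) ^+ k.*2.+1).
    by rewrite /C size_pm_steps exprMn [t ^+ _.+1]exprS; ring.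
  apply: fdiffs_bound => y; rewrite subr0 sum_norm_pm_steps (gtr0_norm t0) => yt.
  apply: le_trans (Kg y (le_trans yt kt)) _.
  by rewrite ler_wpM2l// lerXn2r// nnegrE// mulr_ge0// ltW.
pose u (m : nat) : R := m.+1%:R^-1.
have u0 m : 0 < u m by rewrite invr_gt0.
apply: (@fatou_le _ _ _ P (fun m x => ((2 - 2 * cos (u m * X x)) / u m ^+ 2) ^+ k)).
- move=> m; rewrite (_ : (fun x => _) = (fun x => W (u m) k x * (u m ^+ 2)^-1 ^+ k)).
    by apply: measurable_funM => //; have [] := bmW (u m) k.
  by apply/funext => x; rewrite /W exprMn.
- move=> m x; apply: exprn_ge0; apply: divr_ge0; last by rewrite exprn_ge0// ltW.
  by rewrite subr_ge0 ler_piMr// cos_le1.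
- by move=> x; exact: cos_div_cvg.
move=> e e0.
have cu : C * u m @[m --> \oo] --> (0 : R).
  by rewrite -(mulr0 C); apply: cvgMl_tmp; exact: cvg_harmonic.
have cu2 : k.*2%:R * u m @[m --> \oo] --> (0 : R).
  by rewrite -(mulr0 k.*2%:R); apply: cvgMl_tmp; exact: cvg_harmonic.
have /cvgrPdist_le/(_ e e0) A1 := cu.
have /cvgrPdist_le/(_ 1 ltr01) A2 := cu2.
near=> m.
have um2 : 0 < u m ^+ k.*2 by rewrite exprn_gt0.
have -> : (\int[P]_x (((2 - 2 * cos (u m * X x)) / u m ^+ 2) ^+ k)%:E =
   ((u m ^+ k.*2)^-1 * \int[P]_x W (u m) k x)%:E)%E.
  rewrite -bm_RintZ// -bm_EFin_Rint; last by apply: bmM => //; exact: bm_cst.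
  by apply: eq_integral => x _; rewrite /W exprMn exprVn -exprM mul2n mulrC.
rewrite lee_fin ler_pdivrMl//; apply: le_trans (bound _ (u0 m) _) _.
  have : `|0 - k.*2%:R * u m| <= 1 by near: m.
  by rewrite sub0r normrN; apply: le_trans; exact: ler_norm.
rewrite ler_pM2l// lerD2l.
have : `|0 - C * u m| <= e by near: m.
by rewrite sub0r normrN; apply: le_trans; exact: ler_norm.
Unshelve. all: by end_near. Qed.

Lemma cosh_partial_cvg (y : R) :
  (fun M => \sum_(i < M) 2 * (y ^+ i.*2 / i.*2`!%:R)) @ \oo --> expR y + expR (- y).
Proof.
have dbl : n.*2 @[n --> \oo] --> \oo.
  by move=> A [N _ NA]; exists N => // n /= Nn; apply: NA => /=; rewrite -addnn; lia.
have h (z : R) : series (exp_coeff z) n.*2 @[n --> \oo] --> expR z.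
  by apply: cvg_comp dbl _; exact: is_cvg_series_exp_coeff.
have hD := cvgD (h y) (h (- y)).
apply: cvgn_ext (hD _) _ => M; rewrite [LHS](_ : _ = series (exp_coeff y) M.*2 + series (exp_coeff (- y)) M.*2)//.
rewrite /series/= -big_split/=.
rewrite big_mkord; elim: M => [|M IH]; first by rewrite !big_ord0.
rewrite doubleS !big_ord_recr/= IH -addrA; congr (_ + _).
have e : (-1) ^+ M.*2 = 1 :> R by rewrite -signr_odd odd_double.
rewrite /exp_coeff/= [(- y) ^+ M.*2]exprNn [(- y) ^+ M.*2.+1]exprNn.
by rewrite [(-1) ^+ M.*2.+1]exprS e; ring.
Qed.

(** The integrand is at most [2 cosh (r X)], whose expansion involves only even moments, those
    controlled by [moment_le]; the factorials cancel and leave terms of [abs_sum g r]. *)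
Lemma exp_moment_le r K : (forall n, abs_sum g r n <= K) ->
  (\int[P]_x (expR (r * `|X x|))%:E <= (2 * K)%:E)%E.
Proof.
move=> gK.
pose F i x := 2 * ((r * X x) ^+ i.*2 / i.*2`!%:R).
have F0 i x : 0 <= F i x.
  by rewrite mulr_ge0// divr_ge0// -mul2n exprM exprn_ge0// sqr_ge0.
have mF i : measurable_fun setT (F i).
  apply: measurable_funM => //; apply: measurable_funM => //.
  by apply: measurable_funX; exact: mtX.
have FE i : (\int[P]_x (F i x)%:E <= (2 * (`|g i.*2| * `|r| ^+ i.*2))%:E)%E.
  have f0 : 0 < i.*2`!%:R :> R by rewrite ltr0n fact_gt0.
  have c0 : 0 <= 2 * r ^+ i.*2 / i.*2`!%:R.
    apply: divr_ge0; last exact: ltW.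
    by apply: mulr_ge0 => //; rewrite -mul2n exprM exprn_ge0// sqr_ge0.
  have -> : (\int[P]_x (F i x)%:E = (2 * r ^+ i.*2 / i.*2`!%:R)%:E * \int[P]_x (X x ^+ i.*2)%:E)%E.
    rewrite -ge0_integralZl_EFin//.
    - by apply: eq_integral => x _; rewrite -EFinM /F exprMn; congr _%:E; ring.
    - by move=> x _; rewrite lee_fin -mul2n exprM exprn_ge0// sqr_ge0.
    - by apply/measurable_EFinP; exact: measurable_funX.
  apply: le_trans (lee_wpmul2l _ (moment_le i)) _; first by rewrite lee_fin.
  rewrite -EFinM lee_fin -normrX [`|r ^+ _|]ger0_norm; last by rewrite -mul2n exprM exprn_ge0// sqr_ge0.
  by rewrite le_eqVlt; apply/orP; left; apply/eqP; field; rewrite gt_eqF.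
apply: (@le_trans _ _ (\int[P]_x (expR (r * X x) + expR (- (r * X x)))%:E)%E).
  apply: ge0_le_integral => //.
  - apply/measurable_EFinP; apply: measurableT_comp => //; apply: measurable_funM => //.
    exact: measurableT_comp.
  - apply/measurable_EFinP; apply: measurable_funD; apply: measurableT_comp => //.
    by apply: measurableT_comp => //; exact: mtX.
  - move=> x _; rewrite lee_fin; case: (ger0P (X x)) => _; first by rewrite lerDl expR_ge0.
    by rewrite mulrN lerDr expR_ge0.
apply: (@fatou_le _ _ _ P (fun M x => \sum_(i < M) F i x)).
- by move=> M; apply: measurable_sum.
- by move=> M x; apply: sumr_ge0.
- by move=> x; exact: cosh_partial_cvg.
move=> e e0; apply: nearW => M.
under eq_integral do rewrite -sumEFin.
rewrite ge0_integral_sum//; last 2 first.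
- by move=> i; apply/measurable_EFinP.
- by move=> i x _; rewrite lee_fin.
apply: (@le_trans _ _ (\sum_(i < M) (2 * (`|g i.*2| * `|r| ^+ i.*2))%:E)%E).
  by apply: lee_sum => i _.
rewrite sumEFin lee_fin -mulr_sumr; apply: ler_wpDr; first exact: ltW.
rewrite ler_pM2l//; apply: le_trans (gK M.*2).
elim: M => [|M IH]; first by rewrite big_ord0 abs_sum_ge0.
by rewrite doubleS /abs_sum !big_ord_recr/= -addrA lerD// lerDl mulr_ge0// exprn_ge0.
Qed.

End moments.

Section product_probability.
Context {R : realType} {d1 d2 : measure_display}
  {T1 : measurableType d1} {T2 : measurableType d2}.
Variables (P1 : probability T1 R) (P2 : probability T2 R).

Definition prodP : probability (T1 * T2)%type R := (P1 \x P2)%E.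

Lemma bm_fst (f : T1 -> R) : bm f -> bm (fun z : T1 * T2 => f z.1).
Proof.
move=> [mf [M fM]]; split; last by exists M => x; exact: fM.
exact: (measurableT_comp mf).
Qed.

Lemma bm_snd (f : T2 -> R) : bm f -> bm (fun z : T1 * T2 => f z.2).
Proof.
move=> [mf [M fM]]; split; last by exists M => x; exact: fM.
exact: (measurableT_comp mf).
Qed.

Lemma bm_Rint_prod (F : T1 * T2 -> R) : bm F ->
  \int[prodP]_z F z = \int[P1]_x \int[P2]_y F (x, y).
Proof.
move=> bF; have iF := bm_integrable prodP bF.
rewrite /Rintegral -(integral12_prod_meas1 iF); congr fine.
apply: eq_integral => x _; rewrite /fubini_F /= fineK//.
apply: integrable_fin_num => //; apply: bm_integrable.
have [mF [M FM]] := bF; split; last by exists M => y; exact: FM.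
exact: measurableT_comp mF (measurable_pair1 x).
Qed.

Lemma bm_Rint_prod2 (F : T1 * T2 -> R) : bm F ->
  \int[prodP]_z F z = \int[P2]_y \int[P1]_x F (x, y).
Proof.
move=> bF; have iF := bm_integrable prodP bF.
rewrite /Rintegral -(integral21_prod_meas1 iF); congr fine.
apply: eq_integral => y _; rewrite /fubini_G /= fineK//.
apply: integrable_fin_num => //; apply: bm_integrable.
have [mF [M FM]] := bF; split; last by exists M => x; exact: FM.
exact: measurableT_comp mF (measurable_pair2 y).
Qed.

Lemma bm_Rint_mul (f : T1 -> R) (h : T2 -> R) : bm f -> bm h ->
  \int[prodP]_z (f z.1 * h z.2) = \int[P1]_x f x * \int[P2]_y h y.
Proof.
move=> bf bh; rewrite bm_Rint_prod/=; last first.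
  by apply: bmM; [exact: bm_fst|exact: bm_snd].
under eq_Rintegral do rewrite bm_RintZ//.
by under eq_Rintegral do rewrite mulrC; rewrite bm_RintZ// mulrC.
Qed.

End product_probability.

(** * Exponential moments of a factor *)

Section factor_moments.
Context {R : realType}.

Definition chf {d} {T : measurableType d} (P : probability T R) (X : T -> R) (t : R) : R[i] :=
  (\int[P]_x cos (t * X x)) +i* (\int[P]_x sin (t * X x)).

(** The underlying probability space is existential, so that products stay in the class by passing
    to a product space. *)
Definition is_chf (k : R -> R[i]) : Prop :=
  exists (d : measure_display) (T : measurableType d) (P : probability T R) (X : T -> R),
    measurable_fun setT X /\ forall t, k t = chf P X t.

Lemma chf_prodP {d1 d2} {T1 : measurableType d1} {T2 : measurableType d2}
    (P1 : probability T1 R) (P2 : probability T2 R) (X : T1 -> R) (Y : T2 -> R) t :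
  measurable_fun setT X -> measurable_fun setT Y ->
  chf (prodP P1 P2) (fun z => X z.1 + Y z.2) t = chf P1 X t * chf P2 Y t.
Proof.
move=> mX mY.
have bcX : bm (fun x => cos (t * X x)) by apply: bm_cos; exact: measurable_funM.
have bsX : bm (fun x => sin (t * X x)) by apply: bm_sin; exact: measurable_funM.
have bcY : bm (fun x => cos (t * Y x)) by apply: bm_cos; exact: measurable_funM.
have bsY : bm (fun x => sin (t * Y x)) by apply: bm_sin; exact: measurable_funM.
have b1 (f : T1 -> R) (h : T2 -> R) : bm f -> bm h -> bm (fun z : T1 * T2 => f z.1 * h z.2).
  by move=> bf bh; apply: bmM; [exact: bm_fst|exact: bm_snd].
rewrite /chf /= [RHS]/GRing.mul/=; congr (_ +i* _).
  transitivity (\int[prodP P1 P2]_z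
      (cos (t * X z.1) * cos (t * Y z.2) - sin (t * X z.1) * sin (t * Y z.2))).
    by apply: eq_Rintegral => z _; rewrite mulrDr cosD.
  rewrite bm_RintB; [|exact: (b1 (fun x => cos (t * X x)) (fun y => cos (t * Y y)))
    |exact: (b1 (fun x => sin (t * X x)) (fun y => sin (t * Y y)))].
  congr (_ - _).
    exact: (@bm_Rint_mul _ _ _ _ _ P1 P2 (fun x => cos (t * X x)) (fun y => cos (t * Y y))).
  exact: (@bm_Rint_mul _ _ _ _ _ P1 P2 (fun x => sin (t * X x)) (fun y => sin (t * Y y))).
transitivity (\int[prodP P1 P2]_z
    (cos (t * X z.1) * sin (t * Y z.2) + sin (t * X z.1) * cos (t * Y z.2))).
  by apply: eq_Rintegral => z _; rewrite mulrDr sinD addrC.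
rewrite bm_RintD; [|exact: (b1 (fun x => cos (t * X x)) (fun y => sin (t * Y y)))
  |exact: (b1 (fun x => sin (t * X x)) (fun y => cos (t * Y y)))].
congr (_ + _).
  exact: (@bm_Rint_mul _ _ _ _ _ P1 P2 (fun x => cos (t * X x)) (fun y => sin (t * Y y))).
exact: (@bm_Rint_mul _ _ _ _ _ P1 P2 (fun x => sin (t * X x)) (fun y => cos (t * Y y))).
Qed.

Lemma is_chfM k1 k2 : is_chf k1 -> is_chf k2 -> is_chf (fun t => k1 t * k2 t).
Proof.
move=> [d1 [T1 [P1 [X [mX E1]]]]] [d2 [T2 [P2 [Y [mY E2]]]]].
exists _, (T1 * T2)%type, (prodP P1 P2), (fun z => X z.1 + Y z.2); split.
  by apply: measurable_funD; [exact: (measurableT_comp mX)|exact: (measurableT_comp mY)].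
by move=> t; rewrite chf_prodP// E1 E2.
Qed.

Lemma is_chf_cst1 : is_chf (fun=> 1).
Proof.
exists _, R, (\d_(0 : R) : probability R R), (fun=> 0); split; first exact: measurable_cst.
move=> t; rewrite /chf mulr0 cos0 sin0.
by rewrite !Rint_cst.
Qed.

Lemma is_chf_prod (I : Type) (r : seq I) (p : pred I) (k : I -> R -> R[i]) :
  (forall i, p i -> is_chf (k i)) -> is_chf (fun t => \prod_(i <- r | p i) k i t).
Proof.
move=> kc; elim: r => [|i r IH].
  by under eq_fun do rewrite big_nil; exact: is_chf_cst1.
case pi: (p i); under eq_fun do rewrite big_cons pi; last exact: IH.
by apply: is_chfM => //; exact: kc.
Qed.

(** With [k] the characteristic function of an independent [Y], the series [g] belongs to [X + Y].
    For some [n] the event [|Y| <= n] has probability at least 1/2, and on it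
    [exp (r |X|) <= exp (r n) exp (r |X + Y|)]. So [A = n], and 4 is the product of this 2 and of
    the one in [exp_moment_le]. *)
Lemma exp_moment_factor d (T : measurableType d) (P : probability T R) (X : T -> R) k g :
  measurable_fun setT X -> is_chf k -> entire g ->
  (forall t, chf P X t * k t = (psum g t)%:C) ->
  exists A, forall r K, 0 <= r -> (forall n, abs_sum g r n <= K) ->
    (\int[P]_x (expR (r * `|X x|))%:E <= (4 * expR (r * A) * K)%:E)%E.
Proof.
move=> mX [d2 [T2 [P2 [Y [mY kE]]]]] eg gE.
pose E n := [set y | `|Y y| <= n%:R].
have mE n : measurable (E n).
  rewrite (_ : E n = (fun y => `|Y y|) @^-1` `]-oo, n%:R]%classic); last first.
    by apply/seteqP; split => y; rewrite /E/= in_itv.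
  by rewrite -[X in measurable X]setTI; apply: (measurableT_comp _ mY) => //.
have UE : \bigcup_n E n = setT.
  apply/seteqP; split => // y _; exists (Num.truncn `|Y y|).+1 => //=.
  by rewrite /E/= ltW// truncnS_gt.
have ndE : nondecreasing_seq E.
  by move=> m n mn; apply/subsetPset => y; rewrite /E/= => /le_trans; apply; rewrite ler_nat.
have := nondecreasing_cvg_mu mE _ ndE (mu := P2); rewrite UE => /(_ measurableT).
rewrite (_ : (P2 : {measure set T2 -> \bar R}) setT = 1%E); last exact: probability_setT.
move=> cE.
have [n hn] : exists n, (2^-1%:E <= P2 (E n))%E.
  apply: contrapT => hn.
  have : (1%:E <= 2^-1%:E :> \bar R)%E.
    apply: (cvge_le _ cE); apply: nearW => n /=.
    by rewrite leNgt; apply/negP => /ltW nE; apply: hn; exists n.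
  by rewrite lee_fin; lra.
exists n%:R => r K r0 gK.
pose Z (z : T * T2) := X z.1 + Y z.2.
have mZ : measurable_fun setT Z.
  by apply: measurable_funD; [exact: (measurableT_comp mX)|exact: (measurableT_comp mY)].
have hZ t : \int[prodP P P2]_z cos (t * Z z) = psum g t.
  by have := gE t; rewrite kE -chf_prodP// => /(congr1 (@complex.Re R)).
have := exp_moment_le mZ eg hZ gK.
pose F (z : T * T2) := (expR (r * `|Z z|))%:E.
have mF : measurable_fun setT F.
  apply/measurable_EFinP; apply: measurableT_comp => //; apply: measurable_funM => //.
  exact: measurableT_comp.
have F0 z : (0 <= F z)%E by rewrite lee_fin expR_ge0.
rewrite -/F /prodP (fubini_tonelli2 F mF F0) => hG.
set M := (\int[P]_x _)%E.
have M0 : (0 <= M)%E by apply: integral_ge0 => x _; rewrite lee_fin expR_ge0.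
have e0 : 0 < expR (- (r * n%:R)) :> R by exact: expR_gt0.
have mM : measurable_fun setT (fun x => (expR (r * `|X x|))%:E).
  apply/measurable_EFinP; apply: measurableT_comp => //; apply: measurable_funM => //.
  exact: measurableT_comp.
have key : (\int[P2]_(y in E n) ((expR (- (r * n%:R)))%:E * M) <= (2 * K)%:E)%E.
  apply: le_trans hG.
  apply: le_trans (_ : \int[P2]_(y in E n) fubini_G P F y <= _)%E; last first.
    apply: ge0_subset_integral => //.
    - by apply: measurable_fun_fubini_tonelli_G.
    - by move=> y _; apply: integral_ge0 => x _.
  apply: ge0_le_integral => //.
  - by move=> y _; rewrite mule_ge0// lee_fin ltW.
  - by apply: measurable_funTS; apply: measurable_fun_fubini_tonelli_G.
  - move=> y yE; rewrite /M -ge0_integralZl_EFin//.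
    apply: ge0_le_integral => //.
    + by under eq_fun do rewrite -EFinM; apply/measurable_EFinP; apply: measurable_funM => //; exact/measurable_EFinP.
    + by apply: (measurableT_comp mF); exact: measurable_pair2.
    + move=> x _; rewrite -EFinM lee_fin -expRD ler_expR /Z /=.
      rewrite -mulrN -mulrDr ler_wpM2l// addrC lerBlDr.
      apply: le_trans (_ : `|X x + Y y| + `|Y y| <= _); last by rewrite lerD2l.
      by rewrite -[leLHS](normrN) -{1}(addrK (Y y) (X x)) normrN; exact: ler_normB.
rewrite [leLHS](_ : _ = (expR (- (r * n%:R)))%:E * M * P2 (E n))%E in key; last first.
  exact: integral_cst.
have {}key : ((expR (- (r * n%:R)) / 2)%:E * M <= (2 * K)%:E)%E.
  apply: le_trans key; rewrite EFinM muleAC; apply: lee_wpmul2l => //.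
  by rewrite mule_ge0// lee_fin ltW.
rewrite (_ : 4 * expR (r * n%:R) * K = (expR (- (r * n%:R)) / 2)^-1 * (2 * K)).
  by rewrite EFinM lee_pdivlMl// divr_gt0.
by rewrite invfM invrK expRN invrK; ring.
Qed.

End factor_moments.

Section exp_partial.
Context {R : realType}.

Lemma exp_partial_le (y : R) n : 0 <= y -> \sum_(i < n) y ^+ i / i`!%:R <= expR y.
Proof.
move=> y0.
have -> : \sum_(i < n) y ^+ i / i`!%:R = series (exp_coeff y) n.
  by rewrite /series/= big_mkord.
apply: nondecreasing_cvgn_le; last exact: is_cvg_series_exp_coeff.
apply/nondecreasing_seqP => k; rewrite /series/= big_nat_recr//= lerDl.
by rewrite /exp_coeff/= divr_ge0// exprn_ge0.
Qed.

(** The series [z]. Its exponential has the coefficients [1 / n!], so the polar form of [expser]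
    yields the real and imaginary parts of [exp (y exp (i t))]. *)
Definition exp_line (n : nat) : R := (n == 1%N)%:R.

Lemma entire_exp_line : entire exp_line.
Proof. by apply: (@entire_finite _ _ 2) => -[|[]]. Qed.

Lemma expser_exp_line n : expser exp_line n = n`!%:R^-1.
Proof.
have -> : n`!%:R^-1 = (0`!%:R^-1 : R) * expser exp_line n; last by rewrite fact0 invr1 mul1r.
apply: (@expser_unique _ (fun n => n`!%:R^-1)) => {}n.
rewrite pseries_diffs_inv_fact /conv big_ord_recl big1 ?addr0.
  by rewrite subn0 /pseries_diffs /exp_line/= !mul1r.
by move=> i _; rewrite /pseries_diffs /exp_line/= mulr0 mul0r.
Qed.

Lemma psum_exp_line_mul (w : nat -> R) r : psum (fun n => exp_line n * w n) r = w 1%N * r.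
Proof.
rewrite (@psum_finite _ _ _ 2); last by case=> [|[]]// n _; rewrite mul0r.
by rewrite big_ord_recr big_ord1/= /exp_line/= mul0r mul0r add0r mul1r expr1.
Qed.

Lemma cos_exp_cvg (y t : R) :
  (fun N => \sum_(i < N) y ^+ i / i`!%:R * cos (i%:R * t)) @ \oo -->
  expR (y * cos t) * cos (y * sin t).
Proof.
have e := entire_expser entire_exp_line erefl.
have := psum_cvg (r := y) (entire_cos t e).
rewrite -[psum _ _]/(csum (expser exp_line) t y) (csum_expser _ _ entire_exp_line erefl).
rewrite /csum /ssum !psum_exp_line_mul !mul1r [cos t * y]mulrC [sin t * y]mulrC => h.
apply: cvgn_ext h _ => N; rewrite /pseries/series/= big_mkord.
by apply: eq_bigr => i _; rewrite expser_exp_line; ring.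
Qed.

Lemma sin_exp_cvg (y t : R) :
  (fun N => \sum_(i < N) y ^+ i / i`!%:R * sin (i%:R * t)) @ \oo -->
  expR (y * cos t) * sin (y * sin t).
Proof.
have e := entire_expser entire_exp_line erefl.
have := psum_cvg (r := y) (entire_sin t e).
rewrite -[psum _ _]/(ssum (expser exp_line) t y) (ssum_expser _ _ entire_exp_line erefl).
rewrite /csum /ssum !psum_exp_line_mul !mul1r [cos t * y]mulrC [sin t * y]mulrC => h.
apply: cvgn_ext h _ => N; rewrite /pseries/series/= big_mkord.
by apply: eq_bigr => i _; rewrite expser_exp_line; ring.
Qed.

End exp_partial.

(** * Laplace transforms as entire series *)

Section laplace.
Context {R : realType} {d : measure_display} {T : measurableType d}.
Variables (P : probability T R) (X e : T -> R).
Hypothesis mX : measurable_fun setT X.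
Hypothesis me : measurable_fun setT e.
Hypothesis e1 : forall x, `|e x| <= 1.

(* Taylor coefficients of [r |-> E (e exp (r X))]. *)
Definition lap (n : nat) : R := (\int[P]_x (e x * X x ^+ n)) / n`!%:R.

Hypothesis iX : forall r, 0 <= r -> P.-integrable setT (EFin \o (fun x => expR (r * `|X x|))).

Let term_le r n x : `|(r * X x) ^+ n / n`!%:R| <= expR (`|r| * `|X x|).
Proof.
rewrite normrM normfV normrX normrM normr_nat.
have := @exp_partial_le R (`|r| * `|X x|) n.+1 (mulr_ge0 (normr_ge0 _) (normr_ge0 _)).
rewrite big_ord_recr/=; apply: le_trans; rewrite lerDr.
by apply: sumr_ge0 => i _; rewrite divr_ge0// exprn_ge0// mulr_ge0.
Qed.

Let mterm r n : measurable_fun setT (fun x => e x * ((r * X x) ^+ n / n`!%:R)).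
Proof.
apply: measurable_funM => //; apply: measurable_funM => //.
by apply: measurable_funX; exact: measurable_funM.
Qed.

Let iterm r n : P.-integrable setT (EFin \o (fun x => e x * ((r * X x) ^+ n / n`!%:R))).
Proof.
apply: (le_integrable measurableT _ _ (iX (normr_ge0 r))).
  exact/measurable_EFinP/mterm.
move=> x _ /=; rewrite lee_fin normrM [leRHS]ger0_norm ?expR_ge0//.
apply: le_trans (term_le r n x).
by rewrite ler_piMl.
Qed.

Let lapE r n : lap n * r ^+ n = \int[P]_x (e x * ((r * X x) ^+ n / n`!%:R)).
Proof.
have i1 : P.-integrable setT (EFin \o (fun x => e x * X x ^+ n)).
  have := @iterm 1 n; have f0 : n`!%:R != 0 :> R by rewrite pnatr_eq0 -lt0n fact_gt0.
  move=> /(integrableZl measurableT n`!%:R); congr (integrable _ _ _).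
  by apply/funext => x /=; rewrite -EFinM mul1r; congr _%:E; field.
rewrite /lap mulrAC -mulrA mulrC -RintegralZl//.
by apply: eq_Rintegral => x _; rewrite exprMn; ring.
Qed.

Lemma abs_sum_lap_le r n : abs_sum lap r n <= \int[P]_x expR (`|r| * `|X x|).
Proof.
have iabs i : P.-integrable setT (EFin \o (fun x => `|e x * ((r * X x) ^+ i / i`!%:R)|)).
  exact: integrable_norm (iterm r i).
have isum m : P.-integrable setT (EFin \o (fun x => \sum_(i < m) `|e x * ((r * X x) ^+ i / i`!%:R)|)).
  elim: m => [|m IH].
    rewrite (_ : (EFin \o _) = cst 0%E); first exact: integrable0.
    by apply/funext => x /=; rewrite big_ord0.
  rewrite (_ : (EFin \o _) = (fun x => (\sum_(i < m) `|e x * ((r * X x) ^+ i / i`!%:R)|)%:E +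
     (`|e x * ((r * X x) ^+ m / m`!%:R)|)%:E)%E).
    exact: (integrableD measurableT IH (iabs m)).
  by apply/funext => x /=; rewrite big_ord_recr.
have sumE m : \int[P]_x (\sum_(i < m) `|e x * ((r * X x) ^+ i / i`!%:R)|) =
    \sum_(i < m) \int[P]_x `|e x * ((r * X x) ^+ i / i`!%:R)|.
  elim: m => [|m IH].
    rewrite big_ord0; transitivity (\int[P]_x (0 : R)); last exact: Rint_cst.
    by apply: eq_Rintegral => x _; rewrite big_ord0.
  rewrite big_ord_recr/= -IH -RintegralD//.
  by apply: eq_Rintegral => x _; rewrite big_ord_recr.
apply: (@le_trans _ _ (\sum_(i < n) \int[P]_x `|e x * ((r * X x) ^+ i / i`!%:R)|)).
  apply: ler_sum => i _; rewrite -normrX -normrM lapE.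
  by apply: le_normr_Rintegral => //; exact: iterm.
rewrite -sumE; apply: le_Rintegral => //; first exact: iX.
move=> x _; apply: le_trans (exp_partial_le n _); last by rewrite mulr_ge0.
apply: ler_sum => i _; rewrite normrM normrM normfV normrX normrM normr_nat.
by rewrite ler_piMl// divr_ge0// exprn_ge0// mulr_ge0.
Qed.

Lemma entire_lap : entire lap.
Proof. by move=> r; exists (\int[P]_x expR (`|r| * `|X x|)); exact: abs_sum_lap_le. Qed.

(** Dominated convergence with majorant [exp (|r| |X|)], done once for the weights [cos (n t)] and
    [sin (n t)]. *)
Let psum_lap_weight (w : nat -> R) (L : R -> R) r :
  (forall n, `|w n| <= 1) ->
  (forall y, (fun N => \sum_(i < N) y ^+ i / i`!%:R * w i) @ \oo --> L y) ->
  psum (fun n => lap n * w n) r = \int[P]_x (e x * L (r * X x)).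
Proof.
move=> w1 wL.
pose F N x := e x * \sum_(i < N) (r * X x) ^+ i / i`!%:R * w i.
have mF N : measurable_fun setT (F N).
  apply: measurable_funM => //; apply: measurable_sum => i.
  apply: measurable_funM => //; apply: measurable_funM => //.
  by apply: measurable_funX; exact: measurable_funM.
have FL x : F ^~ x @ \oo --> e x * L (r * X x).
  by apply: cvgMl_tmp; exact: wL.
have mL : measurable_fun setT (fun x => e x * L (r * X x)).
  by apply: (measurable_fun_cvg (h := F)) => // x _; exact: FL.
have FleN N x : `|F N x| <= expR (`|r| * `|X x|).
  apply: le_trans (exp_partial_le N _); last by rewrite mulr_ge0.
  rewrite /F normrM; apply: le_trans (ler_piMl _ (e1 x)) _ => //.
  apply: le_trans (ler_norm_sum _ _ _) _; apply: ler_sum => i _.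
  rewrite normrM; apply: le_trans (ler_piMr _ (w1 i)) _ => //.
  by rewrite normrM normfV normrX normrM normr_nat.
have iF N : P.-integrable setT (EFin \o F N).
  apply: (le_integrable measurableT _ _ (iX (normr_ge0 r))).
    exact/measurable_EFinP.
  by move=> x _ /=; rewrite lee_fin [leRHS]ger0_norm ?expR_ge0.
have FE N : \int[P]_x F N x = \sum_(i < N) lap i * w i * r ^+ i.
  elim: N => [|N IH].
    rewrite big_ord0; transitivity (\int[P]_x (0 : R)); last exact: Rint_cst.
    by apply: eq_Rintegral => x _; rewrite /F big_ord0 mulr0.
  rewrite big_ord_recr/= -IH mulrAC lapE mulrC -RintegralZl// -RintegralD//.
    by apply: eq_Rintegral => x _; rewrite /F big_ord_recr/= mulrDr; congr (_ + _); ring.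
  have := integrableZl measurableT (w N) (iterm r N).
  by congr (integrable _ _ _).
have aeF : {ae P, forall x, setT x -> (fun N => (F N x)%:E) @ \oo --> (e x * L (r * X x))%:E}.
  by apply: aeW => x _; apply: cvg_EFin; [exact: nearW|exact: FL].
have aeB : {ae P, forall x (N : nat), setT x -> (`|(F N x)%:E| <= (expR (`|r| * `|X x|))%:E)%E}.
  by apply: aeW => x N _; rewrite /= lee_fin.
have [iL _ hc] := dominated_convergence measurableT
  (fun N => (measurable_EFinP _ _).2 (mF N)) ((measurable_EFinP _ _).2 mL)
  aeF (iX (normr_ge0 r)) aeB.
have iLf := integrable_fin_num measurableT iL.
rewrite -(fineK iLf) in hc; have hR := fine_cvg hc.
apply/cvg_lim => //; apply: (cvgn_ext (hR _)) => N /=.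
by rewrite /pseries/series/= big_mkord -FE.
Qed.

Lemma csum_lap t r : csum lap t r =
  \int[P]_x (e x * (expR (r * X x * cos t) * cos (r * X x * sin t))).
Proof.
apply: (psum_lap_weight (L := fun y => expR (y * cos t) * cos (y * sin t))).
  by move=> n; exact: cos_max.
by move=> y; exact: cos_exp_cvg.
Qed.

Lemma ssum_lap t r : ssum lap t r =
  \int[P]_x (e x * (expR (r * X x * cos t) * sin (r * X x * sin t))).
Proof.
apply: (psum_lap_weight (L := fun y => expR (y * cos t) * sin (y * sin t))).
  by move=> n; exact: sin_max.
by move=> y; exact: sin_exp_cvg.
Qed.

Lemma psum_lap r : psum lap r = \int[P]_x (e x * expR (r * X x)).
Proof.
rewrite -csum_th0 csum_lap; apply: eq_Rintegral => x _.
by rewrite cos0 sin0 mulr1 mulr0 cos0 mulr1.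
Qed.

Lemma csum_lap_pihalf r : csum lap (pi / 2) r = \int[P]_x (e x * cos (r * X x)).
Proof.
rewrite csum_lap; apply: eq_Rintegral => x _.
by rewrite cos_pihalf sin_pihalf mulr0 expR0 mulr1 mul1r.
Qed.

Lemma ssum_lap_pihalf r : ssum lap (pi / 2) r = \int[P]_x (e x * sin (r * X x)).
Proof.
rewrite ssum_lap; apply: eq_Rintegral => x _.
by rewrite cos_pihalf sin_pihalf mulr0 expR0 mulr1 mul1r.
Qed.

(** Ridge property: [|F (r exp (i t))| <= F (r cos t)] for a transform with nonnegative weight.
    Projecting on an arbitrary direction [q] replaces the modulus, which is recovered when [q] is
    the argument. *)
Lemma csum_lap_le t r : (forall x, 0 <= e x) ->
  forall q, csum lap t r * cos q + ssum lap t r * sin q <= psum lap (r * cos t).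
Proof.
move=> e0 q.
have iW (w : R -> R) : measurable_fun setT w -> (forall y, `|w y| <= 1) ->
    P.-integrable setT (EFin \o (fun x => e x * (expR (r * X x * cos t) * w (X x)))).
  move=> mw w1; apply: (le_integrable measurableT _ _ (iX (normr_ge0 r))).
    apply/measurable_EFinP; apply: measurable_funM => //; apply: measurable_funM.
      apply: measurableT_comp => //; apply: measurable_funM => //.
      exact: measurable_funM.
    exact: measurableT_comp.
  move=> x _ /=; rewrite lee_fin [leRHS]ger0_norm ?expR_ge0// !normrM.
  apply: le_trans (ler_piMl _ (e1 x)) _; first by rewrite mulr_ge0.
  apply: le_trans (ler_piMr _ (w1 (X x))) _ => //.
  rewrite ger0_norm ?expR_ge0// ler_expR; apply: le_trans (ler_norm _) _.
  by rewrite !normrM ler_piMr ?mulr_ge0// cos_max.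
have mc : measurable_fun setT (fun y : R => cos (r * y * sin t)).
  apply: measurableT_comp; first by apply: continuous_measurable_fun; exact: continuous_cos.
  by apply: measurable_funM => //; exact: measurable_funM.
have ms : measurable_fun setT (fun y : R => sin (r * y * sin t)).
  apply: measurableT_comp; first by apply: continuous_measurable_fun; exact: continuous_sin.
  by apply: measurable_funM => //; exact: measurable_funM.
have ic := iW _ mc (fun y => cos_max _).
have is_ := iW _ ms (fun y => sin_max _).
have i1 : P.-integrable setT (EFin \o (fun x => e x * expR (r * cos t * X x))).
  have := iW (fun=> 1) (@measurable_cst _ _ _ _ _ _).
  move=> /(_ ltac:(by move=> y; rewrite normr1)); congr (integrable _ _ _).
  by apply/funext => x /=; rewrite mulr1 mulrAC.
rewrite csum_lap ssum_lap psum_lap.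
rewrite -(RintegralZr _ measurableT ic) -(RintegralZr _ measurableT is_).
have icq := integrableZr measurableT (cos q) ic.
have isq := integrableZr measurableT (sin q) is_.
rewrite -RintegralD//.
apply: le_Rintegral => //; first exact: (integrableD measurableT icq isq).
move=> x _; set a := r * X x * sin t.
have -> : e x * (expR (r * X x * cos t) * cos a) * cos q + e x * (expR (r * X x * cos t) * sin a) * sin q =
    e x * (expR (r * X x * cos t) * cos (a - q)) by rewrite cosB; ring.
by rewrite ler_wpM2l// mulrAC ler_piMr ?expR_ge0// cos_le1.
Qed.

End laplace.

(** * The functional equation of the characteristic functions *)

Section level_sums.
Context {R : realType}.

Lemma sum_ltn_nat m N : (\sum_(i < N) (i < m)%N)%N = minn m N.
Proof.
elim: N => [|N IH]; first by rewrite big_ord0 minn0.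
by rewrite big_ord_recr/= IH; lia.
Qed.

Lemma level_sum_approx (y : R) N : 0 <= y -> y <= N%:R ->
  `|y - \sum_(i < N) (i.+1%:R <= y)%R%:R| <= 1.
Proof.
move=> y0 yN; have /andP[my ym] := truncn_itv y0.
have -> : \sum_(i < N) (i.+1%:R <= y)%R%:R = (Num.truncn y)%:R :> R.
  rewrite (eq_bigr (fun i : 'I_N => ((i < Num.truncn y)%N%:R : R))); last first.
    by move=> i _; rewrite truncn_ge_nat.
  rewrite -natr_sum sum_ltn_nat; congr _%:R; apply/minn_idPl.
  by rewrite -(ler_nat R) (le_trans my).
rewrite ler_norml -natr1 in ym *; lra.
Qed.

End level_sums.

Section orthogonal_to_indicators.
Context {R : realType} {d d' : measure_display} {T : measurableType d}
  {T' : measurableType d'}.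
Variables (P : probability T R) (xi : T -> T') (U : T -> R).
Hypotheses (mxi : measurable_fun setT xi) (bU : bm U).

Lemma bm_comp (h : T' -> R) : bm h -> bm (h \o xi).
Proof.
move=> [mh [M hM]]; split; first exact: measurableT_comp.
by exists M => x; exact: hM.
Qed.

(** A function with values in [[0, 1]] is within [1 / N] of the mean of the indicators of [N] of its
    superlevel sets; orthogonality passes to the limit, and an affine change of [h] covers the
    bounded case. *)
Lemma Rint_indic_orth : (forall B, measurable B -> \int[P]_x (\1_(xi @^-1` B) x * U x) = 0) ->
  forall h, bm h -> \int[P]_x (h (xi x) * U x) = 0.
Proof.
move=> U0.
have [mU [C UC]] := bU.
have C0 : 0 <= C by apply: le_trans (UC point).
have bI (B : set T') : measurable B -> bm (fun x => \1_(xi @^-1` B) x : R).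
  move=> mB; split; last by exists 1 => x; rewrite indicE; case: (_ \in _); rewrite ?normr1 ?normr0.
  by apply: measurable_indic; rewrite -[X in measurable X]setTI; exact: mxi.
have pos (h : T' -> R) : bm h -> (forall x, 0 <= h x <= 1) -> \int[P]_x (h (xi x) * U x) = 0.
  move=> bh h01; have [mh _] := bh.
  have bhU : bm (fun x => h (xi x) * U x) by apply: bmM => //; exact: (bm_comp bh).
  have key N : (0 < N)%N -> `|\int[P]_x (h (xi x) * U x)| <= N%:R^-1 * C.
    move=> N0; have NR : 0 < N%:R :> R by rewrite ltr0n.
    pose B (i : nat) := [set x | (i.+1%:R : R) <= N%:R * h x].
    have mB i : measurable (B i).
      rewrite (_ : B i = (fun x => N%:R * h x) @^-1` `[i.+1%:R, +oo[%classic); last first.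
        by apply/seteqP; split => x; rewrite /B/= in_itv/= andbT.
      by rewrite -[X in measurable X]setTI; apply: measurable_funM => //.
    pose S x := \sum_(i < N) (\1_(xi @^-1` B i) x * U x).
    have bS : bm S by apply: bm_sum => i; apply: bmM => //; exact: bI.
    have IS : \int[P]_x S x = 0.
      rewrite bm_Rint_sum; last by move=> i; apply: bmM => //; exact: bI.
      by rewrite big1// => i _; rewrite U0.
    have bNS : bm (fun x => N%:R^-1 * S x) by apply: bmM => //; exact: bm_cst.
    have -> : \int[P]_x (h (xi x) * U x) = \int[P]_x (h (xi x) * U x - N%:R^-1 * S x).
      by rewrite bm_RintB// bm_RintZ// IS mulr0 subr0.
    apply: bm_Rint_norm_le; first exact: bmB.
    move=> x; rewrite /S -mulr_suml.
    have -> : h (xi x) * U x - N%:R^-1 * ((\sum_(i < N) \1_(xi @^-1` B i) x) * U x) =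
        N%:R^-1 * ((N%:R * h (xi x) - \sum_(i < N) \1_(xi @^-1` B i) x) * U x).
      by field; rewrite gt_eqF.
    rewrite !normrM normfV normr_nat ler_wpM2l ?invr_ge0//.
    rewrite -[leRHS]mul1r ler_pM//.
    have /andP[h0 h1] := h01 (xi x).
    have := @level_sum_approx R (N%:R * h (xi x)) N (mulr_ge0 (ltW NR) h0).
    rewrite ler_piMr// => /(_ isT); congr (`|_ - _| <= _).
    apply: eq_bigr => i _; rewrite indicE; congr (nat_of_bool _)%:R.
    by apply/idP/idP; rewrite inE.
  apply/eqP; rewrite -normr_le0; apply/ler_addgt0Pr => e e0; rewrite add0r.
  have [N Nn] : exists N, C / e <= N.+1%:R.
    by exists (Num.truncn (C / e)); rewrite ltW// truncnS_gt.
  apply: le_trans (key N.+1 isT) _.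
  by rewrite mulrC ler_pdivrMr// mulrC -ler_pdivrMr.
move=> h bh; have [mh [M hM]] := bh.
have M0 : 0 <= M by apply: le_trans (hM point).
(* Adding 1 to [2 * M] keeps the denominator positive when [M = 0]. *)
pose g x := (h x + M) / (2 * M + 1).
have bg : bm g.
  by apply: bmM; [apply: bmD => //|]; exact: bm_cst.
have M1 : 0 < 2 * M + 1 by lra.
have g01 x : 0 <= g x <= 1.
  have := hM x; rewrite ler_norml => /andP[h1 h2].
  by rewrite /g divr_ge0 ?ler_pdivrMr//=; lra.
have IU : \int[P]_x U x = 0.
  rewrite -[RHS](U0 setT)//; apply: eq_Rintegral => x _.
  by rewrite preimage_setT indicT mul1r.
have bgU : bm (fun x => g (xi x) * U x) by apply: bmM => //; exact: (bm_comp bg).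
have -> : \int[P]_x (h (xi x) * U x) = \int[P]_x ((2 * M + 1) * (g (xi x) * U x) - M * U x).
  by apply: eq_Rintegral => x _; rewrite /g; field; rewrite gt_eqF.
rewrite bm_RintB; [|by apply: bmM => //; exact: bm_cst..].
by rewrite !bm_RintZ// pos// IU !mulr0 subrr.
Qed.

End orthogonal_to_indicators.

Section independence.
Context {R : realType} {d : measure_display} {T : measurableType d}.
Variable P : probability T R.

Definition cbm {d'} {T' : measurableType d'} (f : T' -> R[i]) :=
  bm (fun x => complex.Re (f x)) /\ bm (fun x => complex.Im (f x)).

Lemma cbmM {d'} {T' : measurableType d'} (f g : T' -> R[i]) : cbm f -> cbm g ->
  cbm (fun x => f x * g x).
Proof.
move=> [f1 f2] [g1 g2]; split.
  rewrite (_ : (fun x => _) = (fun x => complex.Re (f x) * complex.Re (g x) - complex.Im (f x) * complex.Im (g x))).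
    by apply: bmB; exact: bmM.
  by apply/funext => x; case: (f x) => ? ?; case: (g x).
rewrite (_ : (fun x => _) = (fun x => complex.Re (f x) * complex.Im (g x) + complex.Im (f x) * complex.Re (g x))).
  by apply: bmD; exact: bmM.
by apply/funext => x; case: (f x) => ? ?; case: (g x).
Qed.

Lemma cbm_cst {d'} {T' : measurableType d'} (c : R[i]) : cbm (fun _ : T' => c).
Proof. by split; exact: bm_cst. Qed.

Lemma cbm_prod {d'} {T' : measurableType d'} (I : Type) (r : seq I) (p : pred I)
    (f : I -> T' -> R[i]) : (forall i, cbm (f i)) -> cbm (fun x => \prod_(i <- r | p i) f i x).
Proof.
move=> bf; elim: r => [|i r IH].
  by under eq_fun do rewrite big_nil; exact: cbm_cst.
case pi: (p i); under eq_fun do rewrite big_cons pi; last exact: IH.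
exact: cbmM.
Qed.

Lemma cbm_comp {d'} {T' : measurableType d'} (xi : T -> T') (f : T' -> R[i]) :
  measurable_fun setT xi -> cbm f -> cbm (f \o xi).
Proof. by move=> mxi [f1 f2]; split; [exact: (bm_comp mxi f1)|exact: (bm_comp mxi f2)]. Qed.

Lemma eq_cintegral (f g : T -> R[i]) : f =1 g -> cintegral P f = cintegral P g.
Proof. by move=> /funext ->. Qed.

Definition cindic {d'} {T' : measurableType d'} (B : set T') (x : T') : R[i] := (\1_B x)%:C.

Lemma cbm_cindic {d'} {T' : measurableType d'} (B : set T') : measurable B -> cbm (cindic B).
Proof.
move=> mB; split; last exact: bm_cst.
split; first exact: measurable_indic.
by exists 1 => x /=; rewrite indicE; case: (_ \in _); rewrite ?normr1 ?normr0.
Qed.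

(* Both sides are linear in [h], so agreement on indicators is enough. *)
Lemma cintegral_indic_ext {d'} {T' : measurableType d'} (xi : T -> T') (W : T -> R[i]) (V : R[i]) :
  measurable_fun setT xi -> cbm W ->
  (forall B, measurable B -> cintegral P (fun w => cindic B (xi w) * W w) =
     cintegral P (fun w => cindic B (xi w)) * V) ->
  forall h, cbm h -> cintegral P (fun w => h (xi w) * W w) = cintegral P (fun w => h (xi w)) * V.
Proof.
move=> mxi [bWr bWi] WV.
have bI B : measurable B -> bm (fun w => \1_B (xi w) : R).
  by move=> mB; exact: (bm_comp mxi (cbm_cindic mB).1).
pose wr w := complex.Re (W w); pose wi w := complex.Im (W w).
have split_int (w : T -> R) (v : R) : bm w ->
    (forall B, measurable B -> \int[P]_x (\1_B (xi x) * w x) = (\int[P]_x \1_B (xi x)) * v) ->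
    forall h, bm h -> \int[P]_x (h (xi x) * w x) = (\int[P]_x h (xi x)) * v.
  move=> bw wB h bh; have bc : bm (fun _ : T => v) := bm_cst v.
  have bhx := bm_comp mxi bh.
  apply/eqP; rewrite -subr_eq0 [X in _ - X]mulrC -bm_RintZ// -bm_RintB; [|exact: bmM..].
  have := @Rint_indic_orth R _ _ T T' P xi (fun x => w x - v) mxi (bmB bw bc).
  move=> /(_ _ h bh) <-.
    by apply/eqP/eq_Rintegral => x _; ring.
  move=> B mB; have := wB B mB => /eqP.
  rewrite -subr_eq0 [X in _ - X]mulrC -bm_RintZ; last exact: bI.
  rewrite -bm_RintB; [|by apply: bmM => //; exact: bI..].
  by move=> /eqP <-; apply: eq_Rintegral => x _; ring.
have hr := split_int wr (complex.Re V) bWr.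
have hi := split_int wi (complex.Im V) bWi.
have WB B : measurable B ->
    \int[P]_x (\1_B (xi x) * wr x) = (\int[P]_x \1_B (xi x)) * complex.Re V /\
    \int[P]_x (\1_B (xi x) * wi x) = (\int[P]_x \1_B (xi x)) * complex.Im V.
  move=> mB; have := WV B mB; rewrite /cintegral.
  have -> : \int[P]_x complex.Im (cindic B (xi x)) = 0 by exact: Rint_cst.
  case: (V) => vr vi /= [].
  move=> E1 E2; split.
    rewrite mul0r subr0 in E1; rewrite -E1; apply: eq_Rintegral => x _.
    by rewrite /wr; case: (W x) => ? ? /=; rewrite mul0r subr0.
  rewrite mul0r addr0 in E2; rewrite -E2; apply: eq_Rintegral => x _.
  by rewrite /wi; case: (W x) => ? ? /=; rewrite mul0r addr0.
move=> h [bh1 bh2].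
have {}hr := hr (fun B mB => (WB B mB).1); have {}hi := hi (fun B mB => (WB B mB).2).
have r1 := hr _ bh1; have r2 := hr _ bh2; have i1 := hi _ bh1; have i2 := hi _ bh2.
have b1 := bm_comp mxi bh1; have b2 := bm_comp mxi bh2.
rewrite /cintegral [RHS]/GRing.mul; move: r1 r2 i1 i2; case: (V) => vr vi /= r1 r2 i1 i2.
congr (_ +i* _).
  rewrite -r1 -i2 -bm_RintB; [|exact: bmM..].
  by apply: eq_Rintegral => x _; rewrite /wr /wi; case: (h (xi x)) => ? ?; case: (W x).
rewrite -i1 -r2 -bm_RintD; [|exact: bmM..].
by apply: eq_Rintegral => x _; rewrite /wr /wi; case: (h (xi x)) => ? ?; case: (W x).
Qed.

End independence.

Section independent_products.
Context {R : realType} {d d' : measure_display} {T : measurableType d}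
  {T' : measurableType d'}.
Variables (P : probability T R) (n : nat) (xi : 'I_n -> {RV P >-> T'}).
Hypothesis xi_indep : independent_RVs xi.

Let mxi j : measurable_fun setT (xi j).
Proof. exact: measurable_funPT. Qed.

Lemma cintegral_EFin (f : T -> R) : cintegral P (fun w => (f w)%:C) = (\int[P]_x f x)%:C.
Proof. by rewrite /cintegral /= Rint_cst. Qed.

Lemma cintegral_prod_indic (B : 'I_n -> set T') : (forall j, measurable (B j)) ->
  cintegral P (fun w => \prod_j cindic (B j) (xi j w)) =
  \prod_j cintegral P (fun w => cindic (B j) (xi j w)).
Proof.
move=> mB; pose A j := xi j @^-1` B j.
have mA j : measurable (A j) by rewrite -[X in measurable X]setTI; exact: mxi.
have IA (C : set T) : measurable C -> \int[P]_x (\1_C x) = fine (P C).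
  by move=> mC; rewrite /Rintegral integral_indic// setIT.
have -> : \prod_j cintegral P (fun w => cindic (B j) (xi j w)) = (\prod_j fine (P (A j)))%:C.
  rewrite rmorph_prod; apply: eq_bigr => j _.
  by rewrite cintegral_EFin -IA.
have -> : (fun w => \prod_j cindic (B j) (xi j w)) =
    (fun w => (\1_(\bigcap_(j in [set` [set: 'I_n]%SET]) A j) w)%:C) :> (T -> R[i]).
  apply/funext => w; rewrite /cindic -rmorph_prod; congr (_%:C).
  rewrite indicE; have [/set_mem wA|/negP wA] := boolP (w \in _).
    rewrite big1// => j _; rewrite indicE mem_set//.
    by apply: (wA j); rewrite /= inE.
  suff [j wj] : exists j, ~ A j w.
    by rewrite (bigD1 j)//= indicE memNset// mul0r.
  apply: contrapT => H; apply: wA; apply/mem_set => j _.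
  by apply: contrapT => wj; apply: H; exists j.
rewrite cintegral_EFin IA; last first.
  by apply: fin_bigcap_measurable => // j _.
congr (_%:C); rewrite xi_indep//.
have -> : (\prod_(j in [set: 'I_n]%SET) P (A j))%E = (\prod_j fine (P (A j)))%:E.
  rewrite -prodEFin big_mkcond/=; apply: eq_bigr => j _.
  rewrite inE fineK//; exact: fin_num_measure.
by [].
Qed.

Lemma cintegral_prod_indep (g : 'I_n -> T' -> R[i]) : (forall j, cbm (g j)) ->
  cintegral P (fun w => \prod_j g j (xi j w)) = \prod_j cintegral P (fun w => g j (xi j w)).
Proof.
(* Induction on the number [m] of leading indices whose function is arbitrary, the others carrying
   indicators; [cintegral_indic_ext] frees one index at a time. *)
suff main m : (m <= n)%N -> forall g : 'I_n -> T' -> R[i], (forall j, cbm (g j)) ->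
    (forall j : 'I_n, (m <= j)%N -> exists2 B, measurable B & g j = cindic B) ->
    cintegral P (fun w => \prod_j g j (xi j w)) = \prod_j cintegral P (fun w => g j (xi j w)).
  move=> bg; apply: (main n) => // j; by rewrite leqNgt ltn_ord.
elim: m => [|m IH] mn {}g bg gB.
  have /choice[B hB] : forall j, exists B, measurable B /\ g j = cindic B.
    by move=> j; have [B mB gE] := gB j (leq0n _); exists B.
  have -> : g = (fun j => cindic (B j)) by apply/funext => j; exact: (hB j).2.
  by apply: cintegral_prod_indic => j; exact: (hB j).1.
pose k := Ordinal mn.
rewrite (bigD1 k)//=; under eq_cintegral do rewrite (bigD1 k)//=.
have mk : measurable_fun setT (xi k) by [].
apply: (@cintegral_indic_ext _ _ _ P _ _ (xi k)
  (fun w => \prod_(j | j != k) g j (xi j w)) _ mk) => //.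
  apply: cbm_prod => j; exact: (cbm_comp (mxi j) (bg j)).
move=> B mB; pose g' j := if j == k then cindic B else g j.
have g'k : g' k = cindic B by rewrite /g' eqxx.
have g'i i : i != k -> g' i = g i by rewrite /g' => /negbTE ->.
have -> : (fun w => cindic B (xi k w) * \prod_(i | i != k) g i (xi i w)) =
   (fun w => \prod_i g' i (xi i w)).
  apply/funext => w; rewrite [RHS](bigD1 k)//= g'k; congr (_ * _).
  by apply: eq_bigr => i ik; rewrite g'i.
have -> : \prod_(i | i != k) cintegral P (fun w => g i (xi i w)) =
   \prod_(i | i != k) cintegral P (fun w => g' i (xi i w)).
  by apply: eq_bigr => i ik; rewrite g'i.
rewrite -g'k -(bigD1 (P := xpredT) k)//=; apply: IH => //; first exact: ltnW.
  by move=> j; rewrite /g'; case: eqP => // _; exact: cbm_cindic.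
move=> j mj; have [->|jk] := eqVneq j k; first by exists B.
rewrite g'i//; apply: gB; rewrite ltn_neqAle mj andbT; apply: contra jk => /eqP mj'.
by apply/eqP/val_inj; rewrite /= mj'.
Qed.

End independent_products.

(** * Duality on R x Z(2) *)

Section pairing.
Context {R : realType}.
Implicit Types (x y : XG R) (a : XG R -> XG R).

Definition csgn (b : bool) : R := (-1) ^+ b.

Lemma csgnD b c : csgn (b (+) c) = csgn b * csgn c.
Proof. by rewrite /csgn signr_addb. Qed.

Lemma pairingE x y :
  pairing x y = (csgn (x.2 && y.2) * cos (x.1 * y.1)) +i* (csgn (x.2 && y.2) * sin (x.1 * y.1)).
Proof.
rewrite /pairing /cexp /= expR0 !mul1r /csgn.
case: (_ && _); last by rewrite !expr0 mulr1 !mul1r.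
by rewrite !expr1 mulrN1 !mulN1r.
Qed.

Lemma pairingDr x y y' : pairing x (y + y') = pairing x y * pairing x y'.
Proof.
rewrite !pairingE [RHS]/GRing.mul /= mulrDr cosD sinD.
have -> : csgn (x.2 && (y.2 + y'.2)) = csgn (x.2 && y.2) * csgn (x.2 && y'.2).
  by rewrite -csgnD; case: x.2; case: y.2; case: y'.2.
by congr (_ +i* _); ring.
Qed.

Lemma pairingDl x x' y : pairing (x + x') y = pairing x y * pairing x' y.
Proof.
rewrite !pairingE [RHS]/GRing.mul /= mulrDl cosD sinD.
have -> : csgn ((x.2 + x'.2) && y.2) = csgn (x.2 && y.2) * csgn (x'.2 && y.2).
  by rewrite -csgnD; case: x.2; case: y.2; case: x'.2.
by congr (_ +i* _); ring.
Qed.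

Lemma pairing0l y : pairing 0 y = 1.
Proof. by rewrite pairingE /= mul0r cos0 sin0 /csgn expr0 mulr1 mulr0. Qed.

Lemma pairing_suml (I : Type) (r : seq I) (F : I -> XG R) y :
  pairing (\sum_(i <- r) F i) y = \prod_(i <- r) pairing (F i) y.
Proof.
elim: r => [|i r IH]; first by rewrite !big_nil pairing0l.
by rewrite !big_cons pairingDl IH.
Qed.

Definition adj a y : XG R := (fst_coef a * y.1, snd_coef a && y.2).

Lemma pairing_End a x y : is_End a -> pairing (a x) y = pairing x (adj a y).
Proof.
move=> aE; case: x => t k; rewrite (is_EndE aE) !pairingE /=.
have -> : snd_coef a * k && y.2 = k && (snd_coef a && y.2).
  by rewrite -[snd_coef a * k]/(snd_coef a && k); case: (snd_coef a); case: k; case: y.2.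
by rewrite [fst_coef a * t]mulrC -mulrA.
Qed.

Lemma measurable_bool_fun {d} {T' : measurableType d} (f : bool -> T') : measurable_fun setT f.
Proof. by []. Qed.

Lemma cbm_pairing y : cbm (fun x : XG R => pairing x y).
Proof.
have bs : bm (fun x : XG R => csgn (x.2 && y.2)).
  split; last by exists 1 => x; rewrite /csgn normrX normrN1 expr1n.
  exact: (measurableT_comp (measurable_bool_fun (fun k => csgn (k && y.2))) measurable_snd).
have m1 : measurable_fun setT (fun x : XG R => x.1 * y.1).
  by apply: measurable_funM => //; exact: measurable_fst.
rewrite /cbm; under [X in bm X]eq_fun do rewrite pairingE /=.
under [X in _ /\ bm X]eq_fun do rewrite pairingE /=.
by split; apply: bmM => //; [exact: bm_cos|exact: bm_sin].
Qed.

Lemma measurable_XG_add {d} {T : measurableType d} (f g : T -> XG R) :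
  measurable_fun setT f -> measurable_fun setT g -> measurable_fun setT (fun w => f w + g w).
Proof.
move=> mf mg.
have f1 := measurableT_comp measurable_fst mf; have f2 := measurableT_comp measurable_snd mf.
have g1 := measurableT_comp measurable_fst mg; have g2 := measurableT_comp measurable_snd mg.
rewrite (_ : (fun w => _) = (fun w => ((f w).1 + (g w).1, (f w).2 (+) (g w).2))); last first.
  by apply/funext => w.
apply: measurable_fun_pair; first exact: measurable_funD.
apply: (measurable_fun_bool true); rewrite setTI.
rewrite (_ : _ @^-1` _ = ((fun w => (f w).2) @^-1` [set true] `&` (fun w => (g w).2) @^-1` [set false])
   `|` ((fun w => (f w).2) @^-1` [set false] `&` (fun w => (g w).2) @^-1` [set true])).
  by apply: measurableU; apply: measurableI; rewrite -[X in measurable X]setTI; (exact: f2 || exact: g2).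
apply/seteqP; split => w /=; case: (f w).2; case: (g w).2 => //=; intuition.
Qed.

Lemma measurable_End a : is_End a -> measurable_fun setT a.
Proof.
move=> aE; rewrite (_ : a = (fun x => (fst_coef a * x.1, snd_coef a * x.2))); last first.
  by apply/funext => -[t k]; rewrite (is_EndE aE).
apply: measurable_fun_pair.
  by apply: measurable_funM => //; exact: measurable_fst.
exact: (measurableT_comp (measurable_bool_fun (fun k : bool => snd_coef a * k)) measurable_snd).
Qed.

End pairing.

Section functional_equation.
Context {R : realType} {disp : measure_display} {T : measurableType disp}.
Variables (P : probability T R) (n : nat) (xi : 'I_n -> {RV P >-> XG R}).

Lemma cintegral_distribution {d'} {T' : measurableType d'} (X : {RV P >-> T'}) (f : T' -> R[i]) :
  cbm f -> cintegral (distribution P X) f = cintegral P (fun w => f (X w)).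
Proof.
have mX : measurable_fun setT X by exact: measurable_funPT.
have main (h : T' -> R) : bm h -> \int[distribution P X]_y h y = \int[P]_w h (X w).
  move=> bh; rewrite /Rintegral integral_distribution//.
    by apply/measurable_EFinP; case: bh.
  by apply: bm_integrable; exact: (bm_comp mX bh).
by move=> [f1 f2]; rewrite /cintegral !main.
Qed.

Lemma charX_distribution (j : 'I_n) y :
  charX (distribution P (xi j)) y = cintegral P (fun w => pairing (xi j w) y).
Proof. by rewrite /charX cintegral_distribution//; exact: cbm_pairing. Qed.

Lemma measurable_linear_form (a : 'I_n -> XG R -> XG R) : (forall j, is_End (a j)) ->
  measurable_fun setT (linear_form a xi).
Proof.
move=> aE; rewrite /linear_form.
elim: (index_enum _) => [|j r IH].
  by under eq_fun do rewrite big_nil; exact: measurable_cst.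
under eq_fun do rewrite big_cons.
apply: measurable_XG_add => //.
by apply: measurableT_comp; [exact: measurable_End|exact: measurable_funPT].
Qed.

Hypothesis xi_indep : independent_RVs xi.

(** Moving each endomorphism to its adjoint collects both forms into one argument per variable, and
    independence factors the expectation. *)
Lemma charX_linear_forms (a b : 'I_n -> XG R -> XG R) u v :
  (forall j, is_End (a j)) -> (forall j, is_End (b j)) ->
  cintegral P (fun w => pairing (linear_form a xi w) u * pairing (linear_form b xi w) v) =
  \prod_j charX (distribution P (xi j)) (adj (a j) u + adj (b j) v).
Proof.
move=> aE bE.
have -> : (fun w => pairing (linear_form a xi w) u * pairing (linear_form b xi w) v) =
   (fun w => \prod_j pairing (xi j w) (adj (a j) u + adj (b j) v)).
  apply/funext => w; rewrite /linear_form !pairing_suml -big_split/=.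
  by apply: eq_bigr => j _; rewrite !pairing_End// pairingDr.
rewrite (cintegral_prod_indep xi_indep (g := fun j x => pairing x (adj (a j) u + adj (b j) v))).
  by apply: eq_bigr => j _; rewrite charX_distribution.
by move=> j; exact: cbm_pairing.
Qed.

Lemma functional_equation (a b c d : 'I_n -> XG R -> XG R) :
  (forall j, is_End (a j)) -> (forall j, is_End (b j)) ->
  (forall j, is_End (c j)) -> (forall j, is_End (d j)) ->
  identically_distributed P
     (fun w => (linear_form a xi w, linear_form b xi w))
     (fun w => (linear_form c xi w, linear_form d xi w)) ->
  forall u v, \prod_j charX (distribution P (xi j)) (adj (a j) u + adj (b j) v) =
    \prod_j charX (distribution P (xi j)) (adj (c j) u + adj (d j) v).
Proof.
move=> aE bE cE dE L u v; rewrite -!charX_linear_forms//.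
pose F (p : XG R * XG R) := pairing p.1 u * pairing p.2 v.
have bF : cbm F.
  apply: cbmM.
    exact: (cbm_comp measurable_fst (cbm_pairing u)).
  exact: (cbm_comp measurable_snd (cbm_pairing v)).
have mk (e e' : 'I_n -> XG R -> XG R) : (forall j, is_End (e j)) -> (forall j, is_End (e' j)) ->
    measurable_fun setT (fun w => (linear_form e xi w, linear_form e' xi w)).
  by move=> eE e'E; apply: measurable_fun_pair; exact: measurable_linear_form.
have mU := mk _ _ aE bE; have mV := mk _ _ cE dE.
pose U : {RV P >-> (XG R * XG R)%type} := mfun_Sub (mem_set mU).
pose V : {RV P >-> (XG R * XG R)%type} := mfun_Sub (mem_set mV).
have -> : (fun w => pairing (linear_form a xi w) u * pairing (linear_form b xi w) v) = (fun w => F (U w)) by [].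
have -> : (fun w => pairing (linear_form c xi w) u * pairing (linear_form d xi w) v) = (fun w => F (V w)) by [].
rewrite -!cintegral_distribution// /cintegral /Rintegral.
congr (fine _ +i* fine _); apply: eq_measure_integral => A mA _; exact: L.
Qed.

End functional_equation.

(** * Gaussian marginals *)

Section squared_modulus.
Context {R : realType}.

(** Real, multiplicative, and for a characteristic function the product of its values at [s] and
    [- s] on the same level, hence again expressible by characteristic functions. *)
Definition sqmod (z : R[i]) : R := complex.Re z ^+ 2 + complex.Im z ^+ 2.

Lemma sqmodM z w : sqmod (z * w) = sqmod z * sqmod w.
Proof. by case: z => a b; case: w => c d; rewrite /sqmod /=; ring. Qed.

Lemma sqmod1 : sqmod 1 = 1.
Proof. by rewrite /sqmod /= expr1n expr0n addr0. Qed.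

Lemma sqmod_prod (I : Type) (r : seq I) (p : pred I) (F : I -> R[i]) :
  sqmod (\prod_(i <- r | p i) F i) = \prod_(i <- r | p i) sqmod (F i).
Proof. exact: (big_morph sqmod sqmodM sqmod1). Qed.

Lemma sqmod_gt0 z : z <> 0 -> 0 < sqmod z.
Proof.
case: z => a b h; rewrite /sqmod /= lt_neqAle addr_ge0 ?sqr_ge0// andbT eq_sym.
rewrite paddr_eq0 ?sqr_ge0// !sqrf_eq0; apply/negP => /andP[/eqP a0 /eqP b0].
by apply: h; rewrite a0 b0.
Qed.

Lemma ln_prod (I : Type) (r : seq I) (p : pred I) (F : I -> R) : (forall i, 0 < F i) ->
  ln (\prod_(i <- r | p i) F i) = \sum_(i <- r | p i) ln (F i).
Proof.
move=> F0; elim: r => [|i r IH]; first by rewrite !big_nil ln1.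
rewrite !big_cons; case: (p i); last exact: IH.
by rewrite lnM ?IH// posrE// prodr_gt0.
Qed.

End squared_modulus.

Section charX_continuity.
Context {R : realType} (mu : probability (XG R) R).

Definition cosX l s := \int[mu]_x (csgn (x.2 && l) * cos (x.1 * s)).
Definition sinX l s := \int[mu]_x (csgn (x.2 && l) * sin (x.1 * s)).

Lemma charXE s l : charX mu (s, l) = cosX l s +i* sinX l s.
Proof.
by rewrite /charX /cintegral; congr (_ +i* _); apply: eq_Rintegral => x _; rewrite pairingE.
Qed.

Lemma bm_csgn l : bm (fun x : XG R => csgn (x.2 && l) : R).
Proof.
split; last by exists 1 => x; rewrite /csgn normrX normrN1 expr1n.
exact: (measurableT_comp (measurable_bool_fun (fun k => csgn (k && l))) measurable_snd).
Qed.

Lemma measurable_fst_mul s : measurable_fun setT (fun x : XG R => x.1 * s).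
Proof. by apply: measurable_funM => //; exact: measurable_fst. Qed.

Lemma bm_csgn_cos l s : bm (fun x : XG R => csgn (x.2 && l) * cos (x.1 * s)).
Proof. by apply: bmM; [exact: bm_csgn|apply: bm_cos; exact: measurable_fst_mul]. Qed.

Lemma bm_csgn_sin l s : bm (fun x : XG R => csgn (x.2 && l) * sin (x.1 * s)).
Proof. by apply: bmM; [exact: bm_csgn|apply: bm_sin; exact: measurable_fst_mul]. Qed.

Let normr_csgn b : `|csgn b| = 1 :> R.
Proof. by rewrite /csgn normrX normrN1 expr1n. Qed.

Lemma continuous_Rint_bounded (F : R -> XG R -> R) : (forall s, bm (F s)) ->
  (forall s x, `|F s x| <= 1) -> (forall x, continuous (F ^~ x)) ->
  continuous (fun s => \int[mu]_x F s x).
Proof.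
move=> bF F1 cF s.
have := @continuity_under_integral R _ (XG R) mu F setT measurableT (s - 1) (s + 1)
  (fun t _ => bm_integrable mu (bF t)) _ (fun=> 1) (bm_integrable mu (bm_cst 1)) _.
move=> /(_ _ _ s); apply.
- by apply: aeW => x _ t _; exact: cF.
- by move=> t _; apply: aeW => x _; exact: F1.
- by apply/mem_set; rewrite /= in_itv/=; apply/andP; split; lra.
Qed.

Lemma continuous_cosX l : continuous (cosX l).
Proof.
apply: continuous_Rint_bounded.
- exact: bm_csgn_cos.
- by move=> s x; rewrite normrM normr_csgn mul1r cos_max.
- move=> x s; apply: cvgMl_tmp; apply: continuous_comp; last exact: continuous_cos.
  by apply: cvgMl_tmp; exact: cvg_id.
Qed.

Lemma continuous_sinX l : continuous (sinX l).
Proof.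
apply: continuous_Rint_bounded.
- exact: bm_csgn_sin.
- by move=> s x; rewrite normrM normr_csgn mul1r sin_max.
- move=> x s; apply: cvgMl_tmp; apply: continuous_comp; last exact: continuous_sin.
  by apply: cvgMl_tmp; exact: cvg_id.
Qed.

Lemma continuous_sqmod_charX l : continuous (fun s => sqmod (charX mu (s, l))).
Proof.
have -> : (fun s => sqmod (charX mu (s, l))) = (fun s => cosX l s * cosX l s + sinX l s * sinX l s).
  by apply/funext => s; rewrite charXE /sqmod/= !expr2.
move=> s; have c1 := @continuous_cosX l s; have c2 := @continuous_sinX l s.
exact: (cvgD (cvgM c1 c1) (cvgM c2 c2)).
Qed.

Lemma cosXN l s : cosX l (- s) = cosX l s.
Proof. by apply: eq_Rintegral => x _; rewrite mulrN cosN. Qed.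

Lemma sinXN l s : sinX l (- s) = - sinX l s.
Proof.
rewrite -[RHS]mulN1r -bm_RintZ; last exact: bm_csgn_sin.
by apply: eq_Rintegral => x _; rewrite mulrN sinN; ring.
Qed.

Lemma sinX0 l : sinX l 0 = 0.
Proof.
transitivity (\int[mu]_x (0 : R)); last exact: Rint_cst.
by apply: eq_Rintegral => x _; rewrite mulr0 sin0 mulr0.
Qed.

Lemma charX00 : charX mu (0, false) = 1.
Proof.
rewrite charXE sinX0; congr (_ +i* _).
transitivity (\int[mu]_x (1 : R)); last exact: Rint_cst.
by apply: eq_Rintegral => x _; rewrite andbF mulr0 cos0 mulr1.
Qed.

Lemma charX_mul_opp s l : charX mu (s, l) * charX mu (- s, l) = (sqmod (charX mu (s, l)))%:C.
Proof.
rewrite !charXE cosXN sinXN /sqmod [LHS]/GRing.mul /=.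
by congr (_ +i* _); ring.
Qed.

End charX_continuity.

(** * The polynomial attached to a direction *)

Section log_polynomial.
Context {R : realType} (n : nat).
Variables (al be : 'I_n -> R * R) (i : 'I_n).

Definition det2 (u v : R * R) := u.1 * v.2 - u.2 * v.1.
(* When [al j] is parallel to [al i], it is [ratio j] times [al i]. *)
Definition ratio j := ((al j).1 * (al i).1 + (al j).2 * (al i).2) / ((al i).1 ^+ 2 + (al i).2 ^+ 2).

Hypothesis be_det : forall j, det2 (al i) (be j) <> 0.

Let al2 : (al i).1 ^+ 2 + (al i).2 ^+ 2 != 0.
Proof.
apply/negP; rewrite paddr_eq0 ?sqr_ge0// !sqrf_eq0 => /andP[/eqP a0 /eqP b0].
have := @be_det i; rewrite /det2 a0 b0 !mul0r subrr; exact.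
Qed.

Lemma ratio_self : ratio i = 1.
Proof. by rewrite /ratio -!expr2 divff. Qed.

Lemma parallel_dot j u : det2 (al i) (al j) = 0 ->
  (al j).1 * u.1 + (al j).2 * u.2 = ratio j * ((al i).1 * u.1 + (al i).2 * u.2).
Proof.
rewrite /det2 => h; apply: (mulIf al2); rewrite /ratio mulrAC divfK//.
have E : (al i).1 * (al j).2 = (al i).2 * (al j).1 by apply/eqP; rewrite -subr_eq0 h.
rewrite -[LHS]subr0 -[0](mulr0 ((al i).1 * u.2 - (al i).2 * u.1)) -h.
ring.
Qed.

(** The left-hand terms not parallel to [al i] change sides with their sign reversed; together with
    the right-hand terms, which [be_det] keeps off that direction, they are the ridge functions to
    be killed. The order of differencing is their number. *)
Lemma sum_parallel_poly (phi psi : 'I_n -> R -> R) :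
  (forall j, continuous (phi j)) ->
  (forall u : R * R, \sum_j phi j ((al j).1 * u.1 + (al j).2 * u.2) =
     \sum_j psi j ((be j).1 * u.1 + (be j).2 * u.2)) ->
  exists p : {poly R}, forall s,
    \sum_(j | det2 (al i) (al j) == 0) phi j (ratio j * s) = p.[s].
Proof.
move=> cphi phipsi.
pose f s := \sum_(j | det2 (al i) (al j) == 0) phi j (ratio j * s).
pose ga (k : 'I_n + 'I_n) := match k with inl j => al j | inr j => be j end.
pose g (k : 'I_n + 'I_n) := match k with inl j => (fun x => - phi j x) | inr j => psi j end.
pose r : seq ('I_n + 'I_n) := [seq inl j | j <- index_enum 'I_n & det2 (al i) (al j) != 0] ++
  [seq inr j | j <- index_enum 'I_n].
apply: (@continuous_fdiffs0_poly R (size r) f).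
  rewrite /f; elim: (index_enum _) => [|j s IH].
    by under eq_fun do rewrite big_nil; move=> x; exact: cvg_cst.
  case dj: (det2 (al i) (al j) == 0); under eq_fun do rewrite big_cons dj; last exact: IH.
  move=> x; apply: cvgD; last exact: IH.
  apply: continuous_comp; last exact: cphi.
  by apply: cvgMl_tmp; exact: cvg_id.
apply: (@fdiffs_ridge_sum R (al i) _ r ga g).
- exists ((al i).1 / ((al i).1 ^+ 2 + (al i).2 ^+ 2), (al i).2 / ((al i).1 ^+ 2 + (al i).2 ^+ 2)).
  by rewrite /= !mulrA -!expr2 -mulrDl divff.
- move=> k; rewrite mem_cat => /orP[/mapP[j]|/mapP[j]].
    by rewrite mem_filter => /andP[dj _] ->.
  by move=> _ ->; apply/eqP; exact: be_det.
move=> u; rewrite big_cat !big_map big_filter/=.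
have E := phipsi u; rewrite (bigID (fun j => det2 (al i) (al j) == 0)) /= in E.
rewrite sumrN -E addrCA addNr addr0 /f.
by apply: eq_bigr => j /eqP dj; rewrite (parallel_dot u dj).
Qed.

End log_polynomial.

Section parallel_modulus.
Context {R : realType} {n : nat}.
Variables (mu : 'I_n -> probability (XG R) R) (a b c d : 'I_n -> XG R -> XG R).
Hypothesis char_neq0 : forall j y, charX (mu j) y <> 0.
Hypothesis char_eq : forall u v, \prod_j charX (mu j) (adj (a j) u + adj (b j) v) =
    \prod_j charX (mu j) (adj (c j) u + adj (d j) v).

Definition coefs (a b : 'I_n -> XG R -> XG R) j := (fst_coef (a j), fst_coef (b j)).
(* The Z(2)-component of [adj (a j) u + adj (b j) v] when those of [u] and [v] are [l]. *)
Definition level (a b : 'I_n -> XG R -> XG R) (l : bool * bool) j :=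
  (snd_coef (a j) && l.1) (+) (snd_coef (b j) && l.2).

Lemma adj_coefs (e e' : 'I_n -> XG R -> XG R) (u : R * R) (l : bool * bool) j :
  adj (e j) (u.1, l.1) + adj (e' j) (u.2, l.2) =
  ((coefs e e' j).1 * u.1 + (coefs e e' j).2 * u.2, level e e' l j).
Proof. by []. Qed.

(** Fixing the Z(2)-components [l] of [u] and [v] fixes those of all arguments, so the equation
    becomes one between functions on the plane; as nothing vanishes, the squared moduli have
    continuous real logarithms. *)
Lemma parallel_modulus (i : 'I_n) (l : bool * bool) :
  (forall j, det2 (coefs a b i) (coefs c d j) <> 0) ->
  exists p : {poly R}, forall s,
    \prod_(j | det2 (coefs a b i) (coefs a b j) == 0)
      sqmod (charX (mu j) (ratio (coefs a b) i j * s, level a b l j)) = expR p.[s].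
Proof.
move=> hdet.
have pos j y : 0 < sqmod (charX (mu j) y) by apply: sqmod_gt0; exact: char_neq0.
have := @sum_parallel_poly R n (coefs a b) (coefs c d) i hdet
  (fun j s => ln (sqmod (charX (mu j) (s, level a b l j))))
  (fun j s => ln (sqmod (charX (mu j) (s, level c d l j)))).
case.
- move=> j s; apply: continuous_comp; first exact: continuous_sqmod_charX.
  by apply: continuous_ln; exact: pos.
- move=> u.
  rewrite -[LHS]ln_prod; last by move=> j; exact: pos.
  rewrite -[RHS]ln_prod; last by move=> j; exact: pos.
  have := congr1 sqmod (char_eq (u.1, l.1) (u.2, l.2)); rewrite !sqmod_prod => E.
  congr ln; transitivity (\prod_j sqmod (charX (mu j) (adj (a j) (u.1, l.1) + adj (b j) (u.2, l.2)))).
    by apply: eq_bigr => j _; rewrite adj_coefs.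
  by rewrite E; apply: eq_bigr => j _; rewrite adj_coefs.
move=> p pE; exists p => s; rewrite -pE -ln_prod// lnK// posrE.
exact: prodr_gt0.
Qed.

End parallel_modulus.

(** * Series on the imaginary axis *)

Section imaginary_axis.
Context {R : realType}.
Implicit Types (a b : nat -> R) (t : R).

(* The value at [i t] of the power series [a]. *)
Definition ival a t : R[i] := csum a (pi / 2) t +i* ssum a (pi / 2) t.

Lemma ival_conv a b t : entire a -> entire b -> ival (conv a b) t = ival a t * ival b t.
Proof.
move=> ea eb; rewrite /ival csum_conv// ssum_conv// [RHS]/GRing.mul /=.
by rewrite [in RHS]addrC; congr (_ +i* _); rewrite addrC.
Qed.

Lemma ival_scale c a t : ival (fun n => c ^+ n * a n) t = ival a (c * t).
Proof. by rewrite /ival csum_scale ssum_scale. Qed.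

Definition one_series (n : nat) : R := (n == 0%N)%:R.

Lemma entire_one_series : entire one_series.
Proof. by apply: (@entire_finite _ _ 1); case. Qed.

Lemma ival_one_series t : ival one_series t = 1.
Proof.
rewrite /ival /csum /ssum !(@psum_finite _ _ _ 1).
- by rewrite !big_ord1 expr0 /one_series eqxx mul0r cos0 sin0 !mulr1 mulr0.
- by case=> // n _; rewrite /one_series mul0r.
- by case=> // n _; rewrite /one_series mul0r.
Qed.

(** The real and imaginary parts determine [a n cos (n pi / 2)] and [a n sin (n pi / 2)]; the
    relation [cos ^ 2 + sin ^ 2 = 1] recovers [a n]. *)
Lemma ival_inj a b : entire a -> entire b -> (forall t, ival a t = ival b t) ->
  forall n, a n = b n.
Proof.
move=> ea eb ab.
have c0 : forall n, a n * cos (n%:R * (pi / 2)) - b n * cos (n%:R * (pi / 2)) = 0.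
  apply: psum_eq0.
    apply: entireD; first exact: entire_cos.
    have := entireZ (-1) (entire_cos (pi / 2) eb).
    by congr entire; apply/funext => n; rewrite mulN1r.
  move=> r _; rewrite psumB; [|exact: entire_cos..].
  by have [+ _] := ab r; rewrite /csum => ->; rewrite subrr.
have s0 : forall n, a n * sin (n%:R * (pi / 2)) - b n * sin (n%:R * (pi / 2)) = 0.
  apply: psum_eq0.
    apply: entireD; first exact: entire_sin.
    have := entireZ (-1) (entire_sin (pi / 2) eb).
    by congr entire; apply/funext => n; rewrite mulN1r.
  move=> r _; rewrite psumB; [|exact: entire_sin..].
  by have [_ +] := ab r; rewrite /ssum => ->; rewrite subrr.
move=> n; apply/eqP; rewrite -subr_eq0; apply/eqP.
have := cos2Dsin2 (n%:R * (pi / 2) : R); have := c0 n; have := s0 n.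
set c := cos _; set s := sin _ => hs hc cs.
transitivity ((a n * c - b n * c) * c + (a n * s - b n * s) * s).
  by rewrite -[LHS]mulr1 -cs; ring.
by rewrite hc hs !mul0r addr0.
Qed.

Lemma entire_prod_ival (I : Type) (r : seq I) (P : pred I) (k : I -> R -> R[i]) :
  (forall i, P i -> exists2 a, entire a & forall t, ival a t = k i t) ->
  exists2 a, entire a & forall t, ival a t = \prod_(i <- r | P i) k i t.
Proof.
move=> hk; elim: r => [|i r [a ea aE]].
  exists one_series; first exact: entire_one_series.
  by move=> t; rewrite big_nil ival_one_series.
case Pi: (P i); last by exists a => // t; rewrite big_cons Pi.
have [b eb bE] := hk i Pi; exists (conv b a); first exact: entire_conv.
by move=> t; rewrite ival_conv// big_cons Pi aE bE.
Qed.

(* Only the even part of [p] is visible in the real values of [exp p] at [i t]. *)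
Lemma entire_exp_even_poly (p : {poly R}) : (forall s, p.[- s] = p.[s]) ->
  exists2 a, entire a & forall t, ival a t = (expR (- p.[t]))%:C.
Proof.
move=> pe; pose N := size p.
(* For even [n], [cos (n pi / 2)] is [i ^ (- n)], the factor that turns [- p] at [t] into a series
   at [i t]. The constant term goes outside because [expser] needs [h 0 = 0]. *)
pose h n : R := if n is 0%N then 0 else - (p`_n * cos (n%:R * (pi / 2))).
have hN n : (N.+1 <= n)%N -> h n = 0.
  case: n => // n nN; rewrite /h nth_default ?mul0r ?oppr0//.
  by rewrite ltnW.
have eh := entire_finite hN.
exists (fun n => expR (- p`_0) * expser h n); first exact/entireZ/entire_expser.
move=> t; rewrite /ival csumZ ?ssumZ ?csum_expser ?ssum_expser//; try exact: entire_expser.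
have cs0 n : cos (n%:R * (pi / 2)) * sin (n%:R * (pi / 2)) = 0 :> R.
  have : sin (n%:R * pi) = 0 :> R.
    by elim: n => [|n IH]; rewrite ?mul0r ?sin0// -natr1 mulrDl mul1r sinDpi IH oppr0.
  have -> : n%:R * pi = n%:R * (pi / 2) + n%:R * (pi / 2) :> R by field.
  by rewrite sinD => h0; lra.
have ssum0 : ssum h (pi / 2) t = 0.
  rewrite /ssum (@psum_finite _ _ _ 0) ?big_ord0// => -[|n] _; first by rewrite mul0r.
  by rewrite /h mulNr -mulrA cs0 mulr0 oppr0.
have -> : csum h (pi / 2) t = - (p.[t] - p`_0).
  have cos2 n : cos (n%:R * (pi / 2)) ^+ 2 = (~~ odd n)%:R :> R.
    have := cos2Dsin2 (n%:R * (pi / 2) : R).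
    have : cos (n%:R * pi) = (-1) ^+ n :> R.
      by elim: n => [|n IH]; rewrite ?mul0r ?cos0// -natr1 mulrDl mul1r cosDpi IH exprS mulN1r.
    have -> : n%:R * pi = n%:R * (pi / 2) + n%:R * (pi / 2) :> R by field.
    rewrite cosD -!expr2 -signr_odd; case: odd; rewrite ?expr0 ?expr1 /=; lra.
  have eh0 : entire (fun n => p`_n) by apply: (@entire_finite _ _ N) => n; exact: nth_default.
  have pE r : psum (fun n => p`_n) r = p.[r].
    by rewrite (@psum_finite _ _ _ N) ?horner_coef// => n; exact: nth_default.
  (* Evenness of the function [p] makes its odd coefficients vanish. *)
  have sgn n : p`_n - (-1) ^+ n * p`_n = 0.
    move: n; apply: psum_eq0.
      apply: entireD => //; have := entireZ (-1) (entire_scale (-1) eh0).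
      by congr entire; apply/funext => n; rewrite mulN1r.
    move=> r _; rewrite psumB//; last exact: entire_scale.
    by rewrite psum_scale !pE mulN1r pe subrr.
  have e0 : entire (fun n => p`_n - p`_0 * one_series n).
    apply: entireD => //; have := entireZ (- p`_0) entire_one_series.
    by congr entire; apply/funext => n; rewrite mulNr.
  transitivity (psum (fun n => (-1) * (p`_n - p`_0 * one_series n)) t).
    apply: eq_psum => -[|n]; first by rewrite /one_series eqxx [p`_0 * _]mulr1 subrr mulr0 !mul0r.
    rewrite /one_series [p`_0 * _]mulr0 subr0 mulN1r; congr (_ * _).
    rewrite mulNr -mulrA -expr2 cos2; congr (- _).
    have := sgn n.+1; rewrite -signr_odd; case: (odd n.+1); rewrite ?mulr1 //= expr1 => h0.
    by rewrite mulr0; lra.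
  rewrite psumZ// psumB//; last exact: entireZ entire_one_series.
  rewrite psumZ; last exact: entire_one_series.
  rewrite pE (@psum_finite _ one_series _ 1); last by case.
  by rewrite big_ord1 expr0 /one_series eqxx !mulr1 mulN1r.
rewrite ssum0 cos0 sin0 !mulr0 mulr1 -expRD; congr (expR _ +i* 0); lra.
Qed.

End imaginary_axis.

Section laplace_coefficients.
Context {R : realType}.

(** Taylor coefficients of the integral of [(-1) ^ (k l) exp (z lam t)] over [(t, k)]; [lam] brings
    parallel forms to a common parameter. *)
Definition lapX (mu : probability (XG R) R) (lam : R) (l : bool) : nat -> R :=
  lap mu (fun x => lam * x.1) (fun x => csgn (x.2 && l)).

Let csgn1 (l : bool) (x : XG R) : `|csgn (x.2 && l)| <= 1 :> R.
Proof. by rewrite /csgn normrX normrN1 expr1n. Qed.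

Let mlam (lam : R) : measurable_fun setT (fun x : XG R => lam * x.1).
Proof. by apply: measurable_funM => //; exact: measurable_fst. Qed.

(** [K] depends on the radius because its growth decides the degree of the exponent. The condition
    concerns [mu] and no level, so it serves both. *)
Definition exp_bounded (mu : probability (XG R) R) (lam : R) (K : R -> R) :=
  forall r, 0 <= r -> (\int[mu]_x (expR (r * `|lam * x.1|))%:E <= (K r)%:E)%E.

Lemma exp_bounded_integrable mu lam K : exp_bounded mu lam K ->
  forall r, 0 <= r -> mu.-integrable setT (EFin \o (fun x => expR (r * `|lam * x.1|))).
Proof.
move=> hK r r0; apply/integrableP; split.
  apply/measurable_EFinP; apply: measurableT_comp => //; apply: measurable_funM => //.
  by apply: measurableT_comp => //; exact: mlam.
apply: le_lt_trans (ltry (K r)); apply: le_trans (hK r r0).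
by under eq_integral do rewrite /= ger0_norm ?expR_ge0//.
Qed.

Lemma exp_bounded_Rint mu lam K r : exp_bounded mu lam K -> 0 <= r ->
  \int[mu]_x expR (r * `|lam * x.1|) <= K r.
Proof.
move=> hK r0; have ii := exp_bounded_integrable hK r0.
by rewrite -lee_fin /Rintegral fineK ?hK//; exact: integrable_fin_num.
Qed.

Lemma entire_lapX mu lam l K : exp_bounded mu lam K -> entire (lapX mu lam l).
Proof.
move=> /exp_bounded_integrable hK; apply: entire_lap => //.
by have [] := @bm_csgn R l.
Qed.

Lemma ival_lapX mu lam l K t : exp_bounded mu lam K ->
  ival (lapX mu lam l) t = charX mu (lam * t, l).
Proof.
move=> /exp_bounded_integrable hK; have [ms _] := @bm_csgn R l.
rewrite charXE /ival; congr (_ +i* _).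
  rewrite csum_lap_pihalf//; apply: eq_Rintegral => x _; congr (_ * cos _); ring.
rewrite ssum_lap_pihalf//; apply: eq_Rintegral => x _; congr (_ * sin _); ring.
Qed.

Lemma abs_sum_lapX_le mu lam l K r n : exp_bounded mu lam K -> 0 <= r ->
  abs_sum (lapX mu lam l) r n <= K r.
Proof.
move=> hK r0; apply: le_trans (exp_bounded_Rint hK r0).
have [ms _] := @bm_csgn R l.
have := abs_sum_lap_le (mlam lam) ms (csgn1 l) (exp_bounded_integrable hK) r n.
by rewrite ger0_norm.
Qed.

(* [1 / ival F] is a product of the other characteristic functions, of their
   conjugates and of [exp (- p)], hence again an entire series. *)
Lemma lapX_exp_poly (n : nat) (mu : 'I_n -> probability (XG R) R) (lam : 'I_n -> R)
    (l : 'I_n -> bool) (J : pred 'I_n) (i : 'I_n) (p q : {poly R}) :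
  J i ->
  (forall j, J j -> exists K, exp_bounded (mu j) (lam j) K) ->
  exp_bounded (mu i) (lam i) (fun r => expR q.[r]) ->
  (forall s, \prod_(j | J j) sqmod (charX (mu j) (lam j * s, l j)) = expR p.[s]) ->
  exists h, [/\ h 0%N = 0, forall k, (maxn 1 (size q) <= k)%N -> h k = 0 &
    forall k, lapX (mu i) (lam i) (l i) k = lapX (mu i) (lam i) (l i) 0 * expser h k].
Proof.
move=> Ji hK hq hp.
set F := lapX (mu i) (lam i) (l i).
have eF : entire F by exact: entire_lapX hq.
have pe s : p.[- s] = p.[s].
  apply: expR_inj; rewrite -!hp; apply: eq_bigr => j _.
  by rewrite mulrN !charXE cosXN sinXN /sqmod /= sqrrN.
have [E eE EE] := entire_exp_even_poly pe.
have [G1 eG1 G1E] : exists2 a, entire a & forall t, ival a t =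
    \prod_(j | J j && (j != i)) (charX (mu j) (lam j * t, l j) * charX (mu j) (- (lam j * t), l j)).
  apply: (@entire_prod_ival R _ _ _ (fun j t =>
    charX (mu j) (lam j * t, l j) * charX (mu j) (- (lam j * t), l j))) => j /andP[Jj _].
  have [K hKj] := hK j Jj; have ej := entire_lapX (l j) hKj.
  exists (conv (lapX (mu j) (lam j) (l j)) (fun k => (-1) ^+ k * lapX (mu j) (lam j) (l j) k)).
    by apply: entire_conv => //; exact: entire_scale.
  move=> t; rewrite ival_conv//; last exact: entire_scale.
  by rewrite ival_scale !(ival_lapX _ _ hKj) mulN1r mulrN.
(* On the imaginary axis [F'] is the conjugate of [F]. *)
pose F' k := (-1) ^+ k * F k.
have eF' : entire F' by exact: entire_scale.
have eG := entire_conv eF' (entire_conv eG1 eE).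
apply: (@entire_zero_free_exp_poly R F (conv F' (conv G1 E)) q) => //.
  apply: ival_inj; [exact: entire_conv|exact: entire_one_series|].
  move=> t; rewrite !ival_conv//; last exact: entire_conv.
  rewrite ival_one_series ival_scale !(ival_lapX _ _ hq) mulN1r mulrN G1E EE mulrA mulrA.
  rewrite -(bigD1 (P := J) i)//=.
  under eq_bigr do rewrite charX_mul_opp.
  by rewrite -rmorph_prod hp -rmorphM /= expRxMexpNx_1.
move=> r k r1; apply: abs_sum_lapX_le hq _.
by apply: le_trans r1.
Qed.

End laplace_coefficients.

Section marcinkiewicz.
Context {R : realType}.

Lemma cos_expn_lt1 (x : R) m : (0 < m)%N -> 0 < sin x -> `|cos x ^+ m| < 1.
Proof.
move=> m0 sx; rewrite normrX exprn_ilt1 -?lt0n//.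
have := cos2Dsin2 x; rewrite -[cos x ^+ 2]real_normK ?num_real// => cs.
have s2 : 0 < sin x ^+ 2 by rewrite exprn_gt0.
have n0 := normr_ge0 (cos x).
rewrite ltNge; apply/negP => c1.
have : 1 <= `|cos x| ^+ 2 by rewrite expr_ge1.
lra.
Qed.

(** Comparing leading terms gives [h m (cos (m t) - cos t ^ m) <= 0] for all [t]. At [t = pi / m]
    the bracket is negative and at [t = 2 pi / m] positive, so [h m = 0]; the second angle lies
    strictly between 0 and [pi] exactly when [m > 2]. *)
Lemma ridge_degree_le2 (h : nat -> R) N : (forall n, (N <= n)%N -> h n = 0) ->
  (forall r t, 1 <= r -> csum h t r <= psum h (r * cos t)) ->
  forall n, (2 < n)%N -> h n = 0.
Proof.
elim: N => [|m IH] hN ridge; first by move=> n _; exact: hN.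
have [m2|m3] := leqP m 2; first by move=> n n2; apply: hN; lia.
apply: IH => // n; rewrite leq_eqVlt => /orP[/eqP <-{n}|]; last exact: hN.
have hm t : h m * (cos (m%:R * t) - cos t ^+ m) <= 0.
  pose c n := h n * (cos (n%:R * t) - cos t ^+ n).
  apply: (@poly_bounds_coef _ _ (- \poly_(i < m) c i) m).
    by rewrite size_polyN; exact: size_poly.
  move=> r r1; rewrite hornerN horner_poly -subr_le0 opprK.
  have := ridge r t r1; rewrite -subr_le0; apply: le_trans.
  rewrite /csum !(@psum_finite _ _ _ m.+1) //; last by move=> n mn; rewrite hN// mul0r.
  rewrite -sumrB big_ord_recr/= addrC; apply: lerD; rewrite le_eqVlt; apply/orP; left; apply/eqP.
    by rewrite exprMn; ring.
  by apply: eq_bigr => i _; rewrite /c exprMn; ring.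
have M0 : 0 < m%:R :> R by rewrite ltr0n; lia.
have pim k : (0 < k)%N -> (k < m)%N -> 0 < sin (k%:R * pi / m%:R) :> R.
  move=> k0 km; apply: sin_gt0_pi; apply/andP; split.
    by rewrite divr_gt0// mulr_gt0 ?pi_gt0// ltr0n.
  by rewrite ltr_pdivrMr// mulrC ltr_pM2l ?pi_gt0// ltr_nat.
have m0 : (0 < m)%N by lia.
have c1 := cos_expn_lt1 m0 (pim 1%N isT (ltnW m3)).
have c2 := cos_expn_lt1 m0 (pim 2%N isT m3).
have h1 := hm (1%:R * pi / m%:R); have h2 := hm (2%:R * pi / m%:R).
have e1 : m%:R * (1%:R * pi / m%:R) = pi :> R by field; rewrite gt_eqF.
have e2 : m%:R * (2%:R * pi / m%:R) = 0 + pi *+ 2 :> R.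
  by rewrite add0r -mulr_natl; field; rewrite gt_eqF.
rewrite e1 cospi in h1; rewrite e2 cosD2pi cos0 in h2.
move: c1 c2; rewrite !ltr_norml => /andP[a1 _] /andP[_ a2].
apply/eqP; rewrite eq_le; apply/andP; split.
  by move: h2; rewrite pmulr_lle0// subr_gt0.
by move: h1; rewrite nmulr_lle0//; lra.
Qed.

End marcinkiewicz.

Section exp_bounds.
Context {R : realType}.

Lemma is_chf_charX (mu : probability (XG R) R) (c : R) :
  is_chf (fun t => charX mu (c * t, false)).
Proof.
exists _, (XG R), mu, (fun x => c * x.1); split.
  by apply: measurable_funM => //; exact: measurable_fst.
move=> t; rewrite charXE /chf; congr (_ +i* _); apply: eq_Rintegral => x _.
  by rewrite andbF /csgn expr0 mul1r; congr cos; ring.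
by rewrite andbF /csgn expr0 mul1r; congr sin; ring.
Qed.

(** Splitting one factor off the product leaves [k], the characteristic function of an independent
    sum, so the factor inherits the exponential moments attached to [exp p]. Their bound is the
    exponential of a polynomial because the coefficients of [exp p] are majorized through the
    absolute values of those of [p]. *)
Lemma exp_bounded_of_modulus (n : nat) (mu : 'I_n -> probability (XG R) R) (lam : 'I_n -> R)
    (J : pred 'I_n) (p : {poly R}) :
  (forall s, \prod_(j | J j) sqmod (charX (mu j) (lam j * s, false)) = expR p.[s]) ->
  forall j, J j -> exists q : {poly R}, exp_bounded (mu j) (lam j) (fun r => expR q.[r]).
Proof.
move=> hp j Jj.
pose k t := charX (mu j) ((- lam j) * t, false) *
  \prod_(m | J m && (m != j)) (charX (mu m) (lam m * t, false) * charX (mu m) ((- lam m) * t, false)).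
have kc : is_chf k.
  apply: is_chfM; first exact: is_chf_charX.
  apply: (@is_chf_prod R _ _ _ (fun m t => charX (mu m) (lam m * t, false) * charX (mu m) ((- lam m) * t, false))) => m _.
  by apply: is_chfM; exact: is_chf_charX.
pose h m : R := if m is 0%N then 0 else p`_m.
have hN m : ((size p).+1 <= m)%N -> h m = 0.
  by case: m => // m pm; rewrite /h nth_default// ltnW.
have eh := entire_finite hN.
pose g m := expR p`_0 * expser h m.
have ee := entire_expser eh erefl.
have eg : entire g by exact: entireZ.
have ph t : psum h t = p.[t] - p`_0.
  rewrite (psum_finite _ hN) big_ord_recl /= mul0r add0r.
  have -> : p.[t] = \sum_(i < (size p).+1) p`_i * t ^+ i.
    by rewrite big_ord_recr/= nth_default// mul0r addr0 horner_coef.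
  by rewrite big_ord_recl expr0 mulr1 addrC addKr; apply: eq_bigr.
have gE t : psum g t = expR p.[t].
  rewrite psumZ// -csum_th0 csum_expser// ssum_th0 cos0 mulr1 csum_th0 ph -expRD.
  by congr expR; ring.
have mX : measurable_fun setT (fun x : XG R => lam j * x.1).
  by apply: measurable_funM => //; exact: measurable_fst.
have [t|A hA] := exp_moment_factor (P := mu j) mX kc eg.
  have -> : chf (mu j) (fun x => lam j * x.1) t = charX (mu j) (lam j * t, false).
    rewrite charXE /chf; congr (_ +i* _); apply: eq_Rintegral => x _.
      by rewrite andbF /csgn expr0 mul1r; congr cos; ring.
    by rewrite andbF /csgn expr0 mul1r; congr sin; ring.
  rewrite gE -hp rmorph_prod /= (bigD1 j)//= mulrA mulNr charX_mul_opp; congr (_ * _).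
  by apply: eq_bigr => m _; rewrite mulNr charX_mul_opp.
pose qh := \poly_(i < (size p).+1) `|h i|.
have habs r : psum (fun m => `|h m|) r = qh.[r].
  by rewrite (@psum_finite _ _ _ (size p).+1) ?horner_poly// => m pm; rewrite hN// normr0.
(* The summands account for the factors [exp qh], [exp (r A)], 4 and [exp p_0]. *)
exists (qh + A *: 'X + (ln 4 + p`_0)%:P) => r r0.
have hb m : abs_sum g r m <= expR p`_0 * expR qh.[r].
  apply: (@le_trans _ _ (expR p`_0 * abs_sum (expser h) r m)).
    rewrite /abs_sum mulr_sumr; apply: ler_sum => i _.
    by rewrite /g normrM ger0_norm ?expR_ge0// mulrA.
  rewrite ler_wpM2l ?expR_ge0//; apply: le_trans (abs_sum_expser_le _ _ eh erefl) _.
  by rewrite habs ger0_norm.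
apply: le_trans (hA r _ r0 hb) _.
rewrite lee_fin hornerD hornerD hornerZ hornerX hornerC !expRD lnK ?posrE//.
by rewrite [A * r]mulrC le_eqVlt; apply/orP; left; apply/eqP; ring.
Qed.

End exp_bounds.

Section exp_quadratic.
Context {R : realType}.

Lemma ival_quadratic (h : nat -> R) t : h 0%N = 0 -> (forall n, (2 < n)%N -> h n = 0) ->
  csum h (pi / 2) t = - (h 2%N * t ^+ 2) /\ ssum h (pi / 2) t = h 1%N * t.
Proof.
move=> h0 h3; rewrite /csum /ssum !(@psum_finite _ _ _ 3); last 2 first.
- by move=> n n3; rewrite h3// mul0r.
- by move=> n n3; rewrite h3// mul0r.
rewrite !big_ord_recr !big_ord0/= h0.
have -> : 2%:R * (pi / 2) = pi :> R by field.
rewrite !mul1r cospi sinpi cos_pihalf sin_pihalf; split; ring.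
Qed.

Lemma psum_quadratic (h : nat -> R) t : h 0%N = 0 -> (forall n, (2 < n)%N -> h n = 0) ->
  psum h t = h 1%N * t + h 2%N * t ^+ 2.
Proof.
by move=> h0 h3; rewrite (psum_finite _ h3) !big_ord_recr big_ord0/= h0; ring.
Qed.

Lemma lapX_0 (mu : probability (XG R) R) lam l : lapX mu lam l 0 = cosX mu l 0.
Proof.
rewrite /lapX /lap fact0 divr1; apply: eq_Rintegral => x _.
by rewrite expr0 mulr0 cos0.
Qed.

Lemma charX_exp_quadratic (mu : probability (XG R) R) l K h : exp_bounded mu 1 K ->
  h 0%N = 0 -> (forall n, (2 < n)%N -> h n = 0) ->
  (forall k, lapX mu 1 l k = lapX mu 1 l 0 * expser h k) ->
  forall s, charX mu (s, l) = (cosX mu l 0)%:C * cexp ((- (h 2%N * s ^+ 2)) +i* (h 1%N * s)).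
Proof.
move=> hK h0 h3 hl s; have := ival_lapX l s hK; rewrite mul1r => <-.
have eh : entire h by exact: (entire_finite h3).
have ee := entire_expser eh h0.
rewrite (funext hl) lapX_0 /ival csumZ// ssumZ// csum_expser// ssum_expser//.
have [-> ->] := ival_quadratic s h0 h3.
by rewrite /cexp [RHS]/GRing.mul /= !mul0r subr0 addr0.
Qed.

(** The bound 1 on the modulus, written for the projection on an arbitrary direction [q]. *)
Lemma cosX_sinX_le1 (mu : probability (XG R) R) l s q :
  cosX mu l s * cos q + sinX mu l s * sin q <= 1.
Proof.
rewrite mulrC [sinX _ _ _ * _]mulrC -!bm_RintZ; [|exact: bm_csgn_sin|exact: bm_csgn_cos].
have bc (F : XG R -> R) c : bm F -> bm (fun x => c * F x).
  by move=> bF; apply: bmM => //; exact: bm_cst.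
rewrite -bm_RintD; [|exact/bc/bm_csgn_cos|exact/bc/bm_csgn_sin].
rewrite -[leRHS](Rint_cst mu); apply: bm_Rint_le; last 2 first.
- exact: bm_cst.
- move=> x; rewrite mulrCA [sin q * _]mulrCA -mulrDr.
  rewrite (_ : cos q * cos (x.1 * s) + sin q * sin (x.1 * s) = cos (x.1 * s - q)).
    apply: le_trans (ler_norm _) _; rewrite normrM /csgn normrX normrN1 expr1n mul1r.
    exact: cos_max.
  by rewrite cosB; ring.
by apply: bmD; [exact/bc/bm_csgn_cos|exact/bc/bm_csgn_sin].
Qed.

Lemma cexp_quadratic_sigma_ge0 (mu : probability (XG R) R) l (k s b : R) : k != 0 ->
  (forall t, charX mu (t, l) = k%:C * cexp ((- (s * t ^+ 2)) +i* (b * t))) -> 0 <= s.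
Proof.
move=> k0 hE; rewrite leNgt; apply/negP => s0.
have bound t : `|k| * expR (- (s * t ^+ 2)) <= 1.
  have := hE t; rewrite charXE /cexp [RHS]/GRing.mul /= !mul0r subr0 addr0 => -[e1 e2].
  have le1 q := cosX_sinX_le1 mu l t q; rewrite e1 e2 in le1.
  have cs := cos2Dsin2 (b * t).
  rewrite -[leLHS]mulr1 -[X in _ * X <= _]cs.
  have [k1|k1] := ger0P k.
    by apply: le_trans (le1 (b * t)); rewrite le_eqVlt; apply/orP; left; apply/eqP; ring.
  apply: le_trans (le1 (b * t + pi)); rewrite cosDpi sinDpi.
  by rewrite le_eqVlt; apply/orP; left; apply/eqP; ring.
have kp : 0 < `|k| by rewrite normr_gt0.
(* At this value of [t ^ 2] the bound reads [exp (1 / |k|) <= 1 / |k|], against [1 + x <= exp x]. *)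
pose t2 := `|k|^-1 / - s; have t20 : 0 <= t2 by rewrite divr_ge0 ?invr_ge0// oppr_ge0 ltW.
have := bound (Num.sqrt t2); rewrite sqr_sqrtr// /t2 mulrC -ler_pdivlMr// mul1r.
have -> : - (s * (`|k|^-1 / - s)) = `|k|^-1 by rewrite invrN !mulrN opprK mulrCA divff ?mulr1// lt_eqF.
have := expR_ge1Dx `|k|^-1; lra.
Qed.

End exp_quadratic.

Section gaussian_forms.
Context {R : realType} {n : nat}.
Variables (mu : 'I_n -> probability (XG R) R) (a b c d : 'I_n -> XG R -> XG R).
Hypothesis char_neq0 : forall j y, charX (mu j) y <> 0.
Hypothesis char_eq : forall u v, \prod_j charX (mu j) (adj (a j) u + adj (b j) v) =
    \prod_j charX (mu j) (adj (c j) u + adj (d j) v).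
Variable i : 'I_n.
Hypothesis hdet : forall j, det2 (coefs a b i) (coefs c d j) <> 0.

Let lam := ratio (coefs a b) i.
Let J := [pred j | det2 (coefs a b i) (coefs a b j) == 0].

Let Ji : J i.
Proof. by rewrite /J /= /det2 mulrC subrr. Qed.

Let lami : lam i = 1.
Proof. exact: ratio_self hdet. Qed.

Lemma exp_bounded_parallel j : J j ->
  exists q : {poly R}, exp_bounded (mu j) (lam j) (fun r => expR q.[r]).
Proof.
have [p hp] := parallel_modulus char_neq0 char_eq (false, false) hdet.
apply: (exp_bounded_of_modulus (J := J) (p := p)) => s; rewrite -hp.
by apply: eq_bigr => m _; rewrite /level !andbF.
Qed.

(** The moments give an exponent of some degree, positivity of the weight lowers it to 2, and the
    moment generating function so identified gives back the sharp growth bound of the last clause,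
    on which level 1 depends. *)
Lemma charX_gaussian_marginal : exists s m : R,
  [/\ 0 <= s, forall t, charX (mu i) (t, false) = cexp ((- (s * t ^+ 2)) +i* (m * t)) &
    exp_bounded (mu i) 1 (fun r => expR (s *: 'X^2 + `|m| *: 'X + (ln 2)%:P).[r])].
Proof.
have [p hp] := parallel_modulus char_neq0 char_eq (false, false) hdet.
have [q hq] := exp_bounded_parallel Ji; rewrite lami in hq.
have hK j : J j -> exists K, exp_bounded (mu j) (lam j) K.
  by move=> /exp_bounded_parallel[qj hj]; exists (fun r => expR qj.[r]).
have := @lapX_exp_poly R n mu lam (fun=> false) J i p q Ji hK; rewrite lami.
case=> [//||h [h0 hN hE]].
  move=> s; rewrite -hp; apply: eq_bigr => m _; by rewrite /level !andbF.
have eh := entire_finite hN.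
have ee := entire_expser eh h0.
have F0 : lapX (mu i) 1 false 0 = 1.
  rewrite lapX_0; have := charX00 (mu i); rewrite charXE => /(congr1 (@complex.Re R)).
  by [].
rewrite F0 in hE.
have {}hE : lapX (mu i) 1 false = expser h.
  by apply/funext => k; rewrite hE mul1r.
have iq := exp_bounded_integrable hq.
have mX : measurable_fun setT (fun x : XG R => 1 * x.1).
  by apply: measurable_funM => //; exact: measurable_fst.
have ms : measurable_fun setT (fun x : XG R => csgn (x.2 && false) : R) by case: (@bm_csgn R false).
have s1 (x : XG R) : `|csgn (x.2 && false)| <= 1 :> R by rewrite andbF /csgn expr0 normr1.
have s0 (x : XG R) : 0 <= csgn (x.2 && false) :> R by rewrite andbF /csgn expr0.
have pE r : psum (lapX (mu i) 1 false) r = expR (psum h r).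
  by rewrite hE -csum_th0 csum_expser// ssum_th0 cos0 mulr1 csum_th0.
have h3 := ridge_degree_le2 hN.
have {}h3 : forall k, (2 < k)%N -> h k = 0.
  apply: h3 => r t _; rewrite -ler_expR -pE.
  (* With the argument of the transform as direction, the projection equals the modulus
     [exp (csum h t r)]. *)
  apply: le_trans (csum_lap_le mX ms s1 iq t r s0 (ssum h t r)).
  rewrite -/(lapX (mu i) 1 false) hE csum_expser// ssum_expser//.
  rewrite -[leLHS]mulr1 -[X in _ * X <= _](cos2Dsin2 (ssum h t r)).
  by rewrite le_eqVlt; apply/orP; left; apply/eqP; ring.
have E0 : forall t, charX (mu i) (t, false) = 1%:C * cexp ((- (h 2%N * t ^+ 2)) +i* (h 1%N * t)).
  move=> t; rewrite (@charX_exp_quadratic R (mu i) false _ h hq h0 h3).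
    by rewrite -(lapX_0 _ 1) F0.
  by move=> k; rewrite F0 hE mul1r.
exists (h 2%N), (h 1%N); split.
- exact: (cexp_quadratic_sigma_ge0 (oner_neq0 _) E0).
- by move=> t; rewrite E0 mul1r.
move=> r r0.
have i1 (z : R) : `|z| <= r -> (mu i).-integrable setT (EFin \o (fun x => expR (z * (1 * x.1)))).
  move=> zr; apply: (le_integrable measurableT _ _ (iq r r0)).
    apply/measurable_EFinP; apply: measurableT_comp => //; exact: measurable_funM.
  move=> x _ /=; rewrite lee_fin [leRHS]ger0_norm ?expR_ge0// [leLHS]ger0_norm ?expR_ge0// ler_expR.
  by apply: le_trans (ler_norm _) _; rewrite normrM ler_wpM2r.
have iE z : `|z| <= r -> (\int[mu i]_x (expR (z * (1 * x.1)))%:E = (expR (psum h z))%:E)%E.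
  move=> zr.
  have eqI : (\int[mu i]_x (csgn (x.2 && false) * expR (z * (1 * x.1)))%:E =
      \int[mu i]_x (expR (z * (1 * x.1)))%:E)%E.
    by apply: eq_integral => x _; rewrite andbF /csgn expr0 [1 * expR _]mul1r.
  rewrite -pE (psum_lap mX ms s1 iq) /Rintegral eqI fineK//.
  exact: (integrable_fin_num measurableT (i1 z zr)).
have rr : `|r| <= r by rewrite ger0_norm.
have rn : `|- r| <= r by rewrite normrN ger0_norm.
(* Replacing [exp (r |x|)] by [exp (r x) + exp (- r x)] produces the [ln 2] of the bound. *)
apply: (@le_trans _ _ (\int[mu i]_x ((expR (r * (1 * x.1)))%:E + (expR (- r * (1 * x.1)))%:E)%E)%E).
  apply: ge0_le_integral => //.
  - apply/measurable_EFinP; apply: measurableT_comp => //; apply: measurable_funM => //.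
    exact: measurableT_comp.
  - by have := integrableD measurableT (i1 _ rr) (i1 _ rn) => /measurable_int.
  move=> x _; rewrite -EFinD lee_fin; case: (ger0P (1 * x.1)) => _; first by rewrite lerDl expR_ge0.
  by rewrite mulrN mulNr lerDr expR_ge0.
rewrite integralD//; [|exact: (i1 _ rr)|exact: (i1 _ rn)].
rewrite (iE _ rr) (iE _ rn) -EFinD lee_fin !psum_quadratic//.
rewrite hornerD hornerD !hornerZ hornerXn hornerX hornerC [leRHS]expRD lnK ?posrE// sqrrN.
have up z : `|z| <= r -> expR (h 1%N * z + h 2%N * r ^+ 2) <= expR (h 2%N * r ^+ 2 + `|h 1%N| * r).
  move=> zr; rewrite ler_expR addrC lerD2l; apply: le_trans (ler_norm _) _.
  by rewrite normrM ler_wpM2l.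
by have := up _ rr; have := up _ rn; lra.
Qed.

(** The weight [(-1) ^ k] is signed, so no ridge inequality is available; but its absolute value is
    1, so the transform obeys the growth bound of [charX_gaussian_marginal], whose exponent has size
    at most 3 and forces degree at most 2. *)
Lemma charX_level_one (l : bool * bool) : level a b l i = true ->
  exists s m : R, forall t, charX (mu i) (t, true) =
    (cosX (mu i) true 0)%:C * cexp ((- (s * t ^+ 2)) +i* (m * t)).
Proof.
move=> li.
have [p hp] := parallel_modulus char_neq0 char_eq l hdet.
have [s [m [_ _ hq]]] := charX_gaussian_marginal.
have hK j : J j -> exists K, exp_bounded (mu j) (lam j) K.
  by move=> /exp_bounded_parallel[qj hj]; exists (fun r => expR qj.[r]).
have := @lapX_exp_poly R n mu lam (level a b l) J i p _ Ji hK; rewrite lami li => /(_ _ hq).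
case=> [//|h [h0 hN hE]].
have h3 k : (2 < k)%N -> h k = 0.
  move=> k2; apply: hN; apply: leq_trans k2; rewrite geq_max /=.
  apply: leq_trans (size_polyD _ _) _; rewrite geq_max; apply/andP; split; last first.
    by apply: leq_trans (size_polyC_leq1 _) _.
  apply: leq_trans (size_polyD _ _) _; rewrite geq_max; apply/andP; split.
    by apply: leq_trans (size_scale_leq _ _) _; rewrite size_polyXn.
  by apply: leq_trans (size_scale_leq _ _) _; rewrite size_polyX.
exists (h 2%N), (h 1%N) => t.
exact: (charX_exp_quadratic hq h0 h3 hE).
Qed.

End gaussian_forms.

(** * Normal laws *)

Section density.
Context {R : realType} {d : measure_display} {T : measurableType d}.
Variables (mu nu : {measure set T -> \bar R}) (g : T -> R).
Hypothesis mg : measurable_fun setT g.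
Hypothesis g0 : forall x, 0 <= g x.
Hypothesis nuE : forall A, measurable A -> nu A = (\int[mu]_(x in A) (g x)%:E)%E.

Import HBNNSimple.
Local Open Scope ereal_scope.

Let sfun_density (h : {nnsfun T >-> R}) :
  \int[nu]_x (h x)%:E = \int[mu]_x ((h x)%:E * (g x)%:E).
Proof.
rewrite integralT_nnsfun sintegralE.
have hE x : (h x)%:E * (g x)%:E =
    \sum_(y \in range h) ((y * \1_(h @^-1` [set y]) x)%:E * (g x)%:E).
  rewrite -ge0_mule_fsuml; last by move=> y; exact: nnfun_muleindic_ge0.
  by rewrite fsumEFin// -(fimfunE _ x).
under [RHS]eq_integral do rewrite hE.
rewrite ge0_integral_fsum//; last 2 first.
- move=> y; apply: emeasurable_funM; last exact/measurable_EFinP.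
  by apply/measurable_EFinP; apply: measurable_funM => //; exact: measurable_indic.
- by move=> y x _; apply: mule_ge0; [exact: nnfun_muleindic_ge0|rewrite lee_fin].
apply: eq_fsbigr => y /set_mem[x0 _ <-]; set r := h x0.
have r0 : (0 <= r)%R by [].
have mA : measurable (h @^-1` [set r]) by exact: measurable_sfunP.
under [RHS]eq_integral do rewrite EFinM -muleA.
rewrite ge0_integralZl//; last 2 first.
- apply: emeasurable_funM; last exact/measurable_EFinP.
  by apply/measurable_EFinP; exact: measurable_indic.
- by move=> x _; rewrite mule_ge0 ?lee_fin.
congr (_ * _); rewrite nuE// integral_mkcond; apply: eq_integral => x _.
by rewrite muleC epatch_indic.
Qed.

Lemma ge0_integral_density (f : T -> R) : measurable_fun setT f -> (forall x, (0 <= f x)%R) ->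
  \int[nu]_x (f x)%:E = \int[mu]_x (f x * g x)%:E.
Proof.
move=> mf f0.
have mf' : measurable_fun setT (EFin \o f) by exact/measurable_EFinP.
pose h := nnsfun_approx measurableT mf'.
have hf x : (fun n => (h n x)%:E) @ \oo --> (f x)%:E.
  by apply: (@cvg_nnsfun_approx _ _ _ _ measurableT _ mf') => // y _; rewrite lee_fin.
have ndh x : {homo (fun n => h n x) : m n / (m <= n)%N >-> (m <= n)%R}.
  by move=> m n mn; exact/lefP/nd_nnsfun_approx.
have L : \int[nu]_x (f x)%:E = limn (fun n => \int[nu]_x (h n x)%:E).
  rewrite -monotone_convergence//.
  - by apply: eq_integral => x _; apply/esym/cvg_lim => //; exact: hf.
  - by move=> n; exact/measurable_EFinP.
  - by move=> n x _; rewrite lee_fin.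
  - by move=> x _ m n mn; rewrite lee_fin ndh.
have Rr : \int[mu]_x (f x * g x)%:E = limn (fun n => \int[mu]_x ((h n x)%:E * (g x)%:E)).
  rewrite -monotone_convergence//.
  - apply: eq_integral => x _; apply/esym/cvg_lim => //.
    by rewrite EFinM; apply: cvgeZr => //; exact: hf.
  - move=> n; apply: emeasurable_funM; exact/measurable_EFinP.
  - by move=> n x _; rewrite mule_ge0 ?lee_fin.
  - by move=> x _ m n mn; rewrite lee_wpmul2r ?lee_fin ?ndh.
by rewrite L Rr; congr (limn _); apply/funext => n; rewrite sfun_density.
Qed.

End density.

Section normal_law.
Context {R : realType}.

Lemma ge0_integral_normal (m s : R) (f : R -> R) : measurable_fun setT f -> (forall x, 0 <= f x) ->
  (\int[normal_prob m s]_x (f x)%:E = \int[lebesgue_measure]_x (f x * normal_pdf m s x)%:E)%E.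
Proof.
move=> mf f0; apply: ge0_integral_density => //; first exact: measurable_normal_pdf.
exact: normal_pdf_ge0.
Qed.

Lemma integral_normal_pdf_scale (m s c : R) :
  0 <= c -> (\int[lebesgue_measure]_x (c * normal_pdf m s x)%:E = c%:E)%E.
Proof.
move=> c0; under eq_integral do rewrite EFinM.
rewrite ge0_integralZl_EFin//.
- by rewrite integral_normal_pdf mule1.
- by move=> x _; rewrite lee_fin normal_pdf_ge0.
- by apply/measurable_EFinP; exact: measurable_normal_pdf.
Qed.

(* Completing the square. *)
Lemma integral_normal_expR (m s r : R) : s != 0 ->
  (\int[normal_prob m s]_x (expR (r * x))%:E = (expR (m * r + s ^+ 2 / 2 * r ^+ 2))%:E)%E.
Proof.
move=> s0.
rewrite ge0_integral_normal; last 2 first.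
- by apply: measurableT_comp => //; exact: measurable_funM.
- by move=> x; exact: expR_ge0.
rewrite -(integral_normal_pdf_scale (m + s ^+ 2 * r) s (expR_ge0 _)).
apply: eq_integral => x _; congr _%:E; rewrite !normal_pdfE//=.
rewrite mulrCA [RHS]mulrCA; congr (_ * _).
rewrite /normal_fun -!expRD; congr expR; field.
by rewrite s0.
Qed.

(* [normal_prob] lives on the copy [measurableTypeR R] of [R]. *)
Let idR : measurableTypeR R -> R := idfun.

Let midR : measurable_fun setT idR.
Proof. by move=> _ A mA; rewrite setTI. Qed.

Lemma integrable_normal_exp_norm (m s r : R) : s != 0 -> 0 <= r ->
  (normal_prob m s).-integrable setT (EFin \o (fun x => expR (r * `|idR x|))).
Proof.
move=> s0 r0.
have me (z : R) : measurable_fun setT (fun x => expR (z * idR x)).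
  by apply: measurableT_comp => //; exact: measurable_funM.
have mn : measurable_fun setT (fun x => expR (r * `|idR x|)).
  by apply: measurableT_comp => //; apply: measurable_funM => //; exact: measurableT_comp.
apply/integrableP; split; first exact/measurable_EFinP.
under eq_integral do rewrite /= ger0_norm ?expR_ge0//.
apply: (@le_lt_trans _ _ (\int[normal_prob m s]_x ((expR (r * idR x))%:E + (expR (- r * idR x))%:E)%E)%E).
  apply: ge0_le_integral => //.
  - exact/measurable_EFinP.
  - by apply: emeasurable_funD; apply/measurable_EFinP; exact: me.
  move=> x _; rewrite -EFinD lee_fin; case: (ger0P x) => _; first by rewrite lerDl expR_ge0.
  by rewrite mulrN mulNr lerDr expR_ge0.
rewrite ge0_integralD//; last 2 first.
- by apply/measurable_EFinP; exact: me.
- by apply/measurable_EFinP; exact: me.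
by rewrite !integral_normal_expR// -EFinD ltry.
Qed.

(** The moment generating function is known at real [r]; by the identity theorem its series is the
    exponential of [m z + s ^ 2 z ^ 2 / 2], which is then read on the imaginary axis. *)
Lemma normal_chf (m s t : R) : s != 0 ->
  \int[normal_prob m s]_x cos (t * idR x) = expR (- (s ^+ 2 / 2 * t ^+ 2)) * cos (m * t) /\
  \int[normal_prob m s]_x sin (t * idR x) = expR (- (s ^+ 2 / 2 * t ^+ 2)) * sin (m * t).
Proof.
move=> s0.
pose h n : R := match n with 1%N => m | 2%N => s ^+ 2 / 2 | _ => 0 end.
have h3 n : (2 < n)%N -> h n = 0 by case: n => [|[|[|]]].
have eh := entire_finite h3.
have ee := entire_expser eh erefl.
have m1 : measurable_fun setT (fun _ : measurableTypeR R => 1 : R) by exact: measurable_cst.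
have l1 (x : measurableTypeR R) : `|1| <= 1 :> R by rewrite normr1.
have iX r (r0 : 0 <= r) := integrable_normal_exp_norm m s0 r0.
pose F := lap (normal_prob m s) idR (fun=> 1).
have eF : entire F := entire_lap midR m1 l1 iX.
have FE : F = expser h.
  apply/funext => n; apply/eqP; rewrite -subr_eq0; apply/eqP; move: n.
  apply: psum_eq0.
    apply: entireD => //; have := entireZ (-1) ee.
    by congr entire; apply/funext => n; rewrite mulN1r.
  move=> r _; rewrite psumB// (psum_lap midR m1 l1 iX).
  rewrite -[psum (expser h) r]csum_th0 csum_expser// ssum_th0 cos0 mulr1 csum_th0.
  rewrite psum_quadratic// /Rintegral.
  under eq_integral do rewrite mul1r.
  by rewrite integral_normal_expR// subrr.
have c := csum_lap_pihalf midR m1 l1 iX t; have d := ssum_lap_pihalf midR m1 l1 iX t.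
rewrite -/F FE csum_expser// in c; rewrite -/F FE ssum_expser// in d.
have [e1 e2] := ival_quadratic t (erefl : h 0%N = 0) h3.
rewrite e1 e2 in c d; split.
  by rewrite [RHS]c; apply: eq_Rintegral => x _; rewrite mul1r.
by rewrite [RHS]d; apply: eq_Rintegral => x _; rewrite mul1r.
Qed.

Definition normal_law (m s : R) : probability R R :=
  distribution (normal_prob m s) (mfun_Sub (mem_set midR)).

Lemma charR_normal (m s t : R) : s != 0 ->
  charR (normal_law m s) t = cexp ((- (s ^+ 2 / 2 * t ^+ 2)) +i* (m * t)).
Proof.
move=> s0; have [e1 e2] := normal_chf m t s0.
have mt : measurable_fun setT (fun x : R => x * t) by exact: measurable_funM.
rewrite /charR cintegral_distribution; last first.
  split; rewrite /= expR0.
    by under eq_fun do rewrite mul1r; exact: bm_cos.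
  by under eq_fun do rewrite mul1r; exact: bm_sin.
rewrite /cintegral /cexp /= -e1 -e2.
by congr (_ +i* _); apply: eq_Rintegral => x _; rewrite expR0 mul1r [_ * t]mulrC.
Qed.

Lemma charR_dirac (m t : R) : charR (\d_m : probability R R) t = cexp (0 +i* (m * t)).
Proof.
have mt : measurable_fun setT (fun x : R => x * t) by exact: measurable_funM.
rewrite /charR /cintegral /cexp /=; congr (_ +i* _); rewrite /Rintegral.
  rewrite integral_dirac//; first by rewrite diracT mul1e.
  by apply/measurable_EFinP; apply: measurable_funM => //; exact: (bm_cos mt).1.
rewrite integral_dirac//; first by rewrite diracT mul1e.
by apply/measurable_EFinP; apply: measurable_funM => //; exact: (bm_sin mt).1.
Qed.

Lemma Lambda_of_charX (mu : probability (XG R) R) s m : 0 <= s ->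
  (forall t, charX mu (t, false) = cexp ((- (s * t ^+ 2)) +i* (m * t))) -> Lambda mu.
Proof.
rewrite le_eqVlt => /orP[/eqP <-|s0] hE.
  exists (\d_m : probability R R).
    by right; exists m.
  by move=> t; rewrite charR_dirac hE mul0r oppr0.
(* [exp (- s t ^ 2)] is the modulus for the normal law of variance [2 s]. *)
have s2 : 0 < 2 * s by rewrite mulr_gt0.
have q0 : Num.sqrt (2 * s) != 0 by rewrite gt_eqF// sqrtr_gt0.
exists (normal_law m (Num.sqrt (2 * s))).
  by left; exists m, (Num.sqrt (2 * s)).
move=> t; rewrite charR_normal// hE sqr_sqrtr ?ltW//.
have -> : 2 * s / 2 = s by field.
by [].
Qed.

End normal_law.

(** * The constraints defining Theta *)

Section gaussian_smoothing.
Context {R : realType}.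

Lemma Rint_normal_law (m s : R) (f : R -> R) : bm f ->
  \int[normal_law m s]_x f x = \int[normal_prob m s]_x f x.
Proof.
move=> bf; rewrite /Rintegral integral_distribution//.
  by apply/measurable_EFinP; case: bf.
apply: bm_integrable; have [mf [M fM]] := bf.
by split; [exact: (measurableT_comp mf)|exists M => x; exact: fM].
Qed.

Lemma Rint_normal_cos (s t : R) : s != 0 ->
  \int[normal_law 0 s]_x cos (t * x) = expR (- (s ^+ 2 / 2 * t ^+ 2)).
Proof.
move=> s0; have [e1 _] := normal_chf 0 t s0.
rewrite Rint_normal_law; last by apply: bm_cos; exact: measurable_funM.
by rewrite mul0r cos0 mulr1 in e1.
Qed.

(* [expR (- s y ^+ 2)] times the density of N(0, tau^2) is a multiple of the
   density of N(0, rho^2). *)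
Lemma Rint_normal_gauss_ge0 (tau rho s : R) (h : R -> R) : tau != 0 -> rho != 0 ->
  rho ^- 2 = tau ^- 2 + 2 * s -> 0 <= s -> bm h -> (forall x, 0 <= h x) ->
  \int[normal_law 0 tau]_x (expR (- (s * x ^+ 2)) * h x) =
  normal_peak tau / normal_peak rho * \int[normal_law 0 rho]_x h x.
Proof.
move=> tau0 rho0 hr s0 bh h0.
have mg : measurable_fun setT (fun x : R => expR (- (s * x ^+ 2))).
  apply: measurableT_comp => //; apply: measurableT_comp => //; apply: measurable_funM => //.
have bg : bm (fun x : R => expR (- (s * x ^+ 2))).
  split=> //; exists 1 => x; rewrite ger0_norm ?expR_ge0// -expR0 ler_expR.
  by rewrite oppr_le0 mulr_ge0// sqr_ge0.
have bgh : bm (fun x : R => expR (- (s * x ^+ 2)) * h x) by exact: bmM.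
have pr0 := normal_peak_gt0 rho0; have pt0 := normal_peak_gt0 tau0.
set c := normal_peak tau / normal_peak rho.
have c0 : 0 <= c by rewrite divr_ge0// ltW.
have [mh _] := bh; have [mgh _] := bgh.
rewrite !Rint_normal_law// /Rintegral !ge0_integral_normal//; last first.
  by move=> x; rewrite mulr_ge0 ?expR_ge0.
have EE : forall x : R, (expR (- (s * x ^+ 2)) * h x * normal_pdf 0 tau x)%:E =
    (c%:E * (h x * normal_pdf 0 rho x)%:E)%E.
  move=> x; rewrite -EFinM; congr _%:E.
  rewrite !normal_pdfE// /c.
  have -> : normal_fun 0 rho x = expR (- (s * x ^+ 2)) * normal_fun 0 tau x.
    rewrite /normal_fun -expRD subr0; congr expR.
    have -> : (rho ^+ 2 *+ 2)^-1 = rho ^- 2 / 2 by rewrite -mulr_natr invfM.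
    have -> : (tau ^+ 2 *+ 2)^-1 = tau ^- 2 / 2 by rewrite -mulr_natr invfM.
    by rewrite hr; field.
  by field; rewrite gt_eqF.
under eq_integral do rewrite EE.
rewrite ge0_integralZl_EFin//; last 2 first.
- by move=> x _; rewrite lee_fin mulr_ge0// normal_pdf_ge0.
- by apply/measurable_EFinP; apply: measurable_funM => //; exact: measurable_normal_pdf.
rewrite fineM// -ge0_integral_normal//.
have bh' : bm (h \o (idfun : measurableTypeR R -> R)).
  by have [_ [M hM]] := bh; split; [exact: mh|exists M => x; exact: hM].
by apply: integrable_fin_num => //; exact: bm_integrable bh'.
Qed.

(** The change of Gaussian density is available for nonnegative integrands, so it is applied to
    [cos + 1] and to 1, and the results are subtracted. *)
Lemma Rint_normal_gauss_cos (tau rho s b : R) : tau != 0 -> rho != 0 ->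
  rho ^- 2 = tau ^- 2 + 2 * s -> 0 <= s ->
  \int[normal_law 0 tau]_x (expR (- (s * x ^+ 2)) * cos (b * x)) =
  normal_peak tau / normal_peak rho * expR (- (rho ^+ 2 / 2 * b ^+ 2)).
Proof.
move=> tau0 rho0 hr s0.
have bc : bm (fun x : R => cos (b * x)) by apply: bm_cos; exact: measurable_funM.
have b1 : bm (fun _ : R => 1 : R) by exact: bm_cst.
have mg : measurable_fun setT (fun x : R => expR (- (s * x ^+ 2))).
  apply: measurableT_comp => //; apply: measurableT_comp => //; apply: measurable_funM => //.
have bg : bm (fun x : R => expR (- (s * x ^+ 2))).
  split=> //; exists 1 => x; rewrite ger0_norm ?expR_ge0// -expR0 ler_expR.
  by rewrite oppr_le0 mulr_ge0// sqr_ge0.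
have h0 (x : R) : 0 <= cos (b * x) + 1.
  by have := cos_max (b * x); rewrite ler_norml => /andP[] + _; rewrite -subr_ge0 opprK.
have E1 := Rint_normal_gauss_ge0 tau0 rho0 hr s0 b1 (fun=> ler01).
have E2 := Rint_normal_gauss_ge0 tau0 rho0 hr s0 (bmD bc b1) h0.
rewrite Rint_cst in E1; rewrite bm_RintD// Rint_cst Rint_normal_cos// in E2.
transitivity (\int[normal_law 0 tau]_x (expR (- (s * x ^+ 2)) * (cos (b * x) + 1) -
    expR (- (s * x ^+ 2)) * 1)).
  by apply: eq_Rintegral => x _; ring.
rewrite bm_RintB; [|by apply: bmM => //; exact: bmD|exact: bmM].
by rewrite E1 E2; ring.
Qed.

End gaussian_smoothing.

Section theta.
Context {R : realType} (mu : probability (XG R) R).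
Variables (s m k s' m' : R).
Hypothesis (s0 : 0 <= s) (s'0 : 0 <= s') (k0 : k != 0).
Hypothesis char0 : forall t, charX mu (t, false) = cexp ((- (s * t ^+ 2)) +i* (m * t)).
Hypothesis char1 : forall t, charX mu (t, true) = k%:C * cexp ((- (s' * t ^+ 2)) +i* (m' * t)).

Let c0E t : cosX mu false t = expR (- (s * t ^+ 2)) * cos (m * t) /\
  sinX mu false t = expR (- (s * t ^+ 2)) * sin (m * t).
Proof. by have := char0 t; rewrite charXE /cexp /= => -[]. Qed.

Let c1E t : cosX mu true t = k * (expR (- (s' * t ^+ 2)) * cos (m' * t)) /\
  sinX mu true t = k * (expR (- (s' * t ^+ 2)) * sin (m' * t)).
Proof.
by have := char1 t; rewrite charXE /cexp [RHS]/GRing.mul /= !mul0r subr0 addr0 => -[].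
Qed.

(** Fubini in both orders. Integrating [y] first leaves the weight [1 + e (-1) ^ k] times
    [exp (- tau ^ 2 (t - x0) ^ 2 / 2)], both nonnegative; integrating over [mu] first leaves the
    characteristic functions. The two values of [e] isolate the two elements of Z(2). *)
Let smoothed_ge0 (e tau x0 : R) : `|e| = 1 -> tau != 0 ->
  0 <= \int[normal_law 0 tau]_y (expR (- (s * y ^+ 2)) * cos ((m - x0) * y) +
      e * k * (expR (- (s' * y ^+ 2)) * cos ((m' - x0) * y))).
Proof.
move=> e1 tau0; pose N := normal_law 0 tau.
pose F (z : XG R * R) := (1 + e * csgn (z.1.2 && true)) * cos (z.2 * (z.1.1 - x0)).
have m1 : measurable_fun setT (fun z : XG R * R => z.2 * (z.1.1 - x0)).
  apply: measurable_funM; first exact: measurable_snd.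
  by apply: measurable_funB => //; exact: (measurableT_comp measurable_fst measurable_fst).
have bF : bm F.
  apply: bmM; last exact: bm_cos.
  apply: bmD; first exact: bm_cst.
  by apply: bmM; [exact: bm_cst|exact: (bm_fst (@bm_csgn R true))].
have w0 (x : XG R) : 0 <= 1 + e * csgn (x.2 && true).
  have : `|e * csgn (x.2 && true)| <= 1 by rewrite normrM e1 /csgn normrX normrN1 expr1n mulr1.
  by rewrite ler_norml => /andP[] + _; lra.
have I1 : 0 <= \int[prodP mu N]_z F z.
  rewrite bm_Rint_prod//; apply: Rintegral_ge0 => x _; rewrite /F /=.
  have bc : bm (fun y : R => cos (y * (x.1 - x0))) by apply: bm_cos; exact: measurable_funM.
  rewrite bm_RintZ// mulr_ge0//.
  rewrite (_ : \int[N]_y cos (y * (x.1 - x0)) = \int[N]_y cos ((x.1 - x0) * y)).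
    by rewrite Rint_normal_cos// expR_ge0.
  by apply: eq_Rintegral => y _; rewrite mulrC.
rewrite bm_Rint_prod2// in I1; apply: le_trans I1 _.
rewrite le_eqVlt; apply/orP; left; apply/eqP; apply: eq_Rintegral => y _.
have [a1 a2] := c0E y; have [a3 a4] := c1E y.
have b1 := @bm_csgn_cos R false y; have b2 := @bm_csgn_sin R false y.
have b3 := @bm_csgn_cos R true y; have b4 := @bm_csgn_sin R true y.
have bZ (c : R) (f : XG R -> R) : bm f -> bm (fun x => c * f x).
  by move=> bf; apply: bmM => //; exact: bm_cst.
transitivity (\int[mu]_x ((cos (x0 * y) * (csgn (x.2 && false) * cos (x.1 * y)) +
   sin (x0 * y) * (csgn (x.2 && false) * sin (x.1 * y))) +
   (e * cos (x0 * y) * (csgn (x.2 && true) * cos (x.1 * y)) +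
   e * sin (x0 * y) * (csgn (x.2 && true) * sin (x.1 * y))))).
  apply: eq_Rintegral => x _; rewrite /F /= andbF.
  have -> : y * (x.1 - x0) = x.1 * y - x0 * y by ring.
  have f1 : csgn false = 1 :> R by rewrite /csgn expr0.
  by rewrite cosB !f1; ring.
rewrite bm_RintD; [|by apply: bmD; exact: bZ..].
rewrite bm_RintD; [|exact: bZ..].
rewrite bm_RintD; [|exact: bZ..].
rewrite !bm_RintZ// -/(cosX mu false y) -/(sinX mu false y) -/(cosX mu true y) -/(sinX mu true y).
rewrite a1 a2 a3 a4 !mulrBl !cosB; ring.
Qed.

(** Squared form of a comparison at the point [x0]: [|k|] times the density of N(m', w + 2 s') is at
    most the density of N(m, w + 2 s). Smoothing by N(0, tau^2) in the dual variable adds the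
    variance [w = tau ^ (-2)]; squaring removes the roots from the normalizing constants. *)
Lemma gaussian_domination (w x0 : R) : 0 < w ->
  k ^+ 2 * (w + 2 * s) * expR ((m - x0) ^+ 2 / (w + 2 * s) - (m' - x0) ^+ 2 / (w + 2 * s')) <=
  w + 2 * s'.
Proof.
move=> w0.
have A0 : 0 < w + 2 * s by rewrite ltr_pwDl// mulr_ge0.
have A'0 : 0 < w + 2 * s' by rewrite ltr_pwDl// mulr_ge0.
have root v : 0 < v -> exists2 q : R, 0 < q & q ^- 2 = v.
  move=> v0; exists (Num.sqrt v^-1); first by rewrite sqrtr_gt0 invr_gt0.
  by rewrite sqr_sqrtr ?invrK// invr_ge0 ltW.
have [tau tau0 tauE] := root _ w0.
have [rho rho0 rhoE] := root _ A0; have [rho' rho'0 rho'E] := root _ A'0.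
have t0 : tau != 0 by rewrite gt_eqF.
have r0 : rho != 0 by rewrite gt_eqF.
have r'0 : rho' != 0 by rewrite gt_eqF.
have mg (v : R) : 0 <= v -> bm (fun x : R => expR (- (v * x ^+ 2))).
  move=> v0; split.
    apply: measurableT_comp => //; apply: measurableT_comp => //; exact: measurable_funM.
  exists 1 => x; rewrite ger0_norm ?expR_ge0// -expR0 ler_expR.
  by rewrite oppr_le0 mulr_ge0// sqr_ge0.
have bc (b : R) : bm (fun x : R => cos (b * x)) by apply: bm_cos; exact: measurable_funM.
set J := normal_peak tau / normal_peak rho * expR (- (rho ^+ 2 / 2 * (m - x0) ^+ 2)).
set J' := normal_peak tau / normal_peak rho' * expR (- (rho' ^+ 2 / 2 * (m' - x0) ^+ 2)).
have sm e : `|e| = 1 -> 0 <= J + e * k * J'.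
  move=> e1; have := smoothed_ge0 x0 e1 t0.
  have bm1 := bmM (mg s s0) (bc (m - x0)); have bm2 := bmM (mg s' s'0) (bc (m' - x0)).
  rewrite bm_RintD//; last by apply: bmM => //; exact: bm_cst.
  rewrite bm_RintZ//.
  by rewrite (Rint_normal_gauss_cos _ t0 r0)// ?(Rint_normal_gauss_cos _ t0 r'0)// ?tauE.
(* The sign [e] opposite to that of [k] gives the bound. *)
have kJ : `|k| * J' <= J.
  have := sm 1; have := sm (-1); rewrite normrN normr1 => /(_ erefl) h1 /(_ erefl) h2.
  by case: (ger0P k) => _; lra.
have pk (q : R) : 0 < q -> (normal_peak q)^-1 = q * (normal_peak 1)^-1.
  move=> q0; rewrite /normal_peak !invrK expr1n mul1r -mulrnAr sqrtrM ?sqr_ge0//.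
  by rewrite sqrtr_sqr ger0_norm ?ltW.
have p1 : 0 < (normal_peak 1)^-1 :> R by rewrite invr_gt0 normal_peak_gt0// oner_neq0.
have pt : 0 < normal_peak tau by rewrite normal_peak_gt0.
have {}kJ : `|k| * rho' * expR (- (rho' ^+ 2 / 2 * (m' - x0) ^+ 2)) <=
    rho * expR (- (rho ^+ 2 / 2 * (m - x0) ^+ 2)).
  move: kJ; rewrite /J /J' (pk rho rho0) (pk rho' rho'0).
  set E' := expR _; set E := expR _; set p := (normal_peak 1)^-1.
  have -> : `|k| * (normal_peak tau * (rho' * p) * E') = (normal_peak tau * p) * (`|k| * rho' * E') by ring.
  have -> : normal_peak tau * (rho * p) * E = (normal_peak tau * p) * (rho * E) by ring.
  by rewrite ler_pM2l// mulr_gt0.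
have {}kJ : k ^+ 2 * rho' ^+ 2 * expR (- (rho' ^+ 2 * (m' - x0) ^+ 2)) <=
    rho ^+ 2 * expR (- (rho ^+ 2 * (m - x0) ^+ 2)).
  have sq (q z : R) : expR (- (q ^+ 2 * z)) = expR (- (q ^+ 2 / 2 * z)) ^+ 2.
    by rewrite [RHS]expr2 -expRD; congr expR; field.
  rewrite !sq -[k ^+ 2]real_normK ?num_real// -!exprMn.
  by apply: lerXn2r => //; rewrite nnegrE ?mulr_ge0 ?expR_ge0 ?normr_ge0 ?ltW//.
have rE : rho ^+ 2 = (w + 2 * s)^-1 by rewrite -rhoE invrK.
have r'E : rho' ^+ 2 = (w + 2 * s')^-1 by rewrite -rho'E invrK.
rewrite rE r'E in kJ.
set E := expR _; set z := (m - x0) ^+ 2 in kJ E *; set z' := (m' - x0) ^+ 2 in kJ E *.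
have EE : E = expR (- ((w + 2 * s')^-1 * z')) / expR (- ((w + 2 * s)^-1 * z)).
  by rewrite -expRN -expRD; congr expR; rewrite opprK addrC ![_^-1 * _]mulrC.
have e0 := expR_gt0 (- ((w + 2 * s)^-1 * z)).
rewrite EE mulrA ler_pdivrMr//.
have AA : 0 <= (w + 2 * s) * (w + 2 * s') by rewrite mulr_ge0 ?ltW.
have {}kJ := ler_wpM2l AA kJ.
have nA : w + 2 * s != 0 by rewrite gt_eqF.
have nA' : w + 2 * s' != 0 by rewrite gt_eqF.
have {1}-> : k ^+ 2 * (w + 2 * s) = (w + 2 * s) * (w + 2 * s') * (k ^+ 2 * (w + 2 * s')^-1).
  by field.
rewrite -mulrA; apply: le_trans kJ _.
rewrite le_eqVlt; apply/orP; left; apply/eqP.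
by rewrite mulrA; congr (_ * _); field.
Qed.

End theta.

(** * Parameters of one Gaussian density dominated by another *)

Section domination_constraints.
Context {R : realType}.
Variables s s' m m' k : R.
Hypothesis (s0 : 0 <= s) (s'0 : 0 <= s') (k0 : k != 0).
Hypothesis dom : forall w x, 0 < w ->
  k ^+ 2 * (w + 2 * s) * expR ((m - x) ^+ 2 / (w + 2 * s) - (m' - x) ^+ 2 / (w + 2 * s')) <=
  w + 2 * s'.

Let k2 : 0 < k ^+ 2.
Proof. by rewrite lt_neqAle sqr_ge0 eq_sym sqrf_eq0 k0. Qed.

Let A0 : 0 < 1 + 2 * s.
Proof. by rewrite ltr_pwDl// mulr_ge0. Qed.

Let A'0 : 0 < 1 + 2 * s'.
Proof. by rewrite ltr_pwDl// mulr_ge0. Qed.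

(** The case [w = 1], with [e < exp e]: a polynomial in [x] of degree at most 2 is bounded above,
    which constrains its leading terms. *)
Lemma domination_exponent (x : R) :
  (m - x) ^+ 2 / (1 + 2 * s) - (m' - x) ^+ 2 / (1 + 2 * s') <
  (1 + 2 * s') / (k ^+ 2 * (1 + 2 * s)).
Proof.
set e := (_ - _); have h := dom x ltr01; rewrite -/e in h.
apply: (@lt_le_trans _ _ (expR e)).
  by apply: lt_le_trans (expR_ge1Dx e); rewrite ltrDr.
by rewrite ler_pdivlMr; [rewrite mulrC|exact: mulr_gt0 k2 A0].
Qed.

Lemma domination_le : s' <= s.
Proof.
rewrite leNgt; apply/negP => ss.
pose A := 1 + 2 * s; pose A' := 1 + 2 * s'.
pose C := A' / (k ^+ 2 * A); pose D := m - m'.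
have C0 : 0 <= C := ltW (divr_gt0 A'0 (mulr_gt0 k2 A0)).
have AA : 0 < A^-1 - A'^-1 by rewrite subr_gt0 ltf_pV2 ?posrE// ltrD2l ltr_pM2l.
(* At [z ^ 2 = y] the exponent reaches the forbidden value [C] up to the cross term [2 z D / A'],
   made nonnegative by the choice of the sign of [z]. *)
pose y := (C + D ^+ 2 / A') / (A^-1 - A'^-1).
have y0 : 0 <= y.
  by apply: divr_ge0 (ltW AA); apply: addr_ge0 => //; exact: divr_ge0 (sqr_ge0 _) (ltW A'0).
have [z z2 zD] : exists2 z : R, z ^+ 2 = y & 0 <= z * D.
  have [d0|d0] := lerP 0 D; [exists (Num.sqrt y)|exists (- Num.sqrt y)].
  - by rewrite sqr_sqrtr.
  - by rewrite mulr_ge0// sqrtr_ge0.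
  - by rewrite sqrrN sqr_sqrtr.
  - by rewrite mulNr -mulrN mulr_ge0 ?sqrtr_ge0// oppr_ge0 ltW.
have := domination_exponent (m - z); rewrite -/A -/A' -/C ltNge => /negP; apply.
have -> : (m - (m - z)) ^+ 2 / A - (m' - (m - z)) ^+ 2 / A' =
    z ^+ 2 * (A^-1 - A'^-1) - D ^+ 2 / A' + 2 * (z * D) / A' by rewrite /D; ring.
rewrite z2 /y mulfVK ?gt_eqF// addrK lerDl; apply: divr_ge0 (ltW A'0); exact: mulr_ge0.
Qed.

Lemma domination_eq : s' = s -> m = m' /\ `|k| <= 1.
Proof.
move=> ss; have mm : m = m'.
  apply/eqP; rewrite -subr_eq0; apply/negPn/negP => D0.
  pose A := 1 + 2 * s; have An : A != 0 by rewrite gt_eqF.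
  (* With equal variances the exponent is affine in [x], of slope proportional to [m - m']; [z] is
     the solution of exponent equal to [C]. *)
  pose C := A / (k ^+ 2 * A); pose z := (C * A + (m - m') ^+ 2) / (2 * (m - m')).
  have := domination_exponent (m - z); rewrite ss -/A -/C.
  have -> : (m - (m - z)) ^+ 2 / A - (m' - (m - z)) ^+ 2 / A = C.
    by rewrite /z; field; rewrite An D0.
  by rewrite ltxx.
split=> //; have := dom m ltr01; rewrite ss -mm subrr expR0 mulr1.
rewrite -[leRHS]mul1r ler_pM2r// -[k ^+ 2]real_normK ?num_real// expr_le1//.
Qed.

Lemma domination_lt : s' < s -> 0 < s' /\
  `|k| <= Num.sqrt (s' / s) * expR (- ((m - m') ^+ 2 / (4 * (s - s')))).
Proof.
move=> ss; set E := expR _.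
have sp : 0 < s by apply: le_lt_trans ss.
have h : k ^+ 2 * s <= s' * E ^+ 2.
  have E2 : E ^+ 2 = expR (- ((m - m') ^+ 2 / (2 * (s - s')))).
    by rewrite expr2 -expRD; congr expR; field; rewrite subr_eq0 gt_eqF.
  suff : k ^+ 2 * (2 * s) * expR ((m - m') ^+ 2 / (2 * (s - s'))) <= 2 * s'.
    rewrite E2 expRN ler_pdivlMr ?expR_gt0//.
    by rewrite mulrCA -mulrA ler_pM2l.
  (* The smoothing variance [w] is itself the error term that tends to 0. *)
  apply/ler_addgt0Pr => w w0; rewrite [leRHS]addrC.
  pose A := w + 2 * s; pose A' := w + 2 * s'.
  have AA : A - A' != 0 by rewrite gt_eqF// subr_gt0 ltrD2l ltr_pM2l.
  have Ap : 0 < A by rewrite ltr_pwDl// mulr_ge0.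
  have A'p : 0 < A' by rewrite ltr_pwDl// mulr_ge0.
  (* The point where the exponent is maximal, its leading coefficient [A^-1 - A'^-1] being negative.
     The maximum [(m - m') ^ 2 / (2 (s - s'))] does not depend on [w]. *)
  have := dom ((m' * A - m * A') / (A - A')) w0; rewrite -/A -/A'.
  have -> : (m - (m' * A - m * A') / (A - A')) ^+ 2 / A -
      (m' - (m' * A - m * A') / (A - A')) ^+ 2 / A' = (m - m') ^+ 2 / (A - A').
    by field; rewrite AA !gt_eqF.
  have -> : A - A' = 2 * (s - s') by rewrite /A /A'; ring.
  apply: le_trans; rewrite ler_pM2r ?expR_gt0// ler_pM2l//.
  by rewrite /A lerDr ltW.
have Ep : 0 < E by exact: expR_gt0.
split.
  have : 0 < s' * E ^+ 2 by apply: lt_le_trans h; rewrite mulr_gt0.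
  by rewrite pmulr_lgt0// exprn_gt0.
rewrite -(@ler_pXn2r _ 2)// ?nnegrE ?mulr_ge0 ?sqrtr_ge0 ?(ltW Ep)//.
rewrite exprMn sqr_sqrtr ?divr_ge0// real_normK ?num_real//.
by rewrite [leRHS]mulrAC ler_pdivlMr.
Qed.

End domination_constraints.

Section theta.
Context {R : realType} (mu : probability (XG R) R).
Variables (s m k s' m' : R).
Hypothesis (s0 : 0 <= s) (s'0 : 0 <= s') (k0 : k != 0).
Hypothesis char0 : forall t, charX mu (t, false) = cexp ((- (s * t ^+ 2)) +i* (m * t)).
Hypothesis char1 : forall t, charX mu (t, true) = k%:C * cexp ((- (s' * t ^+ 2)) +i* (m' * t)).

Let dom w x (w0 : 0 < w) := gaussian_domination s0 s'0 char0 char1 x w0.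

Lemma Theta_of_charX : Theta mu.
Proof.
exists s, s', m, m', k; split=> //.
have := domination_le s0 s'0 k0 dom; rewrite le_eqVlt => /orP[/eqP ss|ss].
  by right; have [mm k1] := domination_eq s0 k0 dom ss; split.
left; have [sp kk] := domination_lt s0 s'0 k0 dom ss; split=> //.
by rewrite normr_gt0.
Qed.

(** If [s' < s], the bound on [|k|] is at most [sqrt (s' / s) < 1]. *)
Lemma extremal_char_eq : `|k| = 1 -> s' = s /\ m = m'.
Proof.
move=> k1.
have := domination_le s0 s'0 k0 dom; rewrite le_eqVlt => /orP[/eqP ss|ss].
  by have [mm _] := domination_eq s0 k0 dom ss; split.
have [sp] := domination_lt s0 s'0 k0 dom ss; rewrite k1 leNgt => /negP[].
have spos : 0 < s by apply: lt_trans ss.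
apply: le_lt_trans (_ : Num.sqrt (s' / s) < 1).
  rewrite ler_piMr ?sqrtr_ge0// -expR0 ler_expR oppr_le0.
  by rewrite divr_ge0 ?sqr_ge0// mulr_ge0// subr_ge0 ltW.
by rewrite -sqrtr1 ltr_sqrt// ltr_pdivrMr// mul1r.
Qed.

End theta.

(** * Conclusions *)

Section extremal_level.
Context {R : realType}.
Implicit Types mu : probability (XG R) R.

Lemma charX0_real mu l : charX mu (0, l) = (cosX mu l 0)%:C.
Proof. by rewrite charXE sinX0. Qed.

Lemma cosX0_neq0 mu l : charX mu (0, l) <> 0 -> cosX mu l 0 != 0.
Proof. by rewrite charX0_real => h; apply/eqP => k0; apply: h; rewrite k0. Qed.

Lemma cosX00 mu : cosX mu false 0 = 1.
Proof. by have := charX00 mu; rewrite charX0_real => /(congr1 (@complex.Re R)). Qed.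

Lemma normr_cosX0_le1 mu l : `|cosX mu l 0| <= 1.
Proof.
have := cosX_sinX_le1 mu l 0 0; have := cosX_sinX_le1 mu l 0 pi.
rewrite cos0 sin0 cospi sinpi !mulr0 !addr0 mulr1 mulrN1 => h1 h2.
by rewrite ler_norml h2 andbT lerNl.
Qed.

Lemma prodr_eq1_norm (n : nat) (Q : pred 'I_n) (k : 'I_n -> R) (i : 'I_n) :
  (forall j, `|k j| <= 1) -> \prod_(j | Q j) k j = 1 -> Q i -> `|k i| = 1.
Proof.
move=> k1 kE Qi; apply/eqP; rewrite eq_le k1 /= leNgt; apply/negP => ki.
have := congr1 Num.norm kE; rewrite normr_prod normr1 (bigD1 i)//= => h.
suff : `|k i| * \prod_(j | Q j && (j != i)) `|k j| < 1 by rewrite h ltxx.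
by apply: le_lt_trans ki; rewrite ler_piMr// prodr_ile1// => j _; rewrite normr_ge0 k1.
Qed.

Lemma cexp_split (x y : R) : cexp (x +i* y) = cexp (0 +i* y) * (expR x)%:C.
Proof.
rewrite /cexp [RHS]/GRing.mul /= expR0 !mul1r !mulr0 subr0 add0r.
by congr (_ +i* _); rewrite mulrC.
Qed.

Lemma Gamma_of_charX mu s m k : 0 <= s -> `|k| = 1 ->
  (forall t, charX mu (t, false) = cexp ((- (s * t ^+ 2)) +i* (m * t))) ->
  (forall t, charX mu (t, true) = k%:C * cexp ((- (s * t ^+ 2)) +i* (m * t))) ->
  Gamma mu.
Proof.
(* [k] is 1 or -1, hence the value at level 1 of the character given by an element of Z(2), the
   nonzero one when [k = -1]. *)
move=> s0 k1 c0 c1; exists (m, k == -1), (fun y => s * y.1 ^+ 2); split.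
- by move=> y; rewrite mulr_ge0// sqr_ge0.
- move=> y; apply: cvgMl_tmp; apply: (@continuous_comp _ _ _ fst (fun x : R => x ^+ 2)).
    exact: cvg_fst.
  exact: exprn_continuous.
- by move=> u v /=; ring.
move=> [t l]; rewrite /pairing /=; case: l.
  rewrite c1 (cexp_split (- _)) andbT mulrA; congr (_ * _); rewrite mulrC; congr (_ * _).
  have : k ^+ 2 = 1 by rewrite -real_normK ?num_real// k1 expr1n.
  move/eqP; rewrite sqrf_eq1 => /orP[]/eqP ->; last by rewrite eqxx expr1 raddfN.
  by rewrite -subr_eq0 opprK gt_eqF// expr0.
by rewrite c0 (cexp_split (- _)) andbF expr0 mulr1.
Qed.

End extremal_level.

Section gaussian_conclusions.
Context {R : realType} {n : nat}.
Variables (mu : 'I_n -> probability (XG R) R) (a b c d : 'I_n -> XG R -> XG R).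
Hypothesis char_neq0 : forall j y, charX (mu j) y <> 0.
Hypothesis char_eq : forall u v, \prod_j charX (mu j) (adj (a j) u + adj (b j) v) =
    \prod_j charX (mu j) (adj (c j) u + adj (d j) v).
Variable i : 'I_n.

Lemma level_exists : snd_coef (a i) = 1 \/ snd_coef (b i) = 1 ->
  exists l, level a b l i = true.
Proof.
case=> h; [exists (true, false)|exists (false, true)]; by rewrite /level h /= andbF.
Qed.

(** At [u = (0, b_i'')], [v = (0, a_i'')] the right-hand levels are [a_i'' d_j'' + b_i'' c_j'' = 1]
    for every [j], while the left-hand level of [i] is [2 a_i'' b_i'' = 0]. The factors at level 1
    on the left also occur on the right; cancelling them leaves 1 as the product of the remaining
    [kappa_j], that of [i] included. *)
Lemma extremal_level_norm :
  (forall j, (snd_coef (a i) && snd_coef (d j)) (+) (snd_coef (b i) && snd_coef (c j))) ->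
  `|cosX (mu i) true 0| = 1.
Proof.
move=> h; pose l := (snd_coef (b i), snd_coef (a i)).
have lc j : level c d l j = true.
  by rewrite /level /= -(h j) addbC andbC [snd_coef (c j) && _]andbC.
have li : level a b l i = false by rewrite /level /= andbC addbb.
have := char_eq (0, l.1) (0, l.2).
rewrite (eq_bigr (fun j => (cosX (mu j) (level a b l j) 0)%:C)); last first.
  by move=> j _; rewrite (@adj_coefs R n a b (0, 0)) /= !mulr0 addr0 charX0_real.
rewrite [RHS](eq_bigr (fun j => (cosX (mu j) true 0)%:C)); last first.
  by move=> j _; rewrite (@adj_coefs R n c d (0, 0)) /= !mulr0 addr0 lc charX0_real.
rewrite -!rmorph_prod => /(congr1 (@complex.Re R)) /=.
rewrite (bigID (level a b l)) [RHS](bigID (level a b l)) /=.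
rewrite [X in _ * X = _]big1 => [|j /negbTE ->]; last exact: cosX00.
rewrite (eq_bigr (fun j => cosX (mu j) true 0)) => [|j -> //].
move/(mulfI _) => /(_ _)/esym E.
apply: (@prodr_eq1_norm R n (fun j => ~~ level a b l j) (fun j => cosX (mu j) true 0)).
- by move=> j; exact: normr_cosX0_le1.
- apply: E; apply/prodf_neq0 => j _; apply: cosX0_neq0; exact: char_neq0.
by rewrite li.
Qed.

Hypothesis hdet : forall j, det2 (coefs a b i) (coefs c d j) <> 0.

Lemma Lambda_forms : Lambda (mu i).
Proof.
have [s [m [s0 h _]]] := charX_gaussian_marginal char_neq0 char_eq hdet.
exact: Lambda_of_charX s0 h.
Qed.

Hypothesis hlevel : snd_coef (a i) = 1 \/ snd_coef (b i) = 1.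

Lemma charX_forms : exists s m s' m' : R,
  [/\ 0 <= s, 0 <= s',
    forall t, charX (mu i) (t, false) = cexp ((- (s * t ^+ 2)) +i* (m * t)) &
    forall t, charX (mu i) (t, true) =
      (cosX (mu i) true 0)%:C * cexp ((- (s' * t ^+ 2)) +i* (m' * t))].
Proof.
have [s [m [s0 h _]]] := charX_gaussian_marginal char_neq0 char_eq hdet.
have [l li] := level_exists hlevel.
have [s' [m' h']] := charX_level_one char_neq0 char_eq hdet li.
exists s, m, s', m'; split=> //; apply: (cexp_quadratic_sigma_ge0 _ h').
by apply: cosX0_neq0; exact: char_neq0.
Qed.

Let k0 : cosX (mu i) true 0 != 0.
Proof. by apply: cosX0_neq0; exact: char_neq0. Qed.

Lemma Theta_forms : Theta (mu i).
Proof.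
have [s [m [s' [m' [s0 s'0 h h']]]]] := charX_forms.
exact: Theta_of_charX s0 s'0 k0 h h'.
Qed.

Lemma Gamma_forms : `|cosX (mu i) true 0| = 1 -> Gamma (mu i).
Proof.
move=> k1; have [s [m [s' [m' [s0 s'0 h h']]]]] := charX_forms.
have [ss mm] := extremal_char_eq s0 s'0 k0 h h' k1; rewrite ss -mm in h'.
exact: Gamma_of_charX s0 k1 h h'.
Qed.

End gaussian_conclusions.

(** A vanishing coefficient would put [(1, 0)] or [(0, 1)] in the kernel. *)
Lemma is_Aut_det (R : realType) (a b c d : XG R -> XG R) :
  is_End a -> is_End b -> is_End c -> is_End d -> is_Aut ((a \o d) \- (b \o c)) ->
  fst_coef a * fst_coef d - fst_coef b * fst_coef c <> 0 /\
  (snd_coef a && snd_coef d) (+) (snd_coef b && snd_coef c).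
Proof.
move=> aE bE cE dE [_ [g [_ FK _]]].
have FE t k : ((a \o d) \- (b \o c)) (t, k) =
   ((fst_coef a * fst_coef d - fst_coef b * fst_coef c) * t,
    ((snd_coef a && snd_coef d) (+) (snd_coef b && snd_coef c)) && k).
  rewrite /= (is_EndE dE) (is_EndE cE) (is_EndE aE) (is_EndE bE); congr pair.
    by rewrite /=; ring.
  by rewrite /= -[RHS]/(_ && _) andb_addl -!andbA.
split.
  move=> D0; have : ((1, false) : XG R) = (0, false).
    by apply: (can_inj FK); rewrite !FE D0 !mul0r.
  by case=> /eqP; rewrite oner_eq0.
apply/negPn/negP => /negbTE D0; have : ((0, true) : XG R) = (0, false).
  by apply: (can_inj FK); rewrite !FE D0.
by [].
Qed.

Theorem theorem1 (R : realType) (disp : measure_display) (T : measurableType disp)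
  (P : probability T R) (n : nat)
  (xi : 'I_n -> {RV P >-> XG R})
  (a b c d : 'I_n -> XG R -> XG R)
  (xi_indep : independent_RVs xi)
  (char_neq0 : forall j y, charX (distribution P (xi j)) y <> 0)
  (aE : forall j, is_End (a j)) (bE : forall j, is_End (b j))
  (cE : forall j, is_End (c j)) (dE : forall j, is_End (d j))
  (L12_L34 : identically_distributed P
     (fun w => (linear_form a xi w, linear_form b xi w))
     (fun w => (linear_form c xi w, linear_form d xi w))) :
  [/\ forall i : 'I_n,
        (forall j, is_Aut ((a i \o d j) \- (b i \o c j))) ->
        Gamma (distribution P (xi i)),
      forall i : 'I_n,
        (forall j, fst_coef (a i) * fst_coef (d j)
                   - fst_coef (b i) * fst_coef (c j) <> 0) ->
        (snd_coef (a i) = 1 \/ snd_coef (b i) = 1) ->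
        Theta (distribution P (xi i)) &
      forall i : 'I_n,
        (forall j, fst_coef (a i) * fst_coef (d j)
                   - fst_coef (b i) * fst_coef (c j) <> 0) ->
        Lambda (distribution P (xi i))].
Proof.
have char_eq := functional_equation xi_indep aE bE cE dE L12_L34.
split=> i; first last.
- by move=> hdet; exact: (Lambda_forms char_neq0 char_eq hdet).
- by move=> hdet hl; exact: (Theta_forms char_neq0 char_eq hdet hl).
move=> hA; have hj j := is_Aut_det (aE i) (bE i) (cE j) (dE j) (hA j).
have hdet j := (hj j).1; have hs j := (hj j).2.
apply: (Gamma_forms char_neq0 char_eq hdet).
  (* The case [j = i] of the condition modulo 2: if [a_i''] and [b_i''] were both 0, the determinant
     would be 0. *)
  by have := hs i; case: (snd_coef (a i)) => [|/=]; [left|case: (snd_coef (b i)) => //; right].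
exact: (extremal_level_norm char_neq0 char_eq hs).
Qed.
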